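(* Let $n\ge 1$ and let $T_n$ be a polynomial of degree $n$ with complex coefficients. Let $\nu\geq 1$ be an integer and let $b_1,b_2,\ldots,b_{2\nu}\in\mathbb{C}$ be a list of (not necessarily distinct) points. Then $T_n^{-1}([-1,1])$ consists of $\nu$ (but not less than $\nu$) analytic Jordan arcs with endpoints $b_1,b_2,\ldots,b_{2\nu}$ if and only if $T_n^2-1$ has exactly $2\nu$ zeros of odd multiplicity, written according to their multiplicity, and these are $b_1,b_2,\ldots,b_{2\nu}$ (that is, $b_1,\ldots,b_{2\nu}$ is the list of all zeros of $T_n^2-1$ whose multiplicity is odd, each such zero of multiplicity $m$ being listed exactly $m$ times).
   Context: For a polynomial $T_n$, $T_n^{-1}([-1,1]):=\{z\in\mathbb{C}: T_n(z)\in[-1,1]\}$. A Jordan arc is the image of an injective continuous map $\gamma:[0,1]\to\mathbb{C}$, with endpoints $\gamma(0),\gamma(1)$; it is analytic if $\gamma$ can be chosen real-analytic on $[0,1]$ with $\gamma'(t)\ne 0$ for all $t$. A set ''consists of $\nu$ (analytic) Jordan arcs with endpoints $b_1,\dots,b_{2\nu}$'' if it is the union of $\nu$ (analytic) Jordan arcs which do not overlap (any two of them have at most finitely many points in common; they may cross or share endpoints), and the list of the $2\nu$ endpoints of these arcs (two per arc, repetitions allowed) is $b_1,\dots,b_{2\nu}$ up to order. ''But not less than $\nu$'' means that the set is not a union of fewer than $\nu$ such non-overlapping (analytic) Jordan arcs. *)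

(* Defs.v *)
From HB Require Import structures.
From mathcomp Require Import all_boot all_order all_algebra.
From mathcomp Require Import all_classical all_reals all_analysis.
From mathcomp Require Import complex.
Set Implicit Arguments.
Unset Strict Implicit.
Unset Printing Implicit Defensive.
Import Order.TTheory GRing.Theory Num.Theory.
Import numFieldNormedType.Exports.
Local Open Scope classical_set_scope.
Local Open Scope ring_scope.
Local Open Scope complex_scope.

(* A curve is a map g : R -> R[i] of which only the restriction to [0, 1]
   matters for its image and injectivity.  Its regularity is expressed on the
   coordinate functions Re o g and Im o g, since the real topological vector
   space structure of R[i] is not available in the library. *)

Definition arc_image (R : realType) (g : R -> R[i]) : set R[i] :=
  g @` `[0, 1].

Definition jordan_param (R : realType) (g : R -> R[i]) : Prop :=
  [/\ {in `[0, 1]%R &, injective g},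
      {within `[0, 1], continuous (fun t => complex.Re (g t))} &
      {within `[0, 1], continuous (fun t => complex.Im (g t))}].

Definition real_analytic_at (R : realType) (f : R -> R) (t0 : R) : Prop :=
  exists a : nat -> R, \forall t \near t0, pseries a (t - t0) @ \oo --> f t.

Definition curve_derive (R : realType) (g : R -> R[i]) (t : R) : R[i] :=
  derive1 (fun s => complex.Re (g s)) t +i*
  derive1 (fun s => complex.Im (g s)) t.

(* Analyticity is required on two-sided neighbourhoods of every point of
   [0, 1], the end points included: a function given by power series on [0, 1]
   extends analytically beyond 0 and 1, and the values of g off [0, 1] are
   otherwise unused. *)
Definition analytic_jordan_param (R : realType) (g : R -> R[i]) : Prop :=
  jordan_param g /\
  forall t, t \in `[0, 1]%R ->
    [/\ real_analytic_at (fun s => complex.Re (g s)) t,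
        real_analytic_at (fun s => complex.Im (g s)) t &
        curve_derive g t != 0].

Definition consists_of_analytic_arcs (R : realType) (E : set R[i])
    (nu : nat) (b : seq R[i]) : Prop :=
  exists g : 'I_nu -> R -> R[i],
    [/\ forall k, analytic_jordan_param (g k),
        E = \bigcup_(k in [set: 'I_nu]) arc_image (g k),
        forall k l, k != l ->
          finite_set (arc_image (g k) `&` arc_image (g l)) &
        perm_eq b (flatten [seq [:: g k 0; g k 1] | k <- enum 'I_nu])].

Definition consists_of_no_less_analytic_arcs (R : realType) (E : set R[i])
    (nu : nat) (b : seq R[i]) : Prop :=
  consists_of_analytic_arcs E nu b /\
  forall (m : nat) (c : seq R[i]),
    (m < nu)%N -> ~ consists_of_analytic_arcs E m c.

Definition inverse_image_segment (R : realType) (T : {poly R[i]}) :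
    set R[i] :=
  (horner T) @^-1` ((fun x : R => x%:C) @` `[-1, 1]).

(* A point that is not a zero has multiplicity 0, hence is not listed. *)
Definition lists_odd_zeros (R : realType) (p : {poly R[i]}) (b : seq R[i]) :
    Prop :=
  forall z : R[i], count_mem z b = if odd (mup z p) then mup z p else 0%N.

(* Main.v *)
Require Import Defs.
From mathcomp Require Import all_boot all_order all_algebra.
From mathcomp Require Import all_classical all_reals all_analysis.
From mathcomp Require Import complex ring lra zify separable.
Set Implicit Arguments.
Unset Strict Implicit.
Unset Printing Implicit Defensive.
Import Order.TTheory GRing.Theory Num.Theory.
Import numFieldNormedType.Exports.
Local Open Scope classical_set_scope.
Local Open Scope ring_scope.
Local Open Scope complex_scope.

(** Let E be the inverse image of [-1,1] under T.  The theorem holds because E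
    leaves each of its points in a definite finite set of directions, and what
    matters is whether these directions come in opposite pairs.

    Local structure.  At a point z of E write T = T(z) + c (x - z)^k + ... with
    c nonzero.  The curves through z on which T is real have the 2k unit
    tangents d with c d^k real.  For each of them [germ_exists] gives an analytic
    unit-speed curve.  At a critical point the usual parametrisation by T is
    singular, but the unit tangent u satisfies an equation u' = i Im(B u) u
    with B regular; it becomes polynomial after adding unknowns, and
    [analytic_ode] solves it by majorants.  If T(z) lies strictly between -1
    and 1, then all 2k directions point into E; if T(z) is 1 or -1, then the k
    directions in which T moves towards 0 do.  In the second case k is the
    multiplicity of z as a zero of T^2 - 1, because T - 1 and T + 1 have no
    common zero.  Hence the inward directions come in opposite pairs exactly
    when z is not a zero of odd multiplicity ([inward_opp], [inward_not_opp]).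

    Lower bound.  Let any regular arcs cover E, and let z be a zero of odd
    multiplicity m.  Each of the m inward directions is the direction of an arc
    at z.  No arc has z in its interior, for it would take two opposite
    directions; so at least m ends lie at z ([odd_lower]).

    A decomposition that attains the bound.  Call a curve nice if near each of
    its points it is one of the chosen germs.  A nice curve in E is determined
    by a point and its tangent there ([nice_agree]).  It cannot close up: the
    winding number of a simple loop changes by a full turn across the loop
    ([wind_jump]), whereas the maximum principle for Im T shows that the loop
    turns around no point off E ([wind_off_E]).  So nice curves in E are simple
    arcs ([nice_injective]), and two of them with a common point and tangent
    line unite to one ([arc_merge]).  Since T - x has n zeros with multiplicity,
    the germs over x0 account for all points of E over nearby values x, and
    finitely many arcs cover E ([cover_side], [E_covered]).  Take the least
    number of them.  No two can be merged, so they meet in finitely many points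
    ([min_finite]).  They end only at zeros of odd multiplicity, since elsewhere
    E continues in the opposite direction ([min_end_odd]), and different ends at
    one point have different directions ([min_end_inj]).  Therefore exactly m
    ends lie at a zero of odd multiplicity m ([odd_decomposition]).

    Consequently the zeros of odd multiplicity occur, with multiplicity, among
    the ends of every decomposition, and they are all of the ends exactly when
    the number of arcs is least. *)
Notation Re := complex.Re.
Notation Im := complex.Im.
Notation normc := Normc.normc.

(** * Complex numbers and their real-valued modulus *)

Section Modulus.
Variable R : realType.
Implicit Types (z w : R[i]) (x y : R).

Lemma ReD z w : Re (z + w) = Re z + Re w. Proof. by case: z; case: w. Qed.
Lemma ImD z w : Im (z + w) = Im z + Im w. Proof. by case: z; case: w. Qed.
Lemma ReN z : Re (- z) = - Re z. Proof. by case: z. Qed.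
Lemma ImN z : Im (- z) = - Im z. Proof. by case: z. Qed.
Lemma ReB z w : Re (z - w) = Re z - Re w. Proof. by rewrite ReD ReN. Qed.
Lemma ImB z w : Im (z - w) = Im z - Im w. Proof. by rewrite ImD ImN. Qed.
Lemma ReM z w : Re (z * w) = Re z * Re w - Im z * Im w.
Proof. by case: z; case: w. Qed.
Lemma ImM z w : Im (z * w) = Re z * Im w + Im z * Re w.
Proof. by case: z; case: w. Qed.
Lemma ReMr z x : Re (z * x%:C) = Re z * x.
Proof. by rewrite ReM /= mulr0 subr0. Qed.
Lemma ImMr z x : Im (z * x%:C) = Im z * x.
Proof. by rewrite ImM /= mulr0 add0r. Qed.
Lemma ReJ z : Re (conjc z) = Re z. Proof. by case: z. Qed.
Lemma ImJ z : Im (conjc z) = - Im z. Proof. by case: z. Qed.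
Lemma complex_ext z w : Re z = Re w -> Im z = Im w -> z = w.
Proof. by case: z; case: w => ? ? ? ? /= -> ->. Qed.
Lemma Im0_real z : Im z = 0 -> z = (Re z)%:C.
Proof. by move=> h; apply: complex_ext. Qed.

Lemma normc_ge0 z : 0 <= normc z.
Proof. by case: z => a b; rewrite sqrtr_ge0. Qed.
Lemma normc_eq0 z : (normc z == 0) = (z == 0).
Proof.
apply/eqP/eqP => [|->]; first exact: Normc.eq0_normc.
exact: Normc.normc0.
Qed.
Lemma normc_gt0 z : (0 < normc z) = (z != 0).
Proof. by rewrite lt_neqAle normc_ge0 andbT eq_sym normc_eq0. Qed.
Lemma normcM z w : normc (z * w) = normc z * normc w.
Proof. exact: Normc.normcM. Qed.
Lemma normcD z w : normc (z + w) <= normc z + normc w.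
Proof. exact: le_normcD. Qed.
Lemma normcN z : normc (- z) = normc z.
Proof. exact: normcN. Qed.
Lemma normcB z w : normc (z - w) = normc (w - z).
Proof. by rewrite -normcN opprB. Qed.
Lemma normcV z : normc z^-1 = (normc z)^-1.
Proof. exact: Normc.normcV. Qed.
Lemma normc0 : normc (0 : R[i]) = 0. Proof. exact: Normc.normc0. Qed.
Lemma normc1 : normc (1 : R[i]) = 1. Proof. exact: Normc.normc1. Qed.
Lemma normcR x : normc x%:C = `|x|.
Proof. by rewrite /= expr0n addr0 sqrtr_sqr. Qed.
Lemma normcX z n : normc (z ^+ n) = normc z ^+ n.
Proof. by elim: n => [|n IH]; rewrite ?expr0 ?normc1 // !exprS normcM IH. Qed.
Lemma sqr_normc_ReIm z : normc z ^+ 2 = Re z ^+ 2 + Im z ^+ 2.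
Proof. by case: z => a b; rewrite sqr_sqrtr ?addr_ge0 ?sqr_ge0. Qed.
Lemma normc_Re z : `|Re z| <= normc z.
Proof.
by rewrite -ler_sqr ?nnegrE ?normc_ge0 // sqr_normc_ReIm real_normK ?num_real// lerDl sqr_ge0.
Qed.
Lemma normc_Im z : `|Im z| <= normc z.
Proof.
by rewrite -ler_sqr ?nnegrE ?normc_ge0 // sqr_normc_ReIm real_normK ?num_real// lerDr sqr_ge0.
Qed.
Lemma normc_le_ReIm z : normc z <= `|Re z| + `|Im z|.
Proof.
rewrite -ler_sqr ?nnegrE ?normc_ge0 ?addr_ge0 // sqr_normc_ReIm.
rewrite sqrrD !real_normK ?num_real//.
have : 0 <= `|Re z| * `|Im z| by rewrite mulr_ge0.
by rewrite mulr2n; lra.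
Qed.
Lemma normcBD z w v : normc (z - v) <= normc (z - w) + normc (w - v).
Proof. by have := normcD (z - w) (w - v); rewrite addrA subrK. Qed.
Lemma normc_ge_sub z w : normc z - normc w <= normc (z - w).
Proof. by have := normcD (z - w) w; rewrite subrK; lra. Qed.
Lemma normc_conj z : normc (conjc z) = normc z.
Proof. by case: z => a b /=; rewrite sqrrN. Qed.
Lemma normc_sum (I : Type) (r : seq I) (F : I -> R[i]) :
  normc (\sum_(i <- r) F i) <= \sum_(i <- r) normc (F i).
Proof.
elim: r => [|i r IH]; first by rewrite !big_nil normc0.
by rewrite !big_cons (le_trans (normcD _ _)) // lerD2l.
Qed.

End Modulus.

Section RealAux.
Variable R : realType.

Lemma minr_gt0_le3 (x y z : R) : 0 < x -> 0 < y -> 0 < z ->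
  exists d, [/\ 0 < d, d <= x, d <= y & d <= z].
Proof.
move=> x0 y0 z0; exists (Num.min x (Num.min y z)).
by split; rewrite ?lt_min ?x0 ?y0 ?z0 // !ge_min lexx ?orbT.
Qed.

Lemma exists_pos_lt2 (x y : R) : 0 < x -> 0 < y -> exists s, [/\ 0 < s, s < x & s < y].
Proof.
move=> x0 y0; exists (Num.min x y / 2).
have m0 : 0 < Num.min x y by rewrite lt_min x0.
have mx : Num.min x y <= x by rewrite ge_min lexx.
have my : Num.min x y <= y by rewrite ge_min lexx orbT.
by split; move: m0 mx my; clear; lra.
Qed.

Lemma normr1P (x : R) : `|x| = 1 -> x = 1 \/ x = -1.
Proof. by case: (ger0P x) => _ <-; [left|right; rewrite opprK]. Qed.

End RealAux.

(** * Complex-valued functions of a real variable *)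

Section ComplexDerivative.
Variable R : realType.
Implicit Types (f g : R -> R[i]) (t x y : R) (l m : R[i]).

Definition cder f t l : Prop :=
  is_derive t (1 : R) (fun s => Re (f s) : R) (Re l) /\
  is_derive t (1 : R) (fun s => Im (f s) : R) (Im l).

Lemma cder_eq f t l m : cder f t l -> l = m -> cder f t m.
Proof. by move=> h <-. Qed.

Lemma cder_cst z t : cder (fun=> z) t 0.
Proof. by split; exact: is_derive_cst. Qed.

Lemma cder_add f g t l m : cder f t l -> cder g t m ->
  cder (fun s => f s + g s) t (l + m).
Proof.
move=> [f1 f2] [g1 g2]; split.
- rewrite ReD; have := is_deriveD f1 g1; congr (is_derive _ _ _ _).
  by apply/funext => s; rewrite ReD.
- rewrite ImD; have := is_deriveD f2 g2; congr (is_derive _ _ _ _).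
  by apply/funext => s; rewrite ImD.
Qed.

Lemma cder_mul f g t l m : cder f t l -> cder g t m ->
  cder (fun s => f s * g s) t (l * g t + f t * m).
Proof.
move=> [f1 f2] [g1 g2]; split.
- have := is_deriveB (is_deriveM f1 g1) (is_deriveM f2 g2).
  congr (is_derive _ _ _ _).
    by apply/funext => s; rewrite ReM.
  by rewrite ReD !ReM /GRing.scale /=; ring.
- have := is_deriveD (is_deriveM f1 g2) (is_deriveM f2 g1).
  congr (is_derive _ _ _ _).
    by apply/funext => s; rewrite ImM.
  by rewrite ImD !ImM /GRing.scale /=; ring.
Qed.

Lemma cder_opp f t l : cder f t l -> cder (fun s => - f s) t (- l).
Proof.
move=> [f1 f2]; split.
- rewrite ReN; have := is_deriveN f1; congr (is_derive _ _ _ _).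
  by apply/funext => s; rewrite ReN.
- rewrite ImN; have := is_deriveN f2; congr (is_derive _ _ _ _).
  by apply/funext => s; rewrite ImN.
Qed.

Lemma cder_sub f g t l m : cder f t l -> cder g t m ->
  cder (fun s => f s - g s) t (l - m).
Proof. by move=> hf hg; apply: cder_add => //; exact: cder_opp. Qed.

Lemma cder_conj f t l : cder f t l -> cder (fun s => conjc (f s)) t (conjc l).
Proof.
move=> [f1 f2]; split.
- rewrite ReJ; move: f1; congr (is_derive _ _ _ _).
  by apply/funext => s; rewrite ReJ.
- rewrite ImJ; have := is_deriveN f2; congr (is_derive _ _ _ _).
  by apply/funext => s; rewrite ImJ.
Qed.

Lemma cder_mulr (z : R[i]) f t l : cder f t l -> cder (fun s => z * f s) t (z * l).
Proof.
move=> hf; apply: cder_eq (cder_mul (cder_cst z t) hf) _.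
by rewrite mul0r add0r.
Qed.

Lemma cder_exp f t l n : cder f t l ->
  cder (fun s => f s ^+ n) t (n%:R * f t ^+ n.-1 * l).
Proof.
move=> hf; elim: n => [|n IH].
  by rewrite !mul0r; exact: cder_cst.
have -> : (fun s => f s ^+ n.+1) = (fun s => f s * f s ^+ n).
  by apply/funext => s; rewrite exprS.
apply: cder_eq (cder_mul hf IH) _ => /=.
case: n {IH} => [|n] /=; first by rewrite expr0; ring.
rewrite exprS -[n.+2%:R]natr1; ring.
Qed.

Lemma cder_horner (p : {poly R[i]}) f t l : cder f t l ->
  cder (fun s => p.[f s]) t (p^`().[f t] * l).
Proof.
move=> hf; elim/poly_ind: p => [|p c IH].
  have -> : (fun s => (0 : {poly R[i]}).[f s]) = (fun=> 0).
    by apply/funext => s; rewrite horner0.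
  by rewrite deriv0 horner0 mul0r; exact: cder_cst.
have -> : (fun s => (p * 'X + c%:P).[f s]) = (fun s => p.[f s] * f s + c).
  by apply/funext => s; rewrite !hornerE.
apply: cder_eq (cder_add (cder_mul IH hf) (cder_cst c t)) _.
rewrite derivD derivC derivM derivX !hornerE; ring.
Qed.

Lemma cder_near f g t l : (\forall s \near t, f s = g s) -> cder f t l -> cder g t l.
Proof.
move=> fg [f1 f2]; split.
- by apply: near_eq_is_derive f1; apply: filterS fg => s ->.
- by apply: near_eq_is_derive f2; apply: filterS fg => s ->.
Qed.

Lemma cder_comp_affine f (a b : R) t l : cder f (a + b * t) l ->
  cder (fun s => f (a + b * s)) t (b%:C * l).
Proof.
have hd : is_derive t (1 : R) (fun s : R => a + b * s) b.
  have h := is_deriveD (is_derive_cst a t (1 : R))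
     (is_deriveM (is_derive_cst b t (1 : R)) (is_derive_id t (1 : R))).
  apply: is_derive_eq h _.
  by rewrite /GRing.scale /= mulr1 mulr0 addr0 add0r.
move=> [f1 f2]; split.
- have := is_derive1_comp (f := fun s => Re (f s)) (g := fun s => a + b * s) f1 hd.
  by rewrite ReM /= mul0r subr0 mulrC.
- have := is_derive1_comp (f := fun s => Im (f s)) (g := fun s => a + b * s) f2 hd.
  by rewrite ImM /= mul0r addr0 mulrC.
Qed.

Lemma is_derive_expand (f : R -> R) t (l : R) : is_derive t (1 : R) f l ->
  forall k, 0 < k -> exists2 d, 0 < d & forall h, `|h| < d ->
    `|f (t + h) - f t - l * h| <= k * `|h|.
Proof.
move=> [df dl] k k0.
have : h^-1 *: ((f \o shift t) (h *: (1 : R)) - f t) @[h --> 0^'] --> l.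
  by rewrite -dl; exact: df.
move=> /cvgrPdist_le/(_ k k0).
move=> /nbhs_ballP[d /= d0 H]; exists d => // h hd.
have [->|h0] := eqVneq h 0.
  by rewrite addr0 subrr mulr0 subr0 normr0 mulr0.
have := H h; rewrite /ball /= sub0r normrN => /(_ hd h0).
rewrite /GRing.scale /= mulr1 (addrC h) => H1.
have -> : f (t + h) - f t - l * h = - (l - h^-1 * (f (t + h) - f t)) * h.
  by rewrite mulNr mulrBl mulrAC mulVf // mul1r opprB.
by rewrite normrM normrN ler_wpM2r.
Qed.

Lemma cder_expand f t l : cder f t l ->
  forall k, 0 < k -> exists2 d, 0 < d & forall h, `|h| < d ->
    normc (f (t + h) - f t - l * h%:C) <= k * `|h|.
Proof.
move=> [f1 f2] k k0.
have k2 : 0 < k / 2 by lra.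
have [d1 d10 H1] := is_derive_expand f1 k2.
have [d2 d20 H2] := is_derive_expand f2 k2.
exists (Num.min d1 d2); first by rewrite lt_min d10.
move=> h; rewrite lt_min => /andP[h1 h2].
apply: le_trans (normc_le_ReIm _) _.
rewrite !ReB !ImB ReMr ImMr.
have := H1 _ h1; have := H2 _ h2; lra.
Qed.

Lemma cder_cont f t l : cder f t l ->
  forall e, 0 < e -> exists2 d, 0 < d & forall s, `|s - t| < d ->
    normc (f s - f t) < e.
Proof.
move=> hf e e0; have [d d0 H] := cder_expand hf ltr01.
have p0 : 0 < e / (normc l + 1) / 2.
  by rewrite !divr_gt0 // ltr_wpDl ?normc_ge0.
exists (Num.min d (e / (normc l + 1) / 2)); first by rewrite lt_min d0.
move=> s; rewrite lt_min => /andP[h1 h2].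
have := H _ h1; rewrite (addrC t) subrK mul1r => H1.
have := normcD (f s - f t - l * (s - t)%:C) (l * (s - t)%:C).
rewrite subrK => H2; apply: le_lt_trans H2 _.
rewrite normcM normcR.
have H3 : (normc l + 1) * `|s - t| < e.
  rewrite mulrC -ltr_pdivlMr ?ltr_wpDl ?normc_ge0 //.
  by apply: lt_trans h2 _; rewrite ltr_pdivrMr // ltr_pMr ?ltr1n // divr_gt0 // ltr_wpDl ?normc_ge0.
move: H3; rewrite mulrDl mul1r; lra.
Qed.

Lemma derive_lower (F dF : R -> R) x y (m : R) : x <= y ->
  (forall t, x <= t <= y -> is_derive t (1 : R) F (dF t)) ->
  (forall t, x <= t <= y -> m <= dF t) ->
  m * (y - x) <= F y - F x.
Proof.
move=> xy dFP hm.
have cF : {within `[x, y]%classic, continuous F}.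
  apply: derivable_within_continuous => t /itvP ht.
  by have [] := dFP t _; rewrite ?ht.
have dF' t : t \in `]x, y[%R -> is_derive t (1 : R) F (dF t).
  by move=> /itvP ht; apply: dFP; rewrite !ltW ?ht.
have [c /itvP hc ->] := MVT_segment xy dF' cF.
by rewrite ler_wpM2r ?subr_ge0 // hm ?hc.
Qed.

Lemma derive_upper (F dF : R -> R) x y (m : R) : x <= y ->
  (forall t, x <= t <= y -> is_derive t (1 : R) F (dF t)) ->
  (forall t, x <= t <= y -> dF t <= m) ->
  F y - F x <= m * (y - x).
Proof.
move=> xy dFP hm.
have h1 t : x <= t <= y -> is_derive t (1 : R) (fun t => - F t) (- dF t).
  by move=> /dFP h; have := is_deriveN h.
have := @derive_lower (fun t => - F t) (fun t => - dF t) x y (- m) xy h1.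
rewrite mulNr opprK => H.
have {}H : - (m * (y - x)) <= - F y + F x.
  by apply: H => t /hm; rewrite lerN2.
lra.
Qed.

(** The mean value inequality for complex-valued functions; the constant 2
    comes from treating the two coordinates separately. *)
Lemma cder_mvt f f' x y l (k : R) : x <= y ->
  (forall t, x <= t <= y -> cder f t (f' t)) ->
  (forall t, x <= t <= y -> normc (f' t - l) <= k) ->
  normc (f y - f x - l * (y - x)%:C) <= 2 * k * (y - x).
Proof.
move=> xy hf hk.
have hR t : x <= t <= y -> `|Re (f' t) - Re l| <= k.
  by move=> /hk; apply: le_trans; rewrite -ReB normc_Re.
have hI t : x <= t <= y -> `|Im (f' t) - Im l| <= k.
  by move=> /hk; apply: le_trans; rewrite -ImB normc_Im.
apply: le_trans (normc_le_ReIm _) _.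
rewrite !ReB !ImB ReMr ImMr.
have R1 := @derive_lower (fun t => Re (f t)) (fun t => Re (f' t)) x y (Re l - k) xy.
have R2 := @derive_upper (fun t => Re (f t)) (fun t => Re (f' t)) x y (Re l + k) xy.
have I1 := @derive_lower (fun t => Im (f t)) (fun t => Im (f' t)) x y (Im l - k) xy.
have I2 := @derive_upper (fun t => Im (f t)) (fun t => Im (f' t)) x y (Im l + k) xy.
have {}R1 : (Re l - k) * (y - x) <= Re (f y) - Re (f x).
  apply: R1 => t ht; first by have [] := hf _ ht.
  by have := hR _ ht; rewrite ler_norml => /andP[]; lra.
have {}R2 : Re (f y) - Re (f x) <= (Re l + k) * (y - x).
  apply: R2 => t ht; first by have [] := hf _ ht.
  by have := hR _ ht; rewrite ler_norml => /andP[]; lra.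
have {}I1 : (Im l - k) * (y - x) <= Im (f y) - Im (f x).
  apply: I1 => t ht; first by have [] := hf _ ht.
  by have := hI _ ht; rewrite ler_norml => /andP[]; lra.
have {}I2 : Im (f y) - Im (f x) <= (Im l + k) * (y - x).
  apply: I2 => t ht; first by have [] := hf _ ht.
  by have := hI _ ht; rewrite ler_norml => /andP[]; lra.
have A1 : `|Re (f y) - Re (f x) - Re l * (y - x)| <= k * (y - x).
  by rewrite ler_norml; apply/andP; split; lra.
have A2 : `|Im (f y) - Im (f x) - Im l * (y - x)| <= k * (y - x).
  by rewrite ler_norml; apply/andP; split; lra.
lra.
Qed.

(** Uniqueness for the linear equation f' = m f, in the form of Gronwall:
    the weight [expR] makes [|f|^2] monotone on both sides of 0. *)
Lemma real_gronwall (N dN : R -> R) K r : 0 <= K ->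
  (forall t, `|t| < r -> is_derive t (1 : R) N (dN t)) ->
  (forall t, `|t| < r -> 0 <= N t) ->
  (forall t, `|t| < r -> `|dN t| <= K * N t) ->
  N 0 = 0 -> forall t, `|t| < r -> N t = 0.
Proof.
move=> K0 dNP N0 NK N00 t tr.
have dE (c s : R) : is_derive s (1 : R) (fun s => expR (c * s)) (c * expR (c * s)).
  have h : is_derive s (1 : R) (fun s : R => c * s) c.
    have := is_deriveM (is_derive_cst c s (1 : R)) (is_derive_id s (1 : R)).
    by move=> h; apply: is_derive_eq h _; rewrite /GRing.scale /= mulr1 mulr0 addr0.
  have := is_derive1_comp (f := expR) (g := fun s => c * s) (is_derive_expR (c * s)) h.
  by rewrite mulrC.
have dNE c s : `|s| < r ->
    is_derive s (1 : R) (fun s => N s * expR (c * s)) ((dN s + c * N s) * expR (c * s)).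
  move=> sr; apply: is_derive_eq (is_deriveM (dNP s sr) (dE c s)) _.
  by rewrite /GRing.scale /=; ring.
apply/eqP; rewrite eq_le N0 // andbT.
have [t0|t0] := leP 0 t.
- have := @derive_upper (fun s => N s * expR (- K * s))
    (fun s => (dN s + - K * N s) * expR (- K * s)) 0 t 0 t0.
  rewrite N00 mul0r mul0r subr0 => H.
  have : N t * expR (- K * t) <= 0.
    apply: H => s /andP[s0 st].
      by apply: dNE; rewrite ger0_norm // (le_lt_trans st) // -(ger0_norm t0).
    have sr : `|s| < r by rewrite ger0_norm // (le_lt_trans st) // -(ger0_norm t0).
    rewrite pmulr_lle0 ?expR_gt0 //.
    have := NK s sr; rewrite ler_norml => /andP[_]; lra.
  by rewrite pmulr_lle0 ?expR_gt0.
- have := @derive_lower (fun s => N s * expR (K * s))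
    (fun s => (dN s + K * N s) * expR (K * s)) t 0 0 (ltW t0).
  rewrite N00 mul0r mul0r sub0r => H.
  have : N t * expR (K * t) <= 0.
    rewrite -oppr_ge0.
    apply: H => s /andP[ts s0].
      apply: dNE; rewrite ler0_norm //; apply: le_lt_trans tr.
      by rewrite ltr0_norm // lerN2.
    have sr : `|s| < r.
      rewrite ler0_norm //; apply: le_lt_trans tr.
      by rewrite ltr0_norm // lerN2.
    rewrite mulr_ge0 ?expR_ge0 //.
    have := NK s sr; rewrite ler_norml => /andP[+ _]; lra.
  by rewrite pmulr_lle0 ?expR_gt0.
Qed.

Lemma cder_gronwall f (m : R -> R[i]) K r : 0 <= K ->
  (forall t, `|t| < r -> cder f t (m t * f t)) ->
  (forall t, `|t| < r -> normc (m t) <= K) ->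
  f 0 = 0 -> forall t, `|t| < r -> f t = 0.
Proof.
move=> K0 hf mK f0.
pose N t := Re (f t) ^+ 2 + Im (f t) ^+ 2.
have NE t : N t = normc (f t) ^+ 2 by rewrite sqr_normc_ReIm.
pose dN t := 2 * (Re (f t) * Re (m t * f t) + Im (f t) * Im (m t * f t)).
have dNP t : `|t| < r -> is_derive t (1 : R) N (dN t).
  move=> /hf [h1 h2].
  have -> : N = (fun s => Re (f s)) * (fun s => Re (f s)) +
                (fun s => Im (f s)) * (fun s => Im (f s)).
    by apply/funext => s; rewrite /N !expr2.
  apply: is_derive_eq (is_deriveD (is_deriveM h1 h1) (is_deriveM h2 h2)) _.
  by rewrite /dN /GRing.scale /=; ring.
have H t : `|t| < r -> `|dN t| <= (2 * K) * N t.
  move=> tr.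
  have -> : dN t = 2 * Re (conjc (f t) * (m t * f t)).
    by rewrite /dN (ReM (conjc _)) ReJ ImJ; ring.
  rewrite normrM ger0_norm // -mulrA ler_wpM2l //.
  apply: le_trans (normc_Re _) _.
  rewrite !normcM normc_conj NE expr2 mulrCA ler_wpM2r ?mulr_ge0 ?normc_ge0 //.
  exact: mK.
move=> t tr; apply/eqP; rewrite -normc_eq0 -sqrf_eq0 -NE; apply/eqP.
apply: (real_gronwall (K := 2 * K) (dN := dN) (r := r)) => //.
- by rewrite mulr_ge0.
- by move=> s _; rewrite NE sqr_ge0.
- by rewrite NE f0 normc0 expr0n.
Qed.

End ComplexDerivative.
(** * Analytic solutions of polynomial differential equations *)

(** Right-hand sides of differential equations: polynomial expressions in
    unknown complex functions of a real time and in their conjugates.  A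
    syntactic form lets the same right-hand side act on numbers, on truncated
    power series and on majorants. *)
Inductive cexpr (R : realType) (I : Type) :=
| EVar of I
| ECst of R[i]
| EAdd of cexpr R I & cexpr R I
| EMul of cexpr R I & cexpr R I
| EConj of cexpr R I.
Arguments EVar {R I}. Arguments ECst {R I}.

Section Convolution.
Variable R : realType.

(** The weights 1/(n+1)^2 form a convolution algebra up to a constant, so that
    bounds of the shape A r^n/(n+1)^2 on coefficients are stable under
    products. *)
Definition wt (n : nat) : R := (n.+1%:R ^+ 2)^-1.

Lemma wt_gt0 n : 0 < wt n.
Proof. by rewrite /wt invr_gt0 exprn_gt0. Qed.

Lemma wt_le1 n : wt n <= 1.
Proof. by rewrite /wt invf_le1 ?exprn_gt0 // expr_ge1 // ler1n. Qed.

Lemma wt_sum n : \sum_(i < n.+1) wt i <= 2 - n.+1%:R^-1.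
Proof.
elim: n => [|n IH]; first by rewrite big_ord1 /wt expr1n invr1; lra.
rewrite big_ord_recr /=.
have : wt n.+1 <= n.+1%:R^-1 - n.+2%:R^-1.
  have -> : n.+1%:R^-1 - n.+2%:R^-1 = (n.+1%:R * n.+2%:R)^-1 :> R.
    rewrite -[n.+2%:R]natr1; set x : R := n.+1%:R.
    have x0 : 0 < x by exact: ltr0Sn.
    by clearbody x; field; rewrite (gt_eqF x0) gt_eqF ?addr_gt0.
  by rewrite /wt lef_pV2 ?posrE ?mulr_gt0 ?exprn_gt0 // expr2 ler_wpM2r // ler_nat.
by move=> h; apply: le_trans (lerD IH h) _; rewrite addrA subrK.
Qed.

Lemma wt_conv n : \sum_(i < n.+1) wt i * wt (n - i) <= 8 * wt n.
Proof.
have H i : (i <= n)%N -> wt i * wt (n - i) <= 2 * (wt i + wt (n - i)) * wt n.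
  move=> le_in; rewrite /wt.
  set x : R := i.+1%:R; set y : R := (n - i).+1%:R.
  have x0 : 0 < x by exact: ltr0Sn.
  have y0 : 0 < y by exact: ltr0Sn.
  have xy : x + y = n.+1%:R + 1 :> R.
    by rewrite /x /y -natrD natr1 addSn addnS subnKC.
  have -> : 2 * ((x ^+ 2)^-1 + (y ^+ 2)^-1) * (n.+1%:R ^+ 2)^-1 =
       (x ^+ 2)^-1 * (y ^+ 2)^-1 * (2 * (x ^+ 2 + y ^+ 2) / n.+1%:R ^+ 2).
    have z0 : (0 : R) < n.+1%:R by exact: ltr0Sn.
    move: z0; set z : R := n.+1%:R => z0; clearbody x y z.
    by field; rewrite ?(gt_eqF x0) ?(gt_eqF y0) ?(gt_eqF z0).
  rewrite ler_peMr ?mulr_ge0 ?invr_ge0 ?exprn_ge0 ?(ltW x0) ?(ltW y0) //.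
  rewrite ler_pdivlMr ?exprn_gt0 // mul1r.
  have -> : n.+1%:R = x + y - 1 :> R by rewrite xy addrK.
  have h1 : (x + y - 1) ^+ 2 <= (x + y) ^+ 2.
    rewrite ler_sqr ?nnegrE; first by lra.
      by rewrite xy addrK.
    by rewrite addr_ge0 ?ltW.
  apply: le_trans h1 _; have := sqr_ge0 (x - y); rewrite !sqrrD !sqrrN !mulrN; lra.
have S : \sum_(i < n.+1) wt i * wt (n - i) <=
         \sum_(i < n.+1) 2 * (wt i + wt (n - i)) * wt n.
  by apply: ler_sum => i _; apply: H; rewrite -ltnS.
apply: le_trans S _.
rewrite -mulr_suml ler_wpM2r ?ltW ?wt_gt0 // -mulr_sumr big_split /=.
have -> : \sum_(i < n.+1) wt (n - i) = \sum_(i < n.+1) wt i.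
  rewrite (reindex_inj rev_ord_inj) /=; apply: eq_bigr => i _.
  by rewrite subSS subKn // -ltnS.
have : 0 < n.+1%:R^-1 :> R by rewrite invr_gt0.
by have := wt_sum n; move: (n.+1%:R^-1) => y; lra.
Qed.

End Convolution.

Section ConvergenceComplex.
Variable R : realType.
Implicit Types (u v : nat -> R[i]) (l : R[i]).

Definition ccvg u l := (Re (u n) @[n --> \oo] --> Re l) /\ (Im (u n) @[n --> \oo] --> Im l).

Lemma ccvg_cst l : ccvg (fun=> l) l.
Proof. by split; exact: cvg_cst. Qed.

Lemma ccvg_add u v l m : ccvg u l -> ccvg v m -> ccvg (fun n => u n + v n) (l + m).
Proof.
move=> [u1 u2] [v1 v2]; split.
- have -> : (fun n => Re (u n + v n)) = (fun n => Re (u n) + Re (v n)).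
    by apply/funext => n; rewrite ReD.
  by rewrite ReD; exact: cvgD.
- have -> : (fun n => Im (u n + v n)) = (fun n => Im (u n) + Im (v n)).
    by apply/funext => n; rewrite ImD.
  by rewrite ImD; exact: cvgD.
Qed.

Lemma ccvg_mul u v l m : ccvg u l -> ccvg v m -> ccvg (fun n => u n * v n) (l * m).
Proof.
move=> [u1 u2] [v1 v2]; split.
- have -> : (fun n => Re (u n * v n)) =
      (fun n => Re (u n) * Re (v n) - Im (u n) * Im (v n)).
    by apply/funext => n; rewrite ReM.
  by rewrite ReM; apply: cvgB; exact: cvgM.
- have -> : (fun n => Im (u n * v n)) =
      (fun n => Re (u n) * Im (v n) + Im (u n) * Re (v n)).
    by apply/funext => n; rewrite ImM.
  by rewrite ImM; apply: cvgD; exact: cvgM.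
Qed.

Lemma ccvg_conj u l : ccvg u l -> ccvg (fun n => conjc (u n)) (conjc l).
Proof.
move=> [u1 u2]; split.
- have -> : (fun n => Re (conjc (u n))) = (fun n => Re (u n)).
    by apply/funext => n; rewrite ReJ.
  by rewrite ReJ.
- have -> : (fun n => Im (conjc (u n))) = (fun n => - Im (u n)).
    by apply/funext => n; rewrite ImJ.
  by rewrite ImJ; exact: cvgN.
Qed.

Lemma ccvg_unique u l m : ccvg u l -> ccvg u m -> l = m.
Proof.
move=> [u1 u2] [v1 v2]; apply: complex_ext.
- exact: (cvg_unique _ u1 v1).
- exact: (cvg_unique _ u2 v2).
Qed.

Lemma geometric_half_cvg (A : R) : A * 2^-1 ^+ n @[n --> \oo] --> (0 : R).
Proof.
have := @cvg_geometric R A 2^-1.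
rewrite ger0_norm ?invr_ge0 // invf_lt1 ?ltr1n // => /(_ isT).
by [].
Qed.

Lemma ccvg_near0 u v l (A : R) : ccvg v l ->
  (forall n, normc (u n - v n) <= A * 2^-1 ^+ n) -> ccvg u l.
Proof.
move=> [v1 v2] H.
have e0 (w : nat -> R) : (forall n, `|w n| <= A * 2^-1 ^+ n) ->
    w n @[n --> \oo] --> (0 : R).
  move=> hw.
  apply: (@squeeze_cvgr _ _ _ _ (fun n => - (A * 2^-1 ^+ n)) (fun n => A * 2^-1 ^+ n)).
  - by apply: nearW => n; rewrite -ler_norml.
  - by rewrite -oppr0; apply: cvgN; exact: geometric_half_cvg.
  - exact: geometric_half_cvg.
split.
- have -> : (fun n => Re (u n)) = (fun n => Re (u n - v n) + Re (v n)).
    by apply/funext => n; rewrite ReB subrK.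
  rewrite -[Re l]add0r; apply: cvgD => //; apply: e0 => n.
  exact: le_trans (normc_Re _) (H n).
- have -> : (fun n => Im (u n)) = (fun n => Im (u n - v n) + Im (v n)).
    by apply/funext => n; rewrite ImB subrK.
  rewrite -[Im l]add0r; apply: cvgD => //; apply: e0 => n.
  exact: le_trans (normc_Im _) (H n).
Qed.

Lemma geometric_pseries_cvg (c : nat -> R) (A r x : R) :
  (forall n, `|c n| <= A * r ^+ n) -> 0 < r -> `|x| * r <= 2^-1 ->
  cvgn (pseries c x).
Proof.
move=> hc r0 hx.
apply: normed_cvg.
apply: (@series_le_cvg _ _ (geometric A 2^-1)).
- by move=> n; exact: normr_ge0.
- move=> n; rewrite /geometric /= mulr_ge0 ?exprn_ge0 ?invr_ge0 //.
  by have := le_trans (normr_ge0 _) (hc 0%N); rewrite expr0 mulr1.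
- move=> n; rewrite /geometric /= normrM normrX.
  apply: le_trans (ler_wpM2r (exprn_ge0 _ (normr_ge0 _)) (hc n)) _.
  rewrite -mulrA -exprMn.
  have A0 : 0 <= A by have := le_trans (normr_ge0 _) (hc 0%N); rewrite expr0 mulr1.
  rewrite ler_wpM2l // lerXn2r ?nnegrE ?mulr_ge0 ?invr_ge0 ?(ltW r0) //.
  by rewrite mulrC.
- apply: is_cvg_geometric_series.
  by rewrite ger0_norm ?invr_ge0 // invf_lt1 ?ltr1n.
Qed.

Definition psum (a : nat -> R[i]) (t : R) : R[i] :=
  limn (pseries (fun n => Re (a n)) t) +i* limn (pseries (fun n => Im (a n)) t).

Definition cpart (a : nat -> R[i]) (t : R) (n : nat) : R[i] :=
  \sum_(i < n) a i * t%:C ^+ i.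

Lemma Re_cpart a t n : Re (cpart a t n) = pseries (fun n => Re (a n)) t n.
Proof.
rewrite /pseries /series /= /cpart big_mkord.
elim: n => [|n IH]; first by rewrite !big_ord0.
by rewrite !big_ord_recr /= ReD IH -rmorphXn ReMr.
Qed.

Lemma Im_cpart a t n : Im (cpart a t n) = pseries (fun n => Im (a n)) t n.
Proof.
rewrite /pseries /series /= /cpart big_mkord.
elim: n => [|n IH]; first by rewrite !big_ord0.
by rewrite !big_ord_recr /= ImD IH -rmorphXn ImMr.
Qed.

Lemma psum_cvg (a : nat -> R[i]) (A r t : R) :
  (forall n, normc (a n) <= A * r ^+ n) -> 0 < r -> `|t| * r <= 2^-1 ->
  (pseries (fun n => Re (a n)) t @ \oo --> Re (psum a t)) /\
  (pseries (fun n => Im (a n)) t @ \oo --> Im (psum a t)).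
Proof.
move=> ha r0 ht; split.
- apply: (geometric_pseries_cvg (A := A) (r := r)) => // n.
  exact: le_trans (normc_Re _) (ha n).
- apply: (geometric_pseries_cvg (A := A) (r := r)) => // n.
  exact: le_trans (normc_Im _) (ha n).
Qed.

Lemma geo_tail (A x : R) n N : 0 <= A -> 0 <= x -> x <= 2^-1 ->
  \sum_(n <= i < N) A * x ^+ i <= 2 * A * 2^-1 ^+ n.
Proof.
move=> A0 x0 x2.
have H : \sum_(n <= i < N) A * x ^+ i <= \sum_(n <= i < N) A * 2^-1 ^+ i.
  by apply: ler_sum => i _; rewrite ler_wpM2l // lerXn2r ?nnegrE ?invr_ge0.
apply: le_trans H _.
have [Nn|nN] := leqP N n.
  by rewrite big_geq // !mulr_ge0 // exprn_ge0 // invr_ge0.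
suff : \sum_(n <= i < N) A * 2^-1 ^+ i <= 2 * A * 2^-1 ^+ n - 2 * A * 2^-1 ^+ N.
  have : 0 <= 2 * A * 2^-1 ^+ N by rewrite !mulr_ge0 // exprn_ge0 // invr_ge0.
  lra.
elim: N nN => [//|N IH]; rewrite ltnS leq_eqVlt => /orP[/eqP <-|nN].
  by rewrite big_nat1 exprS; lra.
rewrite big_nat_recr /= ?(ltnW nN) // exprS; have := IH nN; lra.
Qed.

(** Polynomials whose coefficients stabilise to those of a power series and
    stay under a common geometric bound converge to its sum. *)
Lemma horner_ccvg (p : nat -> {poly R[i]}) (a : nat -> R[i]) (A r t : R) :
  (forall m n : nat, (n <= m)%N -> (p m)`_n = a n) ->
  (forall m n : nat, normc ((p m)`_n) <= A * r ^+ n) -> 0 < r -> `|t| * r <= 2^-1 ->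
  ccvg (fun m => (p m).[t%:C]) (psum a t).
Proof.
move=> hpa hpA r0 ht.
have ha n : normc (a n) <= A * r ^+ n by rewrite -(hpa n n).
have A0 : 0 <= A.
  by have := le_trans (normc_ge0 _) (ha 0%N); rewrite expr0 mulr1.
have [c1 c2] := psum_cvg ha r0 ht.
have cc : ccvg (fun m => cpart a t m.+1) (psum a t).
  split.
  - have -> : (fun m => Re (cpart a t m.+1)) =
        (fun m => pseries (fun n => Re (a n)) t m.+1).
      by apply/funext => m; rewrite Re_cpart.
    by rewrite (cvg_shiftS (pseries (fun n => Re (a n)) t)).
  - have -> : (fun m => Im (cpart a t m.+1)) =
        (fun m => pseries (fun n => Im (a n)) t m.+1).
      by apply/funext => m; rewrite Im_cpart.
    by rewrite (cvg_shiftS (pseries (fun n => Im (a n)) t)).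
apply: (@ccvg_near0 _ _ _ A cc) => m.
pose N := maxn (size (p m)) m.+1.
rewrite (@horner_coef_wide _ N) ?leq_maxl //.
rewrite -(big_mkord xpredT (fun i => (p m)`_i * t%:C ^+ i)).
rewrite (big_cat_nat (n := m.+1)) ?leq_maxr //= big_mkord.
have -> : \sum_(i < m.+1) (p m)`_i * t%:C ^+ i = cpart a t m.+1.
  by apply: eq_bigr => i _; rewrite hpa // -ltnS.
rewrite addrAC subrr add0r.
apply: le_trans (normc_sum _ _) _.
have : \sum_(m.+1 <= i < N) normc ((p m)`_i * t%:C ^+ i) <=
       \sum_(m.+1 <= i < N) A * (`|t| * r) ^+ i.
  apply: ler_sum => i _; rewrite normcM normcX normcR exprMn mulrCA mulrC.
  by rewrite ler_wpM2l ?exprn_ge0.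
move=> /le_trans; apply.
apply: le_trans (geo_tail _ _ A0 _ ht) _; first by rewrite mulr_ge0 // ltW.
by rewrite exprS; lra.
Qed.

Lemma psum_cder (a : nat -> R[i]) (A r t : R) : 0 < r ->
  (forall n, normc (a n) <= A * r ^+ n * wt R n) -> `|t| * r < 2^-1 ->
  cder (psum a) t (psum (fun n => n.+1%:R * a n.+1) t).
Proof.
move=> r0 ha ht.
have A0 : 0 <= A.
  have := le_trans (normc_ge0 _) (ha 0%N); rewrite expr0 mulr1.
  by rewrite pmulr_lge0 ?wt_gt0.
pose K := (2 * r)^-1.
have K0 : 0 < K by rewrite invr_gt0 mulr_gt0.
have KE : `|K| * r <= 2^-1.
  by rewrite gtr0_norm // /K invfM -mulrA mulVf ?mulr1 // gt_eqF.
have tK : `|t| < `|K|.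
  rewrite (gtr0_norm K0) /K invfM -(ltr_pM2r r0) -mulrA mulVf ?mulr1 //.
  by rewrite gt_eqF.
have gen (c : nat -> R) : (forall n, `|c n| <= normc (a n)) ->
  is_derive t (1 : R) (fun x => limn (pseries c x)) (limn (pseries (pseries_diffs c) t)).
  move=> hc.
  have b0 n : `|c n| <= A * r ^+ n.
    apply: le_trans (hc n) (le_trans (ha n) _).
    by rewrite ler_piMr ?wt_le1 // mulr_ge0 // exprn_ge0 // ltW.
  have b1 n : `|pseries_diffs c n| <= (A * r) * r ^+ n.
    rewrite /pseries_diffs normrM ger0_norm //.
    apply: le_trans (ler_wpM2l (ler0n _ _) (le_trans (hc _) (ha _))) _.
    rewrite mulrCA exprS (mulrA A) ler_piMr ?mulr_ge0 ?exprn_ge0 ?(ltW r0) //.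
    rewrite /wt ler_pdivrMr ?exprn_gt0 // mul1r.
    rewrite -natrX ler_nat; rewrite expnS expn1; nia.
  have b2 n : `|pseries_diffs (pseries_diffs c) n| <= (A * r ^+ 2) * r ^+ n.
    rewrite /pseries_diffs !normrM !normr_nat mulrA.
    apply: le_trans (ler_wpM2l (mulr_ge0 (ler0n _ _) (ler0n _ _)) (le_trans (hc _) (ha _))) _.
    rewrite mulrCA !exprS expr0 mulr1 (mulrA r) (mulrA A) ler_piMr ?mulr_ge0 ?exprn_ge0 ?(ltW r0) //.
    rewrite /wt ler_pdivrMr ?exprn_gt0 // mul1r.
    rewrite -natrX -natrM ler_nat expnS expn1; nia.
  apply: (pseries_snd_diffs (K := K)) => //.
  - exact: (geometric_pseries_cvg b0).
  - exact: (geometric_pseries_cvg b1).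
  - exact: (geometric_pseries_cvg b2).
have Eq (c : nat -> R) : pseries_diffs c = (fun n => n.+1%:R * c n.+1) by [].
split.
- have -> : (fun s => Re (psum a s)) = (fun x => limn (pseries (fun n => Re (a n)) x)) by [].
  have -> : Re (psum (fun n => n.+1%:R * a n.+1) t) =
     limn (pseries (pseries_diffs (fun n => Re (a n))) t).
    rewrite /psum /= Eq; congr (limn (pseries _ _)); apply/funext => n.
    by rewrite -[n.+1%:R](rmorph_nat (real_complex R)) mulrC ReMr mulrC.
  by apply: gen => n; exact: normc_Re.
- have -> : (fun s => Im (psum a s)) = (fun x => limn (pseries (fun n => Im (a n)) x)) by [].
  have -> : Im (psum (fun n => n.+1%:R * a n.+1) t) =
     limn (pseries (pseries_diffs (fun n => Im (a n))) t).
    rewrite /psum /= Eq; congr (limn (pseries _ _)); apply/funext => n.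
    by rewrite -[n.+1%:R](rmorph_nat (real_complex R)) mulrC ImMr mulrC.
  by apply: gen => n; exact: normc_Im.
Qed.

End ConvergenceComplex.

Section Picard.
Variable R : realType.
Local Notation wt := (wt R).

Section Expressions.
Variable I : Type.
Implicit Types (e : cexpr R I).

Fixpoint evalc (v : I -> R[i]) e : R[i] :=
  match e with
  | EVar i => v i
  | ECst c => c
  | EAdd e1 e2 => evalc v e1 + evalc v e2
  | EMul e1 e2 => evalc v e1 * evalc v e2
  | EConj e1 => conjc (evalc v e1)
  end.

(** Conjugation acts on coefficients only because the time variable is real. *)
Fixpoint evalp (p : I -> {poly R[i]}) e : {poly R[i]} :=
  match e with
  | EVar i => p i
  | ECst c => c%:P
  | EAdd e1 e2 => evalp p e1 + evalp p e2
  | EMul e1 e2 => evalp p e1 * evalp p e2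
  | EConj e1 => map_poly conjc (evalp p e1)
  end.

Fixpoint ebound (A : R) e : R :=
  match e with
  | EVar i => A
  | ECst c => normc c
  | EAdd e1 e2 => ebound A e1 + ebound A e2
  | EMul e1 e2 => 8 * (ebound A e1 * ebound A e2)
  | EConj e1 => ebound A e1
  end.

Lemma evalp_horner p e (t : R) :
  (evalp p e).[t%:C] = evalc (fun i => (p i).[t%:C]) e.
Proof.
elim: e => [i|c|e1 IH1 e2 IH2|e1 IH1 e2 IH2|e1 IH1] //=.
- by rewrite hornerC.
- by rewrite hornerD IH1 IH2.
- by rewrite hornerM IH1 IH2.
- by rewrite -IH1 -{1}(conjc_real t) horner_map.
Qed.

Lemma evalc_ccvg (u : nat -> I -> R[i]) (v : I -> R[i]) e :
  (forall i, ccvg (u ^~ i) (v i)) -> ccvg (fun n => evalc (u n) e) (evalc v e).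
Proof.
move=> uv; elim: e => [i|c|e1 IH1 e2 IH2|e1 IH1 e2 IH2|e1 IH1] //=.
- exact: ccvg_cst.
- exact: ccvg_add.
- exact: ccvg_mul.
- exact: ccvg_conj.
Qed.

Definition agree n (p q : {poly R[i]}) := forall j, (j < n)%N -> p`_j = q`_j.

Lemma agree_evalp n (p q : I -> {poly R[i]}) e :
  (forall i, agree n (p i) (q i)) -> agree n (evalp p e) (evalp q e).
Proof.
move=> pq; elim: e => [i|c|e1 IH1 e2 IH2|e1 IH1 e2 IH2|e1 IH1] //= j jn.
- by rewrite !coefD IH1 // IH2.
- rewrite !coefM; apply: eq_bigr => k _; rewrite IH1 ?IH2 //.
    by rewrite (leq_ltn_trans (leq_subr _ _)).
  by rewrite (leq_trans (ltn_ord k)).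
- by rewrite !coef_map IH1.
Qed.

Definition maj (A r : R) (p : {poly R[i]}) :=
  forall n, normc p`_n <= A * r ^+ n * wt n.

Lemma maj_ge0 A r p : maj A r p -> 0 <= A.
Proof.
move=> /(_ 0%N) /(le_trans (normc_ge0 _)).
by rewrite expr0 mulr1 pmulr_lge0 // wt_gt0.
Qed.

Lemma maj_mul A B r p q : 0 <= r -> maj A r p -> maj B r q ->
  maj (8 * (A * B)) r (p * q).
Proof.
move=> r0 hp hq n.
have A0 := maj_ge0 hp; have B0 := maj_ge0 hq.
rewrite coefM; apply: le_trans (normc_sum _ _) _.
have S : \sum_(i < n.+1) normc (p`_i * q`_(n - i)) <=
         \sum_(i < n.+1) A * B * r ^+ n * (wt i * wt (n - i)).
  apply: ler_sum => i _; rewrite normcM.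
  have -> : A * B * r ^+ n * (wt i * wt (n - i)) =
     (A * r ^+ i * wt i) * (B * r ^+ (n - i) * wt (n - i)).
    have -> : r ^+ n = r ^+ i * r ^+ (n - i) by rewrite -exprD subnKC // -ltnS.
    ring.
  by apply: ler_pM => //; exact: normc_ge0.
apply: le_trans S _; rewrite -mulr_sumr.
apply: le_trans (ler_wpM2l _ (wt_conv R n)) _.
  by rewrite !mulr_ge0 // exprn_ge0.
by rewrite le_eqVlt; apply/orP; left; apply/eqP; ring.
Qed.

Lemma maj_evalp A r (p : I -> {poly R[i]}) e : 0 <= r ->
  (forall i, maj A r (p i)) -> maj (ebound A e) r (evalp p e).
Proof.
move=> r0 hp; elim: e => [i|c|e1 IH1 e2 IH2|e1 IH1 e2 IH2|e1 IH1] //=.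
- move=> n; rewrite coefC; have [->|_] := eqVneq n 0%N.
    by rewrite expr0 mulr1 /wt expr1n invr1 mulr1.
  by rewrite normc0 !mulr_ge0 ?normc_ge0 ?exprn_ge0 // ltW // wt_gt0.
- move=> n; rewrite coefD; apply: le_trans (normcD _ _) _.
  by rewrite !mulrDl lerD.
- exact: maj_mul.
- by move=> n; rewrite coef_map normc_conj.
Qed.

End Expressions.

Definition pprim (c : R[i]) (q : {poly R[i]}) : {poly R[i]} :=
  c%:P + \poly_(i < (size q).+1) (if i is j.+1 then q`_j / j.+1%:R else 0).

Lemma coef0_pprim c q : (pprim c q)`_0 = c.
Proof. by rewrite coefD coefC coef_poly /= addr0. Qed.

Lemma coefS_pprim c q n : (pprim c q)`_n.+1 = q`_n / n.+1%:R.
Proof.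
rewrite coefD coefC coef_poly /= add0r ltnS; case: ltnP => // h.
by rewrite nth_default // mul0r.
Qed.

Lemma deriv_pprim c q : (pprim c q)^`() = q.
Proof.
apply/polyP => n; rewrite coef_deriv coefS_pprim -[LHS]mulr_natr divfK //.
Qed.

(** The Cauchy-Kovalevskaya theorem for ordinary differential equations.
    The Picard iterates are polynomials; each iteration fixes one more Taylor
    coefficient, and the majorant A r^n/(n+1)^2 is preserved once r is large,
    because integration divides the n-th coefficient by n. *)
Theorem analytic_ode (I : finType) (F : I -> cexpr R I) (v0 : I -> R[i]) :
  exists (r : R) (f : I -> R -> R[i]) (a : I -> nat -> R[i]),
    [/\ 0 < r, forall i, f i 0 = v0 i,
       forall i t, `|t| < r -> cder (f i) t (evalc (f^~ t) (F i)) &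
       forall i t, `|t| < r ->
         (pseries (fun n => Re (a i n)) t @ \oo --> Re (f i t)) /\
         (pseries (fun n => Im (a i n)) t @ \oo --> Im (f i t))].
Proof.
pose P := fix P m : I -> {poly R[i]} :=
  if m is m'.+1 then fun i => pprim (v0 i) (evalp (P m') (F i))
  else fun i => (v0 i)%:P.
pose A := 1 + \sum_i normc (v0 i).
have sv0 i : normc (v0 i) <= \sum_i normc (v0 i).
  by rewrite (bigD1 i) //= lerDl sumr_ge0 // => j _; exact: normc_ge0.
have A1 : 1 <= A by rewrite lerDl sumr_ge0 // => j _; exact: normc_ge0.
have vA i : normc (v0 i) <= A by apply: le_trans (sv0 i) _; rewrite lerDr.
have eb0 (e : cexpr R I) : 0 <= ebound A e.
  elim: e => [i|c|e1 IH1 e2 IH2|e1 IH1 e2 IH2|e1 IH1] //=.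
  - by apply: le_trans A1.
  - exact: normc_ge0.
  - exact: addr_ge0.
  - by rewrite !mulr_ge0.
pose M := \sum_i ebound A (F i).
have M0 : 0 <= M by rewrite sumr_ge0.
have FM i : ebound A (F i) <= M by rewrite /M (bigD1 i) //= lerDl sumr_ge0.
pose r := 4 * M + 1.
have r0 : 0 < r by rewrite /r; lra.
have majP m i : maj A r (P m i).
  elim: m i => [|m IH] i [|n].
  - by rewrite coefC eqxx expr0 mulr1 /wt expr1n invr1 mulr1.
  - rewrite coefC (_ : (n.+1 == 0)%N = false) // normc0 !mulr_ge0 ?exprn_ge0 ?(ltW r0) //.
      by apply: le_trans A1.
    exact: ltW (wt_gt0 _ _).
  - by rewrite coef0_pprim expr0 mulr1 /wt expr1n invr1 mulr1.
  - rewrite coefS_pprim normcM normcV.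
    have -> : normc (n.+1%:R : R[i]) = n.+1%:R.
      by rewrite -(rmorph_nat (real_complex R)) normcR normr_nat.
    have H := maj_evalp (F i) (ltW r0) IH.
    apply: le_trans (ler_wpM2r _ (H n)) _; first by rewrite invr_ge0.
    rewrite exprS.
    have w1 : wt n / n.+1%:R <= 4 * wt n.+1.
      rewrite /wt -invfM -[4 * _]mulrC -ler_pdivrMr // -invfM lef_pV2 ?posrE ?mulr_gt0 ?exprn_gt0 //.
      rewrite -!natrX -!natrM ler_nat !expnS !expn0; nia.
    have -> : ebound A (F i) * r ^+ n * wt n / n.+1%:R =
       (ebound A (F i) * r ^+ n) * (wt n / n.+1%:R) by ring.
    apply: le_trans (ler_wpM2l _ w1) _.
      by rewrite mulr_ge0 // exprn_ge0 // ltW.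
    have -> : ebound A (F i) * r ^+ n * (4 * wt n.+1) =
        (4 * ebound A (F i)) * (r ^+ n * wt n.+1) by ring.
    have -> : A * (r * r ^+ n) * wt n.+1 = (A * r) * (r ^+ n * wt n.+1) by ring.
    apply: ler_wpM2r.
      by rewrite mulr_ge0 ?exprn_ge0 ?(ltW r0) // ltW // wt_gt0.
    have h1 : r <= A * r by rewrite ler_peMl // ltW.
    have h2 := FM i; apply: le_trans h1; rewrite /r; lra.
have agP m i : agree m.+1 (P m i) (P m.+1 i).
  elim: m i => [|m IH] i j.
    by rewrite ltnS leqn0 => /eqP ->; rewrite [P 1%N i]/= coef0_pprim /= coefC.
  case: j => [|j] jm; first by rewrite !coef0_pprim.
  by rewrite !coefS_pprim (agree_evalp (n := m.+1) (F i) IH).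
pose a i n := (P n i)`_n.
have aP i m n : (n <= m)%N -> (P m i)`_n = a i n.
  elim: m => [|m IH]; first by rewrite leqn0 => /eqP ->.
  rewrite leq_eqVlt => /orP[/eqP -> //|]; rewrite ltnS => nm.
  by rewrite -(IH nm) (agP m i).
have ha i n : normc (a i n) <= A * r ^+ n * wt n by exact: majP.
have geo (x : R) n : 0 <= x -> x * r ^+ n * wt n <= x * r ^+ n.
  by move=> x0; rewrite ler_piMr ?wt_le1 // mulr_ge0 // exprn_ge0 // ltW.
have A0 : 0 <= A by apply: le_trans A1.
have ha' i n : normc (a i n) <= A * r ^+ n by apply: le_trans (ha i n) (geo _ _ A0).
pose rho := (2 * r)^-1.
have small t : `|t| < rho -> `|t| * r < 2^-1.
  move=> ht; rewrite -(ltr_pM2r r0) in ht; apply: lt_le_trans ht _.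
  by rewrite /rho invfM -mulrA mulVf ?mulr1 // gt_eqF.
exists rho, (fun i => psum (a i)), a; split.
- by rewrite invr_gt0 mulr_gt0.
- move=> i; have s0 : `|0 : R| * r <= 2^-1 by rewrite normr0 mul0r invr_ge0.
  have := @horner_ccvg R (P^~ i) (a i) A r 0 (aP i) _ r0 s0.
  move=> /(_ (fun m n => le_trans (majP m i n) (geo _ _ A0))) H.
  apply: (ccvg_unique H).
  have -> : (fun m => (P m i).[0%:C]) = (fun=> v0 i).
    apply/funext => m; rewrite (_ : (0 : R)%:C = 0) // horner_coef0 aP //.
    by rewrite /a /= coefC.
  exact: ccvg_cst.
- move=> i t /small ht.
  apply: cder_eq (psum_cder r0 (ha i) ht) _.
  pose D m := (evalp (P m) (F i)).
  have DE m : D m = (P m.+1 i)^`() by rewrite /= deriv_pprim.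
  have c1 : ccvg (fun m => (D m).[t%:C]) (psum (fun n => n.+1%:R * a i n.+1) t).
    apply: (@horner_ccvg R D _ (ebound A (F i)) r t _ _ r0 (ltW ht)).
      by move=> m n nm; rewrite DE coef_deriv aP // mulr_natl.
    move=> m n; apply: le_trans (maj_evalp (F i) (ltW r0) (majP m) n) (geo _ _ _).
    exact: eb0.
  have c2 : ccvg (fun m => (D m).[t%:C]) (evalc (fun j => psum (a j) t) (F i)).
    have -> : (fun m => (D m).[t%:C]) =
              (fun m => evalc (fun j => (P m j).[t%:C]) (F i)).
      by apply/funext => m; rewrite evalp_horner.
    apply: evalc_ccvg => j.
    apply: (@horner_ccvg R (P^~ j) (a j) A r t (aP j) _ r0 (ltW ht)).
    move=> m n; exact: le_trans (majP m j n) (geo _ _ A0).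
  exact: ccvg_unique c1 c2.
- move=> i t /small ht; exact: psum_cvg (ha' i) r0 (ltW ht).
Qed.

End Picard.

(** * Germs of unit-speed curves on which a polynomial is real *)

Section Germ.
Variable R : realType.
Local Notation C := R[i].

Lemma conjcM (x y : C) : conjc (x * y) = conjc x * conjc y.
Proof. exact: (rmorphM (@conjc R)). Qed.
Lemma conjcD (x y : C) : conjc (x + y) = conjc x + conjc y.
Proof. exact: (rmorphD (@conjc R)). Qed.
Lemma conjcN (x : C) : conjc (- x) = - conjc x.
Proof. exact: (rmorphN (@conjc R)). Qed.
Lemma conjc_half : conjc (2^-1 : C) = 2^-1.
Proof. by rewrite conjc_inv conjc_nat. Qed.

Lemma cder_gronwall_near (f m : R -> C) r l : 0 < r -> cder m 0 l ->
  (forall t, `|t| < r -> cder f t (m t * f t)) -> f 0 = 0 ->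
  exists2 d : R, 0 < d <= r & forall t, `|t| < d -> f t = 0.
Proof.
move=> r0 hm hf f0.
have [d d0 hd] := cder_cont hm ltr01.
exists (Num.min d r); first by rewrite lt_min d0 r0 ge_min lexx orbT.
apply: (cder_gronwall (m := m) (K := normc (m 0) + 1)) => //.
- by rewrite addr_ge0 // normc_ge0.
- by move=> t; rewrite lt_min => /andP[_]; exact: hf.
- move=> t; rewrite lt_min => /andP[td _].
  have := hd t; rewrite subr0 => /(_ td) h1.
  have := normcD (m t - m 0) (m 0); rewrite subrK; lra.
Qed.

Lemma cder0_near (f : R -> C) r : 0 < r ->
  (forall t, `|t| < r -> cder f t 0) -> forall t, `|t| < r -> f t = f 0.
Proof.
move=> r0 hf t tr.
apply/eqP; rewrite -subr_eq0; apply/eqP.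
apply: (@cder_gronwall _ (fun t => f t - f 0) (fun=> 0) 0 r) => //.
- move=> s sr; rewrite mul0r.
  by apply: cder_eq (cder_sub (hf s sr) (cder_cst _ _)) _; rewrite subr0.
- by move=> s _; rewrite normc0.
- by rewrite subrr.
Qed.

Definition polye (I : Type) (p : {poly C}) (e : cexpr R I) : cexpr R I :=
  foldr (fun c acc => EAdd (EMul acc e) (ECst c)) (ECst 0) p.

Lemma evalc_polye I (v : I -> C) p e : evalc v (polye p e) = p.[evalc v e].
Proof.
rewrite /polye /horner; elim: (polyseq p) => //= c s ->.
by [].
Qed.

(** The coefficient B of the curvature equation u' = i Im(B u) u; see
    [germ_exists]. *)
Definition curvB (V W : {poly C}) (k : nat) (z P Q : C) : C :=
  k.-1%:R / k%:R * (V^`().[z] * Q) - P * W^`().[z].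

Lemma germ_ode (V W : {poly C}) (k : nat) (z0 u0 y0 P0 Q0 : C) :
  exists (r : R) (z u y P Q : R -> C) (a : nat -> C),
  [/\ 0 < r,
      [/\ z 0 = z0, u 0 = u0, y 0 = y0, P 0 = P0 & Q 0 = Q0],
      forall t, `|t| < r ->
        [/\ cder z t (u t),
            cder u t (u t * ((curvB V W k (z t) (P t) (Q t) * u t) -
                 conjc (curvB V W k (z t) (P t) (Q t) * u t)) / 2),
            cder y t (y t * V^`().[z t] * Q t * u t / k%:R),
            cder P t (- (P t ^+ 2 * W^`().[z t] * u t)) &
            cder Q t (- (Q t ^+ 2 * V^`().[z t] * u t))] &
      forall t, `|t| < r ->
         (pseries (fun n => Re (a n)) t @ \oo --> Re (z t)) /\
         (pseries (fun n => Im (a n)) t @ \oo --> Im (z t))].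
Proof.
pose o (n : nat) (h : (n < 5)%N) : 'I_5 := Ordinal h.
pose ez : cexpr R 'I_5 := EVar (o 0%N isT).
pose eu : cexpr R 'I_5 := EVar (o 1%N isT).
pose ey : cexpr R 'I_5 := EVar (o 2%N isT).
pose eP : cexpr R 'I_5 := EVar (o 3%N isT).
pose eQ : cexpr R 'I_5 := EVar (o 4%N isT).
pose eV := polye V^`() ez.
pose eW := polye W^`() ez.
pose eB := EAdd (EMul (ECst (k.-1%:R / k%:R)) (EMul eV eQ))
                (EMul (ECst (-1)) (EMul eP eW)).
pose eBu := EMul eB eu.
pose Fu := EMul (ECst 2^-1) (EMul eu (EAdd eBu (EMul (ECst (-1)) (EConj eBu)))).
pose Fy := EMul (ECst (k%:R^-1)) (EMul (EMul ey eV) (EMul eQ eu)).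
pose FP := EMul (ECst (-1)) (EMul (EMul eP eP) (EMul eW eu)).
pose FQ := EMul (ECst (-1)) (EMul (EMul eQ eQ) (EMul eV eu)).
pose F (i : 'I_5) := nth (ECst 0) [:: eu; Fu; Fy; FP; FQ] i.
pose v0 (i : 'I_5) := nth 0 [:: z0; u0; y0; P0; Q0] i.
have [r [f [a [r0 f0 hf ha]]]] := analytic_ode F v0.
exists r, (f (o 0%N isT)), (f (o 1%N isT)), (f (o 2%N isT)), (f (o 3%N isT)),
  (f (o 4%N isT)), (a (o 0%N isT)).
split => [//||t tr|t tr]; last exact: (ha (o 0%N isT)).
  by split; rewrite f0.
split.
- exact: (hf (o 0%N isT) t tr).
- apply: cder_eq (hf (o 1%N isT) t tr) _.
  by rewrite /F /= !evalc_polye /= /curvB; ring.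
- apply: cder_eq (hf (o 2%N isT) t tr) _.
  by rewrite /F /= !evalc_polye /=; ring.
- apply: cder_eq (hf (o 3%N isT) t tr) _.
  by rewrite /F /= !evalc_polye /=; ring.
- apply: cder_eq (hf (o 4%N isT) t tr) _.
  by rewrite /F /= !evalc_polye /=; ring.
Qed.

(** The leading behaviour of T at z0: T - T(z0) has a zero of order k with
    leading coefficient V(z0). *)
Definition local_form (T : {poly C}) (z0 : C) (k : nat) (V : {poly C}) : Prop :=
  [/\ (0 < k)%N, T = T.[z0]%:P + ('X - z0%:P) ^+ k * V & V.[z0] != 0].

(** [germ T z0 d g] : g is a unit-speed curve through z0 in direction d along
    which T is real, in the normal form T(g(t)) = T(z0) + rho zeta(t)^k with
    zeta increasing; near 0 it is the sum of a power series. *)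
Definition germ (T : {poly C}) (z0 d : C) (g : R -> C) : Prop :=
  exists (r : R) (u : R -> C) (zeta eta : R -> R) (a : nat -> C) (k : nat)
    (V : {poly C}) (rho : R),
  [/\ [/\ 0 < r, local_form T z0 k V, V.[z0] * d ^+ k = rho%:C & rho != 0],
      [/\ g 0 = z0, u 0 = d, zeta 0 = 0 & normc d = 1],
      forall t, `|t| < r ->
        [/\ cder g t (u t), normc (u t) = 1 & exists l, cder u t l],
      forall t, `|t| < r ->
        [/\ is_derive t (1 : R) zeta (eta t), 0 < eta t &
            T.[g t] = T.[z0] + (rho * zeta t ^+ k)%:C] &
      forall t, `|t| < r ->
         (pseries (fun n => Re (a n)) t @ \oo --> Re (g t)) /\
         (pseries (fun n => Im (a n)) t @ \oo --> Im (g t))].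

(** Existence of germs.  Write T = T(z0) + (z - z0)^k V with V(z0) <> 0, so
    that T' = (z - z0)^(k-1) W with W = k V + (z - z0) V'.  If T is real along
    a unit-speed curve with tangent u, then u' = i Im(B u) u where
    B = (k-1)/k V'/V - W'/W, which is regular at z0 even if k > 1.  With
    Q = 1/V, P = 1/W and y a branch of a multiple of V^(1/k) as further
    unknowns the equation becomes polynomial.  Conversely, along a solution,
    zeta = (z - z0) y has derivative eta = u y Q W / k, which satisfies
    eta' = - Re(B u) eta and hence stays real. *)
Lemma germ_exists (T V : {poly C}) (z0 d : C) (k : nat) :
  local_form T z0 k V -> normc d = 1 -> Im (V.[z0] * d ^+ k) = 0 -> exists g, germ T z0 d g.
Proof.
move=> lf d1 hIm; have [k0 TE V0] := lf.
set c := V.[z0] in V0 hIm.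
have dn0 : d != 0 by rewrite -normc_gt0 d1.
have kC : (k%:R : C) != 0 by rewrite pnatr_eq0 -lt0n.
pose W : {poly C} := k%:R *: V + ('X - z0%:P) * V^`().
have W0 : W.[z0] = k%:R * c.
  by rewrite /W hornerD hornerZ hornerM hornerXsubC subrr mul0r addr0.
have Wn0 : W.[z0] != 0 by rewrite W0 mulf_neq0.
pose rho := Re (c * d ^+ k).
have rhoE : c * d ^+ k = rho%:C by exact: Im0_real.
have rho0 : rho != 0.
  apply/eqP => h; move: rhoE; rewrite h => /eqP.
  by rewrite mulf_eq0 expf_eq0 (negPf V0) (negPf dn0) andbF.
have [r [z [u [y [P [Q [a [r0 [zi ui yi Pi Qi] hode hps]]]]]]]] :=
  germ_ode V W k z0 d d^-1 (W.[z0])^-1 c^-1.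
have r00 : `|0 : R| < r by rewrite normr0.
have [hz0 hu0 hy0 hP0 hQ0] := hode 0 r00.
pose B t := curvB V W k (z t) (P t) (Q t).
(* the relations Q V = 1 and P W = 1 are preserved *)
have [l1 hl1] : exists l, cder (fun t => - (Q t * V^`().[z t] * u t)) 0 l.
  eexists; apply: cder_opp; apply: cder_mul hu0; apply: cder_mul hQ0 _.
  exact: cder_horner hz0.
have [r1 /andP[r10 r1r] hQV] : exists2 r1 : R, 0 < r1 <= r &
    forall t, `|t| < r1 -> Q t * V.[z t] - 1 = 0.
  apply: (cder_gronwall_near r0 hl1); last first.
    by rewrite zi Qi mulVf // subrr.
  move=> t tr; have [hz hu hy hP hQ] := hode t tr.
  apply: cder_eq (cder_sub (cder_mul hQ (cder_horner V hz)) (cder_cst 1 t)) _.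
  ring.
have [l2 hl2] : exists l, cder (fun t => - (P t * W^`().[z t] * u t)) 0 l.
  eexists; apply: cder_opp; apply: cder_mul hu0; apply: cder_mul hP0 _.
  exact: cder_horner hz0.
have [r2 /andP[r20 r2r] hPW] : exists2 r2 : R, 0 < r2 <= r &
    forall t, `|t| < r2 -> P t * W.[z t] - 1 = 0.
  apply: (cder_gronwall_near r0 hl2); last first.
    by rewrite zi Pi mulVf // subrr.
  move=> t tr; have [hz hu hy hP hQ] := hode t tr.
  apply: cder_eq (cder_sub (cder_mul hP (cder_horner W hz)) (cder_cst 1 t)) _.
  ring.
have QV t : `|t| < r1 -> Q t * V.[z t] = 1 by move=> /hQV /eqP; rewrite subr_eq0 => /eqP.
have PW t : `|t| < r2 -> P t * W.[z t] = 1 by move=> /hPW /eqP; rewrite subr_eq0 => /eqP.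
(* the speed is constant *)
have huu t : `|t| < r -> u t * conjc (u t) = 1.
  move=> tr.
  have -> : u t * conjc (u t) = u 0 * conjc (u 0).
    apply: (@cder0_near (fun t => u t * conjc (u t)) r r0) => // s sr.
    have [hz hu hy hP hQ] := hode s sr.
    apply: cder_eq (cder_mul hu (cder_conj hu)) _.
    rewrite -/(B s); move: (B s * u s) => b.
    rewrite !conjcM conjcD conjcN conjcK conjc_half.
    by ring.
  by rewrite ui; apply/eqP; rewrite -subr_eq0 -sqr_normc normc_def
    -sqr_normc_ReIm sqrtr_sqr ger0_norm ?normc_ge0 // d1 expr1n subrr.
have nu t : `|t| < r -> normc (u t) = 1.
  move=> /huu h; have := congr1 (@Normc.normc R) h; rewrite normcM normc_conj normc1 => /eqP.
  by rewrite -expr2 sqrp_eq1 ?normc_ge0 // => /eqP.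
(* zeta' = eta is real *)
pose et t := u t * y t * Q t * W.[z t] / k%:R.
pose bt t := (B t * u t + conjc (B t * u t)) / 2.
have bt_conj t : conjc (bt t) = bt t.
  by rewrite /bt conjcM conjcD conjcK conjc_half [in LHS]addrC.
have [d3 [d30 d31 d32 d3r]] := minr_gt0_le3 r10 r20 r0.
have het t : `|t| < d3 -> cder et t (- bt t * et t).
  move=> td.
  have [hz hu hy hP hQ] := hode t (lt_le_trans td d3r).
  have QVt := QV t (lt_le_trans td d31); have PWt := PW t (lt_le_trans td d32).
  have Vt0 : V.[z t] != 0.
    by apply/eqP => h; move: QVt; rewrite h mulr0 => /eqP; rewrite eq_sym oner_eq0.
  have Wt0 : W.[z t] != 0.
    by apply/eqP => h; move: PWt; rewrite h mulr0 => /eqP; rewrite eq_sym oner_eq0.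
  have Qt : Q t = V.[z t]^-1 by apply: (mulIf Vt0); rewrite QVt mulVf.
  have Pt : P t = W.[z t]^-1 by apply: (mulIf Wt0); rewrite PWt mulVf.
  apply: cder_eq (cder_mul (cder_mul (cder_mul (cder_mul hu hy) hQ)
      (cder_horner W hz)) (cder_cst (k%:R^-1) t)) _.
  have k1 : (k%:R : C) = k.-1%:R + 1 by rewrite -{1}(prednK k0) natr1.
  rewrite /et /bt /B; set b := conjc _.
  rewrite /curvB Pt Qt k1.
  move: kC; rewrite k1; move: (k.-1%:R : C) => kk kC.
  field; rewrite Vt0 Wt0 kC /=.
  by [].
have [l4 hl4] : exists l, cder (fun t => - bt t) 0 l.
  have [lB hB] : exists l, cder (fun t => B t * u t) 0 l.
    eexists; apply: cder_mul hu0; apply: cder_sub.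
      apply: cder_mulr; apply: cder_mul hQ0; exact: cder_horner hz0.
    by apply: cder_mul hP0 _; exact: cder_horner hz0.
  eexists; apply: cder_opp; apply: (cder_mul _ (cder_cst 2^-1 0)).
  exact: cder_add hB (cder_conj hB).
have et0 : et 0 = 1.
  by rewrite /et ui yi Qi zi W0; field; rewrite V0 dn0 kC.
have [d4 /andP[d40 d43] hetR] : exists2 d4 : R, 0 < d4 <= d3 &
    forall t, `|t| < d4 -> et t - conjc (et t) = 0.
  apply: (cder_gronwall_near d30 hl4); last by rewrite et0 conjc1 subrr.
  move=> t td.
  apply: cder_eq (cder_sub (het t td) (cder_conj (het t td))) _.
  by rewrite conjcM conjcN bt_conj; ring.
have etR t : `|t| < d4 -> Im (et t) = 0.
  move=> /hetR /eqP; rewrite subr_eq0 => /eqP h.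
  by have := congr1 (@complex.Im _) h; rewrite ImJ; lra.
pose ze t := (z t - z0) * y t.
have hze t : `|t| < d4 -> cder ze t (et t).
  move=> td.
  have [hz hu hy hP hQ] := hode t (lt_le_trans td (le_trans d43 d3r)).
  have QVt := QV t (lt_le_trans td (le_trans d43 d31)).
  apply: cder_eq (cder_mul (cder_sub hz (cder_cst z0 t)) hy) _.
  rewrite /et /W hornerD hornerZ hornerM hornerXsubC.
  have -> : u t * y t * Q t * (k%:R * V.[z t] + (z t - z0) * V^`().[z t]) / k%:R =
    u t * y t * (Q t * V.[z t]) + u t * y t * Q t * ((z t - z0) * V^`().[z t]) / k%:R.
    by field.
  rewrite QVt; ring.
have ze0 : ze 0 = 0 by rewrite /ze zi subrr mul0r.
have zeR t : `|t| < d4 -> Im (ze t) = 0.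
  move=> td.
  have : ze t - conjc (ze t) = ze 0 - conjc (ze 0).
    apply: (@cder0_near (fun t => ze t - conjc (ze t)) d4 d40) => // s sd.
    by apply: cder_eq (cder_sub (hze s sd) (cder_conj (hze s sd))) (hetR s sd).
  rewrite ze0 conjc0 subrr => /eqP; rewrite subr_eq0 => /eqP h.
  by have := congr1 (@complex.Im _) h; rewrite ImJ; lra.
(* y^k Q is constant, which gives the normal form *)
have yQ t : `|t| < r -> y t ^+ k * Q t = (d ^+ k)^-1 * c^-1.
  move=> tr; rewrite -exprVn -yi -Qi.
  apply: (@cder0_near (fun t => y t ^+ k * Q t) r r0) => // s sr.
  have [hz hu hy hP hQ] := hode s sr.
  apply: cder_eq (cder_mul (cder_exp k hy) hQ) _.
  have -> : y s ^+ k = y s * y s ^+ k.-1 by rewrite -exprS prednK.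
  by move: (y s ^+ k.-1) => w; field.
have TzE t : `|t| < d4 -> T.[z t] = T.[z0] + rho%:C * ze t ^+ k.
  move=> td; rewrite {1}TE hornerD hornerC hornerM horner_exp hornerXsubC.
  congr (_ + _); rewrite -rhoE /ze exprMn.
  have QVt := QV t (lt_le_trans td (le_trans d43 d31)).
  have h := yQ t (lt_le_trans td (le_trans d43 d3r)).
  have -> : y t ^+ k = (d ^+ k)^-1 * c^-1 * V.[z t].
    by rewrite -h -mulrA QVt mulr1.
  have dk0 : d ^+ k != 0 by rewrite expf_neq0.
  by field; rewrite V0 dk0.
have d40' : `|0 : R| < d4 by rewrite normr0.
have [d5 d50 hd5] := cder_cont (het 0 (lt_le_trans d40' d43)) ltr01.
exists z, (Num.min d4 d5), u, (fun t => Re (ze t)), (fun t => Re (et t)), a, k, V, rho.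
split => //.
- by split => //; rewrite lt_min d40.
- by rewrite ze0.
- move=> t; rewrite lt_min => /andP[td _].
  have tr := lt_le_trans td (le_trans d43 d3r).
  have [hz hu hy hP hQ] := hode t tr.
  by split => //; [exact: nu | eexists; exact: hu].
- move=> t; rewrite lt_min => /andP[td td5]; split.
  + by have [] := hze t td.
  + have := hd5 t; rewrite subr0 => /(_ td5); rewrite et0 => h.
    have := normc_Re (et t - 1); rewrite ReB /= => /le_lt_trans/(_ h).
    by rewrite ltr_norml => /andP[]; lra.
  + by rewrite TzE // (Im0_real (zeR t td)) /= rmorphM rmorphXn.
- move=> t; rewrite lt_min => /andP[td _].
  exact: hps (lt_le_trans td (le_trans d43 d3r)).
Qed.

End Germ.

(** * Local estimates for polynomials *)

Section PolyEstimates.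
Variable R : realType.
Local Notation C := R[i].
Implicit Types (p : {poly C}).

Lemma poly_bounded p (B : R) :
  exists2 M : R, 0 <= M & forall z : C, normc z <= B -> normc p.[z] <= M.
Proof.
elim/poly_ind: p => [|p c [M M0 IH]].
  by exists 0 => // z _; rewrite horner0 normc0.
exists (M * `|B| + normc c); first by rewrite addr_ge0 ?mulr_ge0 ?normc_ge0.
move=> z zB; rewrite hornerMXaddC; apply: le_trans (normcD _ _) _.
rewrite lerD2r normcM ler_pM ?normc_ge0 ?IH //.
by apply: le_trans zB (ler_norm _).
Qed.

Lemma poly_lipschitz p (B : R) :
  exists2 K : R, 0 <= K & forall z w : C, normc z <= B -> normc w <= B ->
    normc (p.[z] - p.[w]) <= K * normc (z - w).
Proof.
elim/poly_ind: p => [|p c [K K0 IH]].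
  by exists 0 => // z w _ _; rewrite !horner0 subrr normc0 mul0r.
have [M M0 hM] := poly_bounded p B.
exists (K * `|B| + M); first by rewrite addr_ge0 // mulr_ge0.
move=> z w zB wB; rewrite !hornerMXaddC.
have -> : p.[z] * z + c - (p.[w] * w + c) = (p.[z] - p.[w]) * z + p.[w] * (z - w).
  by ring.
apply: le_trans (normcD _ _) _; rewrite !normcM mulrDl mulrAC lerD //.
  by rewrite ler_pM ?normc_ge0 ?IH // (le_trans zB) // ler_norm.
by rewrite ler_wpM2r ?normc_ge0 // hM.
Qed.

Lemma poly_taylor1 p (B : R) :
  exists2 K : R, 0 <= K & forall z w : C, normc z <= B -> normc w <= B ->
    normc (p.[z] - p.[w] - p^`().[w] * (z - w)) <= K * normc (z - w) ^+ 2.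
Proof.
elim/poly_ind: p => [|p c [K K0 IH]].
  by exists 0 => // z w _ _; rewrite deriv0 !horner0 mul0r !subrr normc0 mul0r.
have [L L0 hL] := poly_lipschitz p B.
exists (`|B| * K + L); first by rewrite addr_ge0 // mulr_ge0.
move=> z w zB wB; rewrite derivMXaddC !hornerMXaddC hornerD hornerMX.
have -> : p.[z] * z + c - (p.[w] * w + c) - (p.[w] + p^`().[w] * w) * (z - w) =
   w * (p.[z] - p.[w] - p^`().[w] * (z - w)) + (z - w) * (p.[z] - p.[w]).
  by ring.
apply: le_trans (normcD _ _) _; rewrite !normcM mulrDl; apply: lerD.
  by rewrite -mulrA ler_pM ?normc_ge0 ?IH // (le_trans wB) // ler_norm.
by rewrite expr2 mulrA [leLHS]mulrC ler_wpM2r ?normc_ge0 // hL.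
Qed.

Lemma poly_continuous p (z : C) (e : R) : 0 < e ->
  exists2 d : R, 0 < d & forall w, normc (w - z) < d -> normc (p.[w] - p.[z]) < e.
Proof.
move=> e0; have [K K0 hK] := poly_lipschitz p (normc z + 1).
have K1 : 0 < K + 1 by lra.
exists (Num.min 1 (e / (K + 1))); first by rewrite lt_min ltr01 divr_gt0.
move=> w; rewrite lt_min => /andP[w1 we].
have wB : normc w <= normc z + 1.
  by have := normcD (w - z) z; rewrite subrK; lra.
apply: le_lt_trans (hK w z wB _) _; first by lra.
have := normc_ge0 (w - z); move: we; rewrite ltr_pdivlMr //; nra.
Qed.

Lemma poly_loc_inj p (z1 : C) : p^`().[z1] != 0 ->
  exists d c : R, [/\ 0 < d, 0 < c & forall z w,
    normc (z - z1) < d -> normc (w - z1) < d ->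
    c * normc (z - w) <= normc (p.[z] - p.[w])].
Proof.
rewrite -normc_gt0 => m0; set m := normc _ in m0.
have [K K0 hK] := poly_taylor1 p (normc z1 + 1).
have m2 : 0 < m / 2 by lra.
have [d d0 hd] := poly_continuous p^`() z1 m2.
have q0 : 0 < m / (8 * (K + 1)) by rewrite divr_gt0 // mulr_gt0 //; lra.
exists (Num.min 1 (Num.min d (m / (8 * (K + 1))))), (m / 4).
split; [by rewrite !lt_min ltr01 d0|lra|].
move=> z w; rewrite !lt_min => /and3P[z1' zd zm] /and3P[w1' wd wm].
have zB : normc z <= normc z1 + 1 by have := normcD (z - z1) z1; rewrite subrK; lra.
have wB : normc w <= normc z1 + 1 by have := normcD (w - z1) z1; rewrite subrK; lra.
have H := hK z w zB wB.
have H2 := normc_ge_sub (p^`().[w] * (z - w)) (p^`().[w] * (z - w) - (p.[z] - p.[w])).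
have E : p^`().[w] * (z - w) - (p^`().[w] * (z - w) - (p.[z] - p.[w])) = p.[z] - p.[w].
  by ring.
rewrite E normcB normcM in H2.
have H3 : m / 2 <= normc p^`().[w].
  have := normc_ge_sub p^`().[z1] (p^`().[z1] - p^`().[w]).
  have -> : p^`().[z1] - (p^`().[z1] - p^`().[w]) = p^`().[w] by ring.
  by rewrite (normcB p^`().[z1]); have := hd w wd; rewrite -/m; lra.
have zw : normc (z - w) <= m / (4 * (K + 1)).
  have := normcBD z z1 w; rewrite (normcB z1).
  have -> : m / (4 * (K + 1)) = 2 * (m / (8 * (K + 1))).
    by field; rewrite gt_eqF //; lra.
  lra.
have KZ : K * normc (z - w) <= m / 4.
  have : (K + 1) * normc (z - w) <= m / 4.
    rewrite mulrC -ler_pdivlMr; last by lra.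
    by rewrite -mulrA -invfM.
  have := normc_ge0 (z - w); lra.
have n0 := normc_ge0 (z - w).
have : K * normc (z - w) ^+ 2 <= m / 4 * normc (z - w).
  by rewrite expr2 mulrA ler_wpM2r.
have : m / 2 * normc (z - w) <= normc p^`().[w] * normc (z - w).
  by rewrite ler_wpM2r.
lra.
Qed.

End PolyEstimates.

Section LocalForm.
Variable R : realType.
Local Notation C := R[i].
Implicit Types (T V : {poly C}) (z d : C).

Lemma local_form_exists T z : (1 < size T)%N -> exists k V, local_form T z k V.
Proof.
move=> sT; pose p := T - T.[z]%:P.
have p0 : p != 0.
  apply/eqP => /eqP; rewrite subr_eq0 => /eqP h.
  by move: sT; rewrite h size_polyC; case: (_ != _).
have [k [q hq pq]] := multiplicity_XsubC p z.
move: hq; rewrite p0 /= => hq; exists k, q; split.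
- rewrite lt0n; apply/eqP => k0; move: pq; rewrite k0 expr0 mulr1 => pq.
  by move: hq; rewrite -pq /root /p hornerD hornerN hornerC subrr eqxx.
- by rewrite mulrC -pq /p addrC subrK.
- exact: hq.
Qed.

Lemma local_form_unique T z k V k' V' :
  local_form T z k V -> local_form T z k' V' -> k = k' /\ V = V'.
Proof.
wlog kk : k V k' V' / (k <= k')%N => [hw|] h h'.
  have /orP[kk|kk] := leq_total k k'; first exact: hw.
  by have [-> ->] := hw _ _ _ _ kk h' h.
have [_ e v] := h; have [_ e' v'] := h'.
have E : ('X - z%:P) ^+ k * V = ('X - z%:P) ^+ k * (('X - z%:P) ^+ (k' - k) * V').
  by rewrite mulrA -exprD subnKC //; apply: (@addrI _ T.[z]%:P); rewrite -e -e'.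
have X0 : ('X - z%:P) ^+ k != 0 by rewrite expf_neq0 // polyXsubC_eq0.
have {}E := mulfI X0 E.
have kk' : (k' - k = 0)%N.
  apply/eqP; apply: contraNT v => hk.
  by rewrite E hornerM horner_exp hornerXsubC subrr expr0n (negPf hk) mul0r.
split; last by rewrite E kk' expr0 mul1r.
by apply/eqP; rewrite eqn_leq kk -subn_eq0 kk'.
Qed.

Lemma local_form_simple T z : T^`().[z] != 0 ->
  exists2 V, local_form T z 1 V & V.[z] = T^`().[z].
Proof.
move=> h.
have sT : (1 < size T)%N.
  rewrite ltnNge; apply/negP => sT; move: h.
  by rewrite (size1_polyC sT) derivC horner0 eqxx.
have [k [V lf]] := local_form_exists z sT; have [k0 e v] := lf.
have D : T^`().[z] = V.[z] * (0 ^+ k.-1 *+ k).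
  rewrite e derivD derivC add0r derivM deriv_exp derivXsubC mul1r.
  rewrite hornerD !hornerM hornerMn !horner_exp hornerXsubC subrr.
  by rewrite [0 ^+ k]expr0n -[k == 0]negbK -lt0n k0 mul0r addr0 mulrC.
have k1 : k = 1%N.
  apply/eqP; rewrite -(prednK k0) eqSS; apply: contraNT h => hk.
  by rewrite D expr0n (negPf hk) mul0rn mulr0.
exists V; first by rewrite -k1.
by rewrite D k1 expr0 mulr1n mulr1.
Qed.

Lemma germ_exists_simple T z d : T^`().[z] != 0 -> normc d = 1 ->
  Im (T^`().[z] * d) = 0 -> exists g, germ T z d g.
Proof.
move=> h d1 hI; have [V lf VE] := local_form_simple h.
by apply: germ_exists lf d1 _; rewrite VE expr1.
Qed.

End LocalForm.

Section Nice.
Variable R : realType.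
Local Notation C := R[i].
Variable T : {poly C}.
Implicit Types (z d : C) (g h : R -> C) (s t : R).

Lemma is_derive_exp (F : R -> R) t (l : R) n : is_derive t (1 : R) F l ->
  is_derive t (1 : R) (fun s => F s ^+ n) (n%:R * F t ^+ n.-1 * l).
Proof.
move=> hF; have -> : (fun s => F s ^+ n) = (F ^+ n)%R.
  by rewrite exprfctE.
exact: is_deriveX.
Qed.

Lemma mvt_near (F dF : R -> R) r x y :
  (forall t, `|t| < r -> is_derive t (1 : R) F (dF t)) ->
  `|x| < r -> `|y| < r -> x <= y ->
  exists2 c, x <= c <= y & F y - F x = dF c * (y - x).
Proof.
move=> hF; rewrite !ltr_norml => /andP[x1 x2] /andP[y1 y2] xy.
have inr t : x <= t <= y -> `|t| < r.
  by move=> /andP[t1 t2]; rewrite ltr_norml; apply/andP; split; lra.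
have dF' t : t \in `]x, y[%R -> is_derive t (1 : R) F (dF t).
  by move=> /itvP ht; apply: hF; apply: inr; rewrite !ltW ?ht.
have cF : {within `[x, y]%classic, continuous F}.
  apply: derivable_within_continuous => t /itvP ht.
  have tr : `|t| < r by apply: inr; rewrite !ht.
  by have [] := hF t tr.
have [c hc ->] := MVT_segment xy dF' cF.
by exists c => //; rewrite !(itvP hc).
Qed.

Lemma germ_zeta (zeta eta : R -> R) r :
  (forall t, `|t| < r -> is_derive t (1 : R) zeta (eta t)) ->
  (forall t, `|t| < r -> 0 < eta t) -> zeta 0 = 0 ->
  forall t, `|t| < r -> (0 < t -> 0 < zeta t) /\ (t < 0 -> zeta t < 0).
Proof.
move=> hz he z0 t tr.
have r00 : `|0 : R| < r by rewrite normr0 (le_lt_trans _ tr).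
split=> t0.
- have [c /andP[c0 ct]] := mvt_near hz r00 tr (ltW t0).
  rewrite z0 !subr0 => ->; rewrite mulr_gt0 // he //.
  by rewrite ger0_norm // (le_lt_trans ct) // -(gtr0_norm t0).
- have [c /andP[tc c0]] := mvt_near hz tr r00 (ltW t0).
  rewrite z0 !sub0r => h; rewrite -oppr_gt0 h mulr_gt0 ?oppr_gt0 // he //.
  by rewrite ler0_norm // (le_lt_trans _ tr) // ltr0_norm // lerN2.
Qed.

Lemma Im_real_const (f : R -> C) (c l : C) r : 0 < r ->
  (forall s, `|s| < r -> Im (f s - c) = 0) ->
  forall t, `|t| < r -> cder f t l -> Im l = 0.
Proof.
move=> r0 hI t tr [_ [_ <-]].
have := @near_eq_derive R R R (fun=> Im c) (fun s => Im (f s)) t 1.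
rewrite derive_cst => <- //.
have d0 : 0 < r - `|t| by rewrite subr_gt0.
apply/nbhs_ballP; exists (r - `|t|) => // s.
rewrite /ball /= => hs.
have := hI s; rewrite ImB => /(_ _) /eqP; rewrite subr_eq0 => H.
apply/esym/eqP; apply: H.
have := ler_normD (s - t) t; rewrite subrK distrC; lra.
Qed.

Lemma germ_facts z d g : germ T z d g ->
  exists (r : R) (u : R -> C),
    [/\ 0 < r, g 0 = z, u 0 = d, normc d = 1 &
    forall t, `|t| < r ->
      [/\ cder g t (u t), normc (u t) = 1, exists l, cder u t l,
          Im (T.[g t] - T.[z]) = 0 /\ Im (T^`().[g t] * u t) = 0 &
          t != 0 -> T^`().[g t] != 0]].
Proof.
move=> [r [u [zeta [eta [a [k [V [rho [[r0 lf rhoE rho0] [g0 u0 ze0 d1] h1 h2 h3]]]]]]]]].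
have [k0 _ _] := lf.
have hI t : `|t| < r -> Im (T.[g t] - T.[z]) = 0.
  by move=> /h2[_ _ ->]; rewrite addrAC subrr add0r.
exists r, u; split => // t tr.
have [c1 c2 c3] := h1 t tr; have [e1 e2 e3] := h2 t tr.
have cT := cder_horner T c1.
split => //.
- split; first exact: hI.
  exact: (Im_real_const r0 hI tr cT).
- move=> t0; apply/eqP => hT.
  have zt0 : zeta t != 0.
    have [zp zn] := germ_zeta (fun s sr => let: And3 a _ _ := h2 s sr in a)
       (fun s sr => let: And3 _ b _ := h2 s sr in b) ze0 tr.
    by case: (ltgtP t 0) t0 => // ht _; [rewrite lt_eqF ?zn|rewrite gt_eqF ?zp].
  have [cR _] := cT; move: cR; rewrite hT mul0r /= => -[_ D0].
  have D : is_derive t (1 : R) (fun s => Re T.[z] + rho * zeta s ^+ k)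
      (rho * (k%:R * zeta t ^+ k.-1 * eta t)).
    have := is_deriveD (is_derive_cst (Re T.[z]) t (1 : R))
      (is_deriveM (is_derive_cst rho t (1 : R)) (is_derive_exp k e1)).
    move=> hD; apply: is_derive_eq hD _.
    by rewrite /GRing.scale /= mulr0 addr0 add0r.
  have E : 'D_1 (fun s => Re T.[z] + rho * zeta s ^+ k) t = 'D_1 (fun s => Re T.[g s]) t.
    apply: near_eq_derive.
    have d0 : 0 < r - `|t| by rewrite subr_gt0.
    apply/nbhs_ballP; exists (r - `|t|) => // s; rewrite /ball /= => hs.
    have sr : `|s| < r by have := ler_normD (s - t) t; rewrite subrK distrC; lra.
    by have [_ _ ->] := h2 s sr; rewrite ReD.
  move: E; rewrite D0; case: D => _ -> /eqP.
  rewrite !mulf_eq0 (negPf rho0) pnatr_eq0 expf_eq0 (negPf zt0) andbF.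
  by rewrite -[k == 0]negbK -lt0n k0 (gt_eqF e2).
Qed.

(** Away from critical points T is a local coordinate, in which the velocity
    of a unit-speed curve with T real is [+- |T'|], a Lipschitz function of
    the position. *)
Lemma noncrit_unique (g1 g2 u1 u2 : R -> C) r (z : C) : 0 < r ->
  T^`().[z] != 0 -> g1 0 = z -> g2 0 = z -> u1 0 = u2 0 ->
  (forall t, `|t| < r -> [/\ cder g1 t (u1 t), normc (u1 t) = 1,
      exists l, cder u1 t l & Im (T.[g1 t] - T.[z]) = 0]) ->
  (forall t, `|t| < r -> [/\ cder g2 t (u2 t), normc (u2 t) = 1,
      exists l, cder u2 t l & Im (T.[g2 t] - T.[z]) = 0]) ->
  exists2 e, 0 < e & forall t, `|t| < e -> g1 t = g2 t.
Proof.
move=> r0 T'z g10 g20 u120 H1 H2.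
have r00 : `|0 : R| < r by rewrite normr0.
have [d [c [d0 c0 hc]]] := poly_loc_inj T'z.
have [K K0 hK] := poly_lipschitz T^`() (normc z + d).
(* the sign of (T o g)' is locally constant, and its modulus is |T'| *)
have key (g u : R -> C) : g 0 = z -> u 0 = u1 0 ->
  (forall t, `|t| < r -> [/\ cder g t (u t), normc (u t) = 1,
      exists l, cder u t l & Im (T.[g t] - T.[z]) = 0]) ->
  exists e : R, [/\ 0 < e, e <= r & forall t, `|t| < e ->
    normc (g t - z) < d /\
    Re (T^`().[g t] * u t) = Num.sg (Re (T^`().[z] * u1 0)) * normc T^`().[g t]].
  move=> gz uu H.
  have [cg nu [l cu] _] := H 0 r00.
  have hI t : `|t| < r -> Im (T^`().[g t] * u t) = 0.
    move=> tr; have [cgt _ _ _] := H t tr.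
    apply: (Im_real_const r0 (f := fun s => T.[g s]) (c := T.[z])) tr _.
      by move=> s /H[].
    exact: cder_horner.
  have [e1 e10 he1] := cder_cont cg d0.
  pose p t := T^`().[g t] * u t.
  have cp : cder p 0 (T^`(2).[g 0] * u 0 * u 0 + T^`().[g 0] * l).
    by apply: cder_mul cu; rewrite derivnS derivn1; exact: cder_horner.
  have np t : `|t| < r -> `|Re (p t)| = normc T^`().[g t].
    move=> tr; rewrite -normcR -(Im0_real (hI t tr)) normcM.
    by have [_ -> _ _] := H t tr; rewrite mulr1.
  have p0 : 0 < `|Re (p 0)| by rewrite np // gz normc_gt0.
  have [e2 e20 he2] := cder_cont cp p0.
  have [e [h0 h1 h2 h3]] := minr_gt0_le3 e10 e20 r0.
  exists e; split => // t te; split.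
    by have := he1 t; rewrite subr0 gz; apply; apply: lt_le_trans te h1.
  have tr : `|t| < r := lt_le_trans te h3.
  rewrite -np // -/(p t).
  have -> : Re (T^`().[z] * u1 0) = Re (p 0) by rewrite /p gz uu.
  have := he2 t; rewrite subr0 => /(_ (lt_le_trans te h2)) hp.
  have := le_lt_trans (normc_Re _) hp; rewrite ReB ltr_norml => /andP[b1 b2].
  have [q0|q0|q0] := ltgtP (Re (p 0)) 0.
  - move: b1 b2; rewrite (ltr0_norm q0) => b1 b2.
    rewrite (ltr0_sg q0) ltr0_norm ?mulN1r ?opprK //; lra.
  - move: b1 b2; rewrite (gtr0_norm q0) => b1 b2.
    rewrite (gtr0_sg q0) gtr0_norm ?mul1r //; lra.
  - by move: p0; rewrite q0 normr0 ltxx.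
have [e1 [e10 e1r k1]] := key g1 u1 g10 erefl H1.
have [e2 [e20 e2r k2]] := key g2 u2 g20 (esym u120) H2.
have [e [e0 ee1 ee2 er]] := minr_gt0_le3 e10 e20 r0.
pose D t := Re T.[g1 t] - Re T.[g2 t].
have TD t : `|t| < e -> T.[g1 t] - T.[g2 t] = (D t)%:C.
  move=> te; have tr := lt_le_trans te er.
  have [_ _ _ i1] := H1 t tr; have [_ _ _ i2] := H2 t tr.
  rewrite /D -ReB; apply: Im0_real.
  by move: i1 i2; rewrite !ImB; lra.
have gD t : `|t| < e -> c * normc (g1 t - g2 t) <= `|D t|.
  move=> te; rewrite -normcR -TD //; apply: hc.
    by have [] := k1 t (lt_le_trans te ee1).
  by have [] := k2 t (lt_le_trans te ee2).
exists e => // t te.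
pose dD t := Re (T^`().[g1 t] * u1 t) - Re (T^`().[g2 t] * u2 t).
have D0 : D t ^+ 2 = 0.
  apply: (@real_gronwall R (fun t => D t ^+ 2) (fun t => 2 * D t * dD t) (2 * (K / c)) e).
  - by rewrite mulr_ge0 // divr_ge0 // ltW.
  - move=> s se; have sr := lt_le_trans se er.
    have [c1 _ _ _] := H1 s sr; have [c2 _ _ _] := H2 s sr.
    have [d1 _] := cder_horner T c1; have [d2 _] := cder_horner T c2.
    have := is_derive_exp 2 (is_deriveB d1 d2).
    by rewrite expr1.
  - by move=> s _; rewrite sqr_ge0.
  - move=> s se; rewrite !normrM ger0_norm // -!mulrA ler_wpM2l //.
    have [n1 s1] := k1 s (lt_le_trans se ee1).
    have [n2 s2] := k2 s (lt_le_trans se ee2).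
    have sg1 : `|Num.sg (Re (T^`().[z] * u1 0))| <= 1 by rewrite normr_sg; case: (_ != 0).
    have dDb : `|dD s| <= K * normc (g1 s - g2 s).
      rewrite /dD s1 s2 -mulrBr normrM.
      apply: le_trans (ler_wpM2r (normr_ge0 _) sg1) _; rewrite mul1r.
      have B1 : normc (g1 s) <= normc z + d by have := normcD (g1 s - z) z; rewrite subrK; lra.
      have B2 : normc (g2 s) <= normc z + d by have := normcD (g2 s - z) z; rewrite subrK; lra.
      apply: le_trans _ (hK _ _ B1 B2); rewrite ler_norml; apply/andP; split.
        have := normc_ge_sub T^`().[g2 s] T^`().[g1 s]; rewrite (normcB T^`().[g2 s]); lra.
      exact: normc_ge_sub.
    have -> : K * (c^-1 * D s ^+ 2) = `|D s| * (K * (`|D s| / c)).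
      by rewrite -[D s ^+ 2]real_normK ?num_real //; ring.
    rewrite ler_wpM2l //; apply: le_trans dDb _; rewrite ler_wpM2l //.
    by rewrite ler_pdivlMr // mulrC; exact: gD.
  - by rewrite /D g10 g20 subrr expr0n.
  - exact: te.
move/eqP: D0; rewrite sqrf_eq0 => /eqP D0.
have := gD t te; rewrite D0 normr0 pmulr_rle0 // => h.
by apply/eqP; rewrite -subr_eq0 -normc_eq0 eq_le h normc_ge0.
Qed.

End Nice.

Section NiceCurves.
Variable R : realType.
Local Notation C := R[i].
Implicit Types (T : {poly C}) (z d : C) (g h : R -> C) (s t : R).

Lemma cder_curve_derive g t l : cder g t l -> curve_derive g t = l.
Proof.
move=> [[_ h1] [_ h2]]; rewrite /curve_derive !derive1E h1 h2.
by case: l {h1 h2}.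
Qed.

Lemma cder_rev g t l : cder g (- t) l -> cder (fun s => g (- s)) t (- l).
Proof.
move=> h; have h' : cder g (0 + -1 * t) l by rewrite add0r mulN1r.
have := cder_comp_affine h'; rewrite rmorphN /= mulN1r.
by congr (cder _ _ _); apply/funext => s; rewrite add0r mulN1r.
Qed.

Lemma cder_shift g c t l : cder g (c + t) l -> cder (fun s => g (c + s)) t l.
Proof.
move=> h; have h' : cder g (c + 1 * t) l by rewrite mul1r.
have := cder_comp_affine h'; rewrite mul1r.
by congr (cder _ _ _); apply/funext => s; rewrite mul1r.
Qed.

Lemma cder_near_eps (f g : R -> C) t l (e : R) : 0 < e ->
  (forall s, `|s - t| < e -> f s = g s) -> cder f t l -> cder g t l.
Proof.
move=> e0 fg; apply: cder_near; apply/nbhs_ballP; exists e => // s.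
by rewrite /ball /= distrC; exact: fg.
Qed.

Lemma germ_rev T z d g : germ T z d g -> germ T z (- d) (fun t => g (- t)).
Proof.
move=> [r [u [zeta [eta [a [k [V [rho [[r0 lf rhoE rho0] [g0 u0 ze0 d1] h1 h2 h3]]]]]]]]].
exists r, (fun t => - u (- t)), (fun t => - zeta (- t)), (fun t => eta (- t)),
  (fun n => (-1) ^+ n * a n), k, V, ((-1) ^+ k * rho).
split.
- split => //; last by rewrite mulf_neq0 // signr_eq0.
  by rewrite (exprNn d) mulrCA rhoE rmorphM rmorphXn rmorphN1.
- by rewrite oppr0 g0 u0 ze0 oppr0 normcN.
- move=> t tr; have tr' : `|- t| < r by rewrite normrN.
  have [c1 c2 [l c3]] := h1 _ tr'; split.
  + exact: cder_rev.
  + by rewrite normcN.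
  + by exists (- - l); apply: cder_opp; exact: cder_rev.
- move=> t tr; have tr' : `|- t| < r by rewrite normrN.
  have [c1 c2 c3] := h2 _ tr'; split => //.
  + have := is_deriveN (is_derive1_comp c1 (is_deriveN (is_derive_id t (1 : R)))).
    by move=> hd; apply: is_derive_eq hd _; rewrite mulrN1 opprK.
  + by rewrite c3 (exprNn (zeta _)) mulrACA -expr2 sqrr_sign mul1r.
- move=> t tr; have tr' : `|- t| < r by rewrite normrN.
  have [c1 c2] := h3 _ tr'.
  have E (b : nat -> R) : pseries (fun n => (-1) ^+ n * b n) t = pseries b (- t).
    rewrite /pseries; congr (series _); apply/funext => n /=.
    by rewrite (exprNn t); ring.
  have S n (x : C) : Re ((-1) ^+ n * x) = (-1) ^+ n * Re x /\
                     Im ((-1) ^+ n * x) = (-1) ^+ n * Im x.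
    have -> : (-1) ^+ n * x = x * ((-1) ^+ n : R)%:C.
      by rewrite rmorphXn rmorphN1 mulrC.
    by rewrite ReMr ImMr !(mulrC ((-1) ^+ n)).
  split.
  + have -> : (fun n => Re ((-1) ^+ n * a n)) = (fun n => (-1) ^+ n * Re (a n)).
      by apply/funext => n; have [-> _] := S n (a n).
    by rewrite E.
  + have -> : (fun n => Im ((-1) ^+ n * a n)) = (fun n => (-1) ^+ n * Im (a n)).
      by apply/funext => n; have [_ ->] := S n (a n).
    by rewrite E.
Qed.

Definition upper_half d := (0 < Re d) || ((Re d == 0) && (0 < Im d)).

Lemma upper_halfN d : d != 0 -> upper_half (- d) = ~~ upper_half d.
Proof.
rewrite /upper_half ReN ImN !oppr_gt0 oppr_eq0 => d0.
have [r0|r0|r0] //= := ltgtP (Re d) 0.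
have [i0|i0|i0] //= := ltgtP (Im d) 0.
by move: d0; rewrite (_ : d = 0) ?eqxx //; apply: complex_ext.
Qed.

Definition pick_germ T z d : R -> C :=
  if pselect (exists g, germ T z d g) is left h then projT1 (cid h) else fun=> 0.

(** One curve is chosen for each line direction, not for each direction, so
    that reversing the orientation of a curve composed of chosen germs yields
    such a curve again. *)
Definition std_germ T z d t : C :=
  if upper_half d then pick_germ T z d t else pick_germ T z (- d) (- t).

Lemma pick_germP T z d g : germ T z d g -> germ T z d (pick_germ T z d).
Proof.
move=> hg; rewrite /pick_germ; case: pselect => [h|]; first exact: (projT2 (cid h)).
by move=> h; exfalso; apply: h; exists g.
Qed.

Lemma std_germP T z d g : germ T z d g -> germ T z d (std_germ T z d).
Proof.
move=> hg; have -> : std_germ T z d = if upper_half d then pick_germ T z d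
    else (fun t => pick_germ T z (- d) (- t)).
  by apply/funext => t; rewrite /std_germ; case: ifP.
case: ifP => _; first exact: pick_germP hg.
by rewrite -{1}(opprK d); apply: germ_rev; exact: pick_germP (germ_rev hg).
Qed.

Lemma std_germN T z d t : d != 0 -> std_germ T z (- d) t = std_germ T z d (- t).
Proof.
move=> d0; rewrite /std_germ upper_halfN // opprK.
by case: (upper_half d); rewrite //= opprK.
Qed.

Section Fixed.
Variable T : {poly C}.

Definition nice_at g t d : Prop :=
  (exists h, germ T (g t) d h) /\
  exists2 e, 0 < e & forall s, `|s| < e -> g (t + s) = std_germ T (g t) d s.

Lemma nice_germ g t d : nice_at g t d -> germ T (g t) d (std_germ T (g t) d).
Proof. by case=> -[h hg] _; exact: std_germP hg. Qed.

Lemma nice_local g t d : nice_at g t d ->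
  exists (r : R) (u : R -> C), [/\ 0 < r, u 0 = d, normc d = 1 &
    forall s, `|s| < r ->
      [/\ cder g (t + s) (u s), normc (u s) = 1, exists l, cder u s l,
          Im (T.[g (t + s)] - T.[g t]) = 0 & s != 0 -> T^`().[g (t + s)] != 0]].
Proof.
move=> ng; have [_ [e e0 he]] := ng.
have [r [u [r0 g0 u0 d1 H]]] := germ_facts (nice_germ ng).
exists (Num.min r e), u; split => //; first by rewrite lt_min r0.
move=> s; rewrite lt_min => /andP[sr se].
have [c1 c2 c3 [c4 _] c5] := H s sr; rewrite he //; split => //.
have c1' : cder (fun x => std_germ T (g t) d (- t + x)) (t + s) (u s).
  by apply: cder_shift; rewrite addKr.
have e' : 0 < e - `|s| by rewrite subr_gt0.
apply: cder_near_eps e' _ c1' => x hx.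
have xe : `|- t + x| < e.
  have -> : - t + x = (x - (t + s)) + s by ring.
  by apply: le_lt_trans (ler_normD _ _) _; rewrite -ltrBrDr.
by rewrite -he // addrA addrN add0r.
Qed.

Lemma nice_norm1 g t d : nice_at g t d -> normc d = 1.
Proof. by move=> /nice_local[r [u []]]. Qed.

Lemma nice_neq0 g t d : nice_at g t d -> d != 0.
Proof. by move=> /nice_norm1 h; rewrite -normc_gt0 h. Qed.

Lemma nice_cder g t d : nice_at g t d -> cder g t d.
Proof.
move=> /nice_local[r [u [r0 <- _ H]]].
by have := H 0; rewrite normr0 addr0 => /(_ r0)[].
Qed.

Lemma nice_dir g t d : nice_at g t d -> curve_derive g t = d.
Proof. by move=> /nice_cder; exact: cder_curve_derive. Qed.

Lemma nice_rev g t d : nice_at g t d -> nice_at (fun s => g (- s)) (- t) (- d).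
Proof.
move=> ng; have d0 := nice_neq0 ng.
have [[h hg] [e e0 he]] := ng; split; first by rewrite opprK; eexists; exact: germ_rev hg.
exists e => // s se; rewrite opprD opprK std_germN // -he // ?normrN //.
Qed.

Lemma nice_shift g c t d : nice_at g (c + t) d -> nice_at (fun s => g (c + s)) t d.
Proof.
move=> [hg [e e0 he]]; split => //.
by exists e => // s se; rewrite addrA he.
Qed.

Lemma nice_eq_near g h t d (e : R) : 0 < e ->
  (forall s, `|s| < e -> g (t + s) = h (t + s)) -> nice_at g t d -> nice_at h t d.
Proof.
move=> e0 gh [hg [e' e0' he]].
have gt : g t = h t by have := gh 0; rewrite normr0 addr0; apply.
split; first by rewrite -gt.
exists (Num.min e e'); first by rewrite lt_min e0.
by move=> s; rewrite lt_min => /andP[s1 s2]; rewrite -gh // he // gt.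
Qed.

Lemma nice_same_germ g h t t' d : nice_at g t d -> nice_at h t' d -> g t = h t' ->
  exists2 e, 0 < e & forall s, `|s| < e -> g (t + s) = h (t' + s).
Proof.
move=> [_ [e e0 he]] [_ [e' e0' he']] gh.
exists (Num.min e e'); first by rewrite lt_min e0.
by move=> s; rewrite lt_min => /andP[s1 s2]; rewrite he // he' // gh.
Qed.

(** A germ is nice at all nearby times: there it passes through noncritical
    points, where [noncrit_unique] applies. *)
Lemma std_germ_nice z d h : germ T z d h ->
  exists2 e, 0 < e & forall t, `|t| < e -> exists d', nice_at (std_germ T z d) t d'.
Proof.
move=> hg; have sg := std_germP hg; set g := std_germ T z d in sg *.
have [r [u [r0 g0 u0 d1 H]]] := germ_facts sg.
exists r => // t tr.
have [->|t0] := eqVneq t 0.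
  exists d; split; first by rewrite g0; exists h.
  by exists 1 => // s _; rewrite add0r g0.
have [c1 c2 c3 [c4 c5] c6] := H t tr.
have {}c6 := c6 t0.
have [h' hg'] := germ_exists_simple c6 c2 c5.
exists (u t); split; first by exists h'.
have sg' := std_germP hg'.
have [r' [u' [r0' g0' u0' d1' H']]] := germ_facts sg'.
have e0 : 0 < r - `|t| by rewrite subr_gt0.
apply: (@noncrit_unique R T (fun s => g (t + s)) (std_germ T (g t) (u t))
  (fun s => u (t + s)) u' (Num.min r' (r - `|t|)) (g t)) => //.
- by rewrite lt_min r0'.
- by rewrite addr0.
- by rewrite u0' addr0.
- move=> s; rewrite lt_min => /andP[_ sr].
  have tsr : `|t + s| < r by apply: le_lt_trans (ler_normD _ _) _; rewrite -ltrBrDl.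
  have [b1 b2 [l b3] [b4 _] _] := H _ tsr; split => //.
  + exact: cder_shift.
  + by exists l; exact: cder_shift.
  + by move: b4 c4; rewrite !ImB; lra.
- move=> s; rewrite lt_min => /andP[sr _].
  by have [b1 b2 b3 [b4 _] _] := H' _ sr.
Qed.

End Fixed.
End NiceCurves.

(** * A compactness lemma and the local openness of polynomials *)

Section RealLemmas.
Variable R : realType.
Local Notation C := R[i].
Implicit Types (g h : R -> C) (s t x y : R).

Lemma eps_continuous (f : R -> R) t :
  (forall e, 0 < e -> exists2 d, 0 < d & forall s, `|s - t| < d -> `|f s - f t| < e) ->
  {for t, continuous f}.
Proof.
move=> hf; apply/cvgrPdist_lt => e /hf[d d0 hd].
apply/nbhs_ballP; exists d => // s; rewrite /ball /= distrC => /hd.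
by rewrite distrC.
Qed.

Definition clamp (a b x : R) : R := Num.max a (Num.min b x).

Lemma clamp_in a b x : a <= b -> a <= clamp a b x <= b.
Proof. by move=> ab; rewrite /clamp le_max lexx ge_max ab ge_min lexx. Qed.

Lemma clamp_id a b x : a <= x <= b -> clamp a b x = x.
Proof. by move=> /andP[ax xb]; rewrite /clamp (min_idPr xb) (max_idPr ax). Qed.

Lemma clamp_dist a b x y : `|clamp a b x - clamp a b y| <= `|x - y|.
Proof.
have n1 := ler_norm (x - y); have n2 := ler_norm (y - x).
rewrite distrC in n2; rewrite /clamp ler_norml.
by case: (leP b x) => h1; case: (leP b y) => h2;
  do 2?[case: (leP a _) => ?]; apply/andP; split; lra.
Qed.

Definition cont_on (a b : R) (f : R -> R) := forall t, a <= t <= b ->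
  forall e, 0 < e -> exists2 d, 0 < d & forall s, a <= s <= b -> `|s - t| < d ->
    `|f s - f t| < e.

Lemma clamp_continuous a b (f : R -> R) : a <= b -> cont_on a b f ->
  continuous (fun x => f (clamp a b x)).
Proof.
move=> ab hf x; apply: eps_continuous => e e0.
have [d d0 hd] := hf _ (clamp_in x ab) e e0.
exists d => // s sx; apply: hd; first exact: clamp_in.
by apply: le_lt_trans sx; exact: clamp_dist.
Qed.

(** Continuity on a segment suffices for a two-sided derivative at the end
    points because the integrand is extended by its boundary values. *)
Lemma antiderivative a b (f : R -> R) : a <= b -> cont_on a b f ->
  exists F : R -> R, forall t, a <= t <= b -> is_derive t (1 : R) F (f t).
Proof.
move=> ab hf; pose h x := f (clamp a b x).
have ch : continuous h by exact: clamp_continuous.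
have hI : lebesgue_measure.-integrable `[a - 1, b + 1] (EFin \o h).
  apply: continuous_compact_integrable; first exact: segment_compact.
  by apply: continuous_subspaceT.
exists (fun x0 : R => (\int[lebesgue_measure]_(t in `[(a - 1)%R, x0]) h t)%R) => t /andP[t1 t2].
have tb : t < b + 1 by lra.
have ta : a - 1 < t by lra.
have [d1 d2] := continuous_FTC1_closed tb hI ta (ch t).
split => //; rewrite -derive1E d2 /h clamp_id //.
by rewrite t1.
Qed.

Lemma EVT_min_on a b (f : R -> R) : a <= b -> cont_on a b f ->
  exists2 c, a <= c <= b & forall t, a <= t <= b -> f c <= f t.
Proof.
move=> ab hf.
have [c hc hm] := @EVT_min R (fun x => f (clamp a b x)) a b ab
  (continuous_subspaceT (clamp_continuous ab hf)).
have {}hc : a <= c <= b by rewrite !(itvP hc).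
exists c => // t ht; have := hm t; rewrite !clamp_id //; apply.
by rewrite in_itv.
Qed.

Definition curve_on (a b : R) g := forall t, a <= t <= b -> exists l, cder g t l.

Lemma curve_dist_cont a b g (z : C) : curve_on a b g ->
  cont_on a b (fun t => normc (g t - z)).
Proof.
move=> hg t /hg[l hl] e e0; have [d d0 hd] := cder_cont hl e0.
exists d => // s _ sd; apply: le_lt_trans (hd s sd).
rewrite ler_norml; apply/andP; split.
- have := normcBD (g t) (g s) z; rewrite (normcB (g t) (g s)); lra.
- have := normcBD (g s) (g t) z; lra.
Qed.

Lemma curve_far a b g z : curve_on a b g -> (forall t, a <= t <= b -> g t != z) ->
  exists2 c, 0 < c & forall t, a <= t <= b -> c <= normc (g t - z).
Proof.
move=> hg hz; have [ab|ba] := leP a b; last first.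
  by exists 1 => // t /andP[h1 h2]; lra.
have [c hc hm] := EVT_min_on ab (curve_dist_cont z hg).
exists (normc (g c - z)) => //.
by rewrite normc_gt0 subr_eq0 hz.
Qed.

Lemma curve_far_except a b g z t0 e : curve_on a b g -> 0 < e ->
  (forall t, a <= t <= b -> t != t0 -> g t != z) ->
  exists2 c, 0 < c &
    forall t, a <= t <= b -> e <= `|t - t0| -> c <= normc (g t - z).
Proof.
move=> hg e0 hz.
have [c1 c10 h1] : exists2 c, 0 < c &
    forall t, a <= t <= Num.min b (t0 - e) -> c <= normc (g t - z).
  apply: curve_far => t; rewrite le_min => /and3P[h1 h2 h3].
    by apply: hg; rewrite h1.
  by apply: hz; rewrite ?h1 // lt_eqF //; lra.
have [c2 c20 h2] : exists2 c, 0 < c &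
    forall t, Num.max a (t0 + e) <= t <= b -> c <= normc (g t - z).
  apply: curve_far => t; rewrite ge_max -andbA => /and3P[h1' h2 h3].
    by apply: hg; rewrite h1'.
  by apply: hz; rewrite ?h1' // gt_eqF //; lra.
exists (Num.min c1 c2); first by rewrite lt_min c10.
move=> t /andP[at' tb]; rewrite [e <= _]leNgt ltr_norml ge_min => hn.
have [l0|l0] := leP t (t0 - e).
  by rewrite h1 // le_min at' tb.
have [r0|r0] := leP (t0 + e) t.
  by rewrite h2 ?orbT // ge_max at' r0 tb.
by exfalso; move/negP: hn; apply; apply/andP; split; lra.
Qed.

(** The principal argument along a curve in the right half-plane. *)
Lemma arg_derive (f : R -> C) t m : cder f t m -> 0 < Re (f t) ->
  is_derive t (1 : R) (fun s => atan (Im (f s) / Re (f s))) (Im (m / f t)).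
Proof.
move=> [f1 f2] r0.
have rn : Re (f t) != 0 by rewrite gt_eqF.
have D := is_deriveM f2 (is_deriveV rn f1).
have := is_derive1_comp (f := atan) (g := fun s => Im (f s) / Re (f s))
  (is_derive1_atan (Im (f t) / Re (f t))) D.
move=> hd; apply: is_derive_eq hd _.
rewrite /GRing.scale /=.
case: (f t) r0 rn => x y /= x0 xn; case: m {f1 f2 D} => p q /=.
have n0 : x ^+ 2 + y ^+ 2 != 0 by rewrite gt_eqF // ltr_wpDr ?sqr_ge0 // exprn_gt0.
have e1 : 1 + (y / x) ^+ 2 = (x ^+ 2 + y ^+ 2) / x ^+ 2 by field.
rewrite e1; field; rewrite xn n0 andbT.
by [].
Qed.

End RealLemmas.

Section LocalOpen.
Variable R : realType.
Local Notation C := R[i].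

Lemma direction_exists (c w : C) k : (0 < k)%N -> c != 0 -> normc w = 1 ->
  exists2 d, normc d = 1 & c * d ^+ k = (normc c)%:C * w.
Proof.
move=> k0 c0 w1; pose q := (normc c)%:C * w / c.
exists (k.-root q)%R.
  have E : normc (k.-root q)%R ^+ k = 1.
    rewrite -normcX rootCK // !normcM normcV normcR ger0_norm ?normc_ge0 // w1 mulr1.
    by rewrite mulfV // normc_eq0.
  by apply/eqP; rewrite -(@pexpr_eq1 _ _ k) ?normc_ge0 ?E.
by rewrite rootCK // /q mulrC divfK.
Qed.

(** A weak form of the open mapping theorem, sufficient for maximum
    principles.  Move from z in a direction along which the leading term of
    T - T(z) is a positive multiple of w. *)
Lemma poly_open (T : {poly C}) (z w : C) (e : R) : (1 < size T)%N -> normc w = 1 ->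
  0 < e -> exists q, normc (q - z) < e /\
    0 < Re ((T.[q] - T.[z]) * conjc w).
Proof.
move=> sT w1 e0; have [k [V [k0 TE V0]]] := local_form_exists z sT.
have [d d1 hd] := direction_exists k0 V0 w1.
have v0 : 0 < normc V.[z] by rewrite normc_gt0.
have [r r0 hr] := poly_continuous V z v0.
have [s [s0 se sr]] := exists_pos_lt2 e0 r0.
exists (z + s%:C * d).
have hq : z + s%:C * d - z = s%:C * d by ring.
have nq : normc (z + s%:C * d - z) = s by rewrite hq normcM normcR gtr0_norm // d1 mulr1.
split; first by rewrite nq.
rewrite TE !hornerD !hornerC !hornerM !horner_exp !hornerXsubC hq subrr.
rewrite expr0n -[k == 0%N]negbK -lt0n k0 mul0r addr0 addrAC subrr add0r.
set q := _ + _.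
have E : (s%:C * d) ^+ k * V.[q] * conjc w =
   (s ^+ k)%:C * ((normc V.[z])%:C * (w * conjc w) + d ^+ k * (V.[q] - V.[z]) * conjc w).
  by rewrite mulrA -hd exprMn rmorphXn; ring.
have ww : w * conjc w = 1.
  by rewrite -sqr_normc normc_def -sqr_normc_ReIm sqrtr_sqr ger0_norm ?normc_ge0 // w1 expr1n.
rewrite E ww mulr1 mulrC ReMr pmulr_lgt0 ?exprn_gt0 // ReD /=.
have := normc_Re (d ^+ k * (V.[q] - V.[z]) * conjc w).
rewrite !normcM normcX d1 expr1n mul1r normc_conj w1 mulr1 => h1.
have h2 : normc (V.[q] - V.[z]) < normc V.[z] by apply: hr; rewrite nq.
by have := le_lt_trans h1 h2; rewrite ltr_norml => /andP[]; lra.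
Qed.

End LocalOpen.

(** * Curves on which T takes values in [-1,1] do not close up *)

Section Winding.
Variable R : realType.
Local Notation C := R[i].
Implicit Types (s t x y : R) (z p q : C).

Lemma ReV z : Re z^-1 = Re z / (Re z ^+ 2 + Im z ^+ 2).
Proof. by case: z. Qed.
Lemma ImV z : Im z^-1 = - Im z / (Re z ^+ 2 + Im z ^+ 2).
Proof. by case: z => x y /=; rewrite mulNr. Qed.

Lemma cder_inv (f : R -> C) t l : f t != 0 -> cder f t l ->
  cder (fun s => (f s)^-1) t (- l / f t ^+ 2).
Proof.
move=> f0 [f1 f2].
pose N s := Re (f s) ^+ 2 + Im (f s) ^+ 2.
have N0 : N t != 0 by rewrite /N -sqr_normc_ReIm sqrf_eq0 normc_eq0.
have dN : is_derive t (1 : R) N (2 * (Re (f t) * Re l + Im (f t) * Im l)).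
  have := is_deriveD (is_derive_exp 2 f1) (is_derive_exp 2 f2).
  by move=> h; apply: is_derive_eq h _; rewrite /= !expr1; ring.
have dV := is_deriveV N0 dN.
have NE : N t = Re (f t) ^+ 2 + Im (f t) ^+ 2 by [].
split.
- have -> : (fun s => Re (f s)^-1) = (fun s => Re (f s)) * (fun s => (N s)^-1).
    by apply/funext => s; rewrite ReV.
  apply: is_derive_eq (is_deriveM f1 dV) _; rewrite /GRing.scale /=.
  move: N0; rewrite NE; case: (f t) => x y; case: (l) => p q /= n0.
  have m0 : (x * x - y * y) ^+ 2 + (x * y + y * x) ^+ 2 != 0.
    have -> : (x * x - y * y) ^+ 2 + (x * y + y * x) ^+ 2 = (x ^+ 2 + y ^+ 2) ^+ 2 by ring.
    by rewrite expf_neq0.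
  by field; rewrite n0 m0.
- have -> : (fun s => Im (f s)^-1) = (fun s => - Im (f s)) * (fun s => (N s)^-1).
    by apply/funext => s; rewrite ImV.
  have f2N : is_derive t (1 : R) (fun s => - Im (f s)) (- Im l) := is_deriveN f2.
  apply: is_derive_eq (is_deriveM f2N dV) _; rewrite /GRing.scale /=.
  move: N0; rewrite NE; case: (f t) => x y; case: (l) => p q /= n0.
  have m0 : (x * x - y * y) ^+ 2 + (x * y + y * x) ^+ 2 != 0.
    have -> : (x * x - y * y) ^+ 2 + (x * y + y * x) ^+ 2 = (x ^+ 2 + y ^+ 2) ^+ 2 by ring.
    by rewrite expf_neq0.
  by field; rewrite n0 m0.
Qed.

Variables (a b : R) (g u : R -> C).
Hypothesis ab : a < b.
Hypothesis gu : forall t, a <= t <= b -> cder g t (u t).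
Hypothesis gab : g a = g b.

Let ab' : a <= b. Proof. exact: ltW. Qed.
Let aI : a <= a <= b. Proof. by rewrite lexx ltW. Qed.

Let gc : curve_on a b g.
Proof. by move=> t /gu h; exists (u t). Qed.

Definition off p := forall t, a <= t <= b -> g t != p.

(** The total variation w of the argument of g - p along the loop, as the
    increment of a primitive of its derivative Im (u / (g - p)). *)
Definition wind p (w : R) := exists2 F : R -> R,
  forall t, a <= t <= b -> is_derive t (1 : R) F (Im (u t / (g t - p))) &
  w = F b - F a.

Lemma derive_eq_diff (F G f : R -> R) :
  (forall t, a <= t <= b -> is_derive t (1 : R) F (f t)) ->
  (forall t, a <= t <= b -> is_derive t (1 : R) G (f t)) ->
  F b - F a = G b - G a.
Proof.
move=> hF hG.
have D t : a <= t <= b -> is_derive t (1 : R) (fun s => F s - G s) 0.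
  move=> ht; have := is_deriveB (hF t ht) (hG t ht); by rewrite subrr.
have h1 := derive_lower (dF := fun=> 0) (m := 0) ab' D (fun _ _ => lexx _).
have h2 := derive_upper (dF := fun=> 0) (m := 0) ab' D (fun _ _ => lexx _).
lra.
Qed.

Lemma wind_unique p w w' : wind p w -> wind p w' -> w = w'.
Proof. by move=> [F hF ->] [G hG ->]; exact: derive_eq_diff hF hG. Qed.

Lemma wind_shift p q w : off p -> off q -> wind p w ->
  (forall t, a <= t <= b -> 0 < Re ((g t - q) / (g t - p))) -> wind q w.
Proof.
move=> op oq [F hF ->] hpos.
pose f t := (g t - q) / (g t - p).
pose A t := atan (Im (f t) / Re (f t)).
exists (fun t => F t + A t).
  move=> t ht.
  have p0 : g t - p != 0 by rewrite subr_eq0 op.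
  have q0 : g t - q != 0 by rewrite subr_eq0 oq.
  have cq := cder_sub (gu ht) (cder_cst q t).
  have cp := cder_inv p0 (cder_sub (gu ht) (cder_cst p t)).
  have := is_deriveD (hF t ht) (arg_derive (cder_mul cq cp) (hpos t ht)).
  move=> h; apply: is_derive_eq h _.
  by rewrite -ImD; congr (Im _); rewrite !subr0; field; rewrite p0 q0.
have -> : A b = A a by rewrite /A /f gab.
by rewrite opprD addrACA subrr addr0.
Qed.

Lemma wind_far p : off p -> p != 0 ->
  (forall t, a <= t <= b -> 0 < Re ((g t - p) / - p)) -> wind p 0.
Proof.
move=> op p0 hpos.
pose f t := (g t - p) / - p.
exists (fun t => atan (Im (f t) / Re (f t))).
  move=> t ht.
  have q0 : g t - p != 0 by rewrite subr_eq0 op.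
  have cq := cder_sub (gu ht) (cder_cst p t).
  have := arg_derive (cder_mul cq (cder_cst (- p)^-1 t)) (hpos t ht).
  move=> h; apply: is_derive_eq h _; congr (Im _).
  by rewrite subr0 mulr0 addr0; field; rewrite p0 q0.
by rewrite /f gab subrr.
Qed.

Lemma Re_gt0_near1 z : normc (z - 1) < 1 -> 0 < Re z.
Proof.
move=> h; have := le_lt_trans (normc_Re _) h; rewrite ReB /= ltr_norml.
by move=> /andP[]; lra.
Qed.

Lemma wind_loc_const p : off p -> exists2 d, 0 < d &
  forall q, normc (q - p) < d -> off q /\ (forall w, wind p w -> wind q w).
Proof.
move=> op; have [c c0 hc] := curve_far gc op.
exists c => // q hq.
have oq : off q.
  move=> t ht; apply/eqP => E; have := hc t ht; rewrite E; lra.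
split => // w hw; apply: (wind_shift op oq hw) => t ht; apply: Re_gt0_near1.
have p0 : g t - p != 0 by rewrite subr_eq0 op.
have -> : (g t - q) / (g t - p) - 1 = (p - q) / (g t - p) by field.
rewrite normcM normcV ltr_pdivrMr ?normc_gt0 // mul1r normcB.
by apply: lt_le_trans hq _; exact: hc.
Qed.

Lemma curve_bounded : exists M : R, 0 < M /\ forall t, a <= t <= b -> normc (g t) < M.
Proof.
have ct : cont_on a b (fun t => - normc (g t)).
  move=> t ht e e0; have [d d0 hd] := curve_dist_cont 0 gc ht e0.
  exists d => // s hs sd; have := hd s hs sd; rewrite !subr0.
  by rewrite -opprD normrN.
have [c hc hm] := EVT_min_on ab' ct.
exists (normc (g c) + 1); split; first by have := normc_ge0 (g c); lra.
by move=> t ht; have := hm t ht; lra.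
Qed.

Lemma wind_large : exists M : R, 0 < M /\ forall p, M <= normc p -> off p /\ wind p 0.
Proof.
have [M [M0 hM]] := curve_bounded; exists M; split => // p hp.
have op : off p.
  by move=> t ht; apply/eqP => E; have := hM t ht; rewrite E; lra.
have p0 : p != 0 by rewrite -normc_gt0; lra.
split => //; apply: wind_far => // t ht; apply: Re_gt0_near1.
have -> : (g t - p) / - p - 1 = g t / - p by field.
rewrite normcM normcV normcN ltr_pdivrMr ?normc_gt0 // mul1r.
by apply: lt_le_trans hp; exact: hM.
Qed.

Definition in_E (T : {poly C}) z : Prop := Im T.[z] = 0 /\ -1 <= Re T.[z] <= 1.

Lemma notE_open (T : {poly C}) p : ~ in_E T p ->
  exists2 d, 0 < d & forall q, normc (q - p) < d -> ~ in_E T q.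
Proof.
move=> np.
have [e e0 he] : exists2 e : R, 0 < e & forall w : C, normc (w - T.[p]) < e ->
    ~ (Im w = 0 /\ -1 <= Re w <= 1).
  have [i0|i0] := eqVneq (Im T.[p]) 0; last first.
    exists `|Im T.[p]|; first by rewrite normr_gt0.
    move=> w hw [w0 _]; have := le_lt_trans (normc_Im _) hw.
    by rewrite ImB w0 sub0r normrN ltxx.
  have [h1|h1] := ltP (Re T.[p]) (-1).
    exists (-1 - Re T.[p]); first lra.
    move=> w hw [_ /andP[w1 w2]]; have := le_lt_trans (normc_Re _) hw.
    by rewrite ReB ltr_norml => /andP[]; lra.
  have [h2|h2] := ltP 1 (Re T.[p]).
    exists (Re T.[p] - 1); first lra.
    move=> w hw [_ /andP[w1 w2]]; have := le_lt_trans (normc_Re _) hw.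
    by rewrite ReB ltr_norml => /andP[]; lra.
  by exfalso; apply: np; split => //; rewrite h1.
have [d d0 hd] := poly_continuous T p e0.
by exists d => // q /hd /he.
Qed.

(** The maximum principle.  The set K of the points of E and of the points
    around which the loop turns is closed by local constancy, and within the
    range of the loop it is compact.  If it contained a point off E, then |Im T|
    would have a positive maximum on K by openness; it would be attained off
    E, hence at an interior point of K, against openness. *)
Lemma wind_off_E (T : {poly C}) : (1 < size T)%N ->
  (forall t, a <= t <= b -> in_E T (g t)) ->
  (forall p, off p -> exists w, wind p w) ->
  forall p, ~ in_E T p -> wind p 0.
Proof.
move=> sT gE windE p0 Gp0.
have Goff p : ~ in_E T p -> off p by move=> np t ht; apply/eqP => h; apply: np; rewrite -h; exact: gE.
have [w0 hw0] := windE _ (Goff _ Gp0).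
have [w00|w0n] := eqVneq w0 0; first by rewrite -w00.
exfalso.
have loc p w : ~ in_E T p -> wind p w -> exists2 d, 0 < d &
    forall q, normc (q - p) < d -> ~ in_E T q /\ wind q w.
  move=> np hw; have [d1 d10 h1] := notE_open np.
  have [d2 d20 h2] := wind_loc_const (Goff _ np).
  exists (Num.min d1 d2); first by rewrite lt_min d10.
  move=> q; rewrite lt_min => /andP[q1 q2]; split; first exact: h1.
  by have [_ H] := h2 q q2; exact: H.
have [M [M0 hM]] := wind_large.
pose good p := ~ in_E T p /\ wind p 0.
have bad_w p w : wind p w -> w != 0 -> ~ good p.
  by move=> hw wn [_ h0]; rewrite (wind_unique hw h0) eqxx in wn.
pose D : set (R * R) := [set v | good (v.1 +i* v.2)].
pose B : set (R * R) := `[- M, M]%classic `*` `[- M, M]%classic.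
have openD : open D.
  rewrite openE => -[x y] [gn gw]; have [d d0 hd] := loc _ _ gn gw.
  apply/nbhs_ballP; exists (d / 2); first by rewrite /= divr_gt0.
  move=> [x' y'] [/= hx hy]; apply: hd.
  apply: le_lt_trans (normc_le_ReIm _) _; rewrite /= distrC (distrC y').
  by rewrite [ltRHS]splitr; exact: ltrD.
have cK : compact (B `&` ~` D).
  apply: (@subclosed_compact _ _ B).
  - apply: closedI; last exact: open_closedC.
    by apply: compact_closed; [exact: norm_hausdorff | apply: compact_setX; exact: segment_compact].
  - by apply: compact_setX; exact: segment_compact.
  - by move=> v [].
pose f (v : R * R) := `|Im T.[v.1 +i* v.2]|.
have cf : continuous f.
  move=> [x y]; apply/cvgrPdist_lt => e e0.
  have [d d0 hd] := poly_continuous T (x +i* y) e0.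
  have d2 : 0 < d / 2 by rewrite divr_gt0.
  apply: filterS (nbhsx_ballx (x, y) _ d2) => -[x' y'] [/= hx hy].
  have h : normc ((x' +i* y') - (x +i* y)) < d.
    apply: le_lt_trans (normc_le_ReIm _) _; rewrite /= distrC (distrC y').
    by rewrite [ltRHS]splitr; exact: ltrD.
  apply: le_lt_trans (ler_dist_dist _ _) _.
  rewrite /= -ImB; apply: le_lt_trans (normc_Im _) _.
  by rewrite normcB; exact: hd.
have inK p w : wind p w -> w != 0 -> (B `&` ~` D) (Re p, Im p).
  move=> hw wn; have pM : normc p < M.
    rewrite ltNge; apply/negP => /hM[_ h0].
    by rewrite (wind_unique hw h0) eqxx in wn.
  have hR := le_lt_trans (normc_Re p) pM; have hI := le_lt_trans (normc_Im p) pM.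
  move: hR hI; rewrite !ltr_norml => /andP[r1 r2] /andP[i1 i2].
  split; first by split; rewrite /= in_itv /= !ltW.
  by rewrite /D /=; case: (p) hw => x y hw; exact: bad_w hw wn.
have fE p : f (Re p, Im p) = `|Im T.[p]| by rewrite /f /=; case: p.
have Kn0 : (B `&` ~` D) !=set0 by exists (Re p0, Im p0); exact: inK hw0 w0n.
have [[x y] hc hmax] := compact_EVT_max Kn0 cK (continuous_subspaceT cf).
have {}hmax p w : wind p w -> w != 0 -> `|Im T.[p]| <= f (x, y).
  by move=> hw wn; rewrite -fE; apply: hmax; rewrite inE; exact: inK hw wn.
have ni : normc ('i%C : C) = 1 by rewrite /= expr0n expr1n add0r sqrtr1.
have ImE (w : C) : Re (w * conjc 'i%C) = Im w.
  by case: w => ? ?; rewrite /=; ring.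
(* the maximum is positive *)
have fpos : 0 < f (x, y).
  have [d d0 hd] := loc _ _ Gp0 hw0.
  have [q [qd hq]] := poly_open p0 sT ni d0.
  have [_ wq] := hd q qd.
  have m0 := hmax _ _ hw0 w0n; have m1 := hmax _ _ wq w0n.
  move: hq; rewrite ImE ImB => hq.
  apply: lt_le_trans (_ : Num.max `|Im T.[p0]| `|Im T.[q]| <= _).
    rewrite lt_max !normr_gt0; case: eqVneq hq => //= ->.
    by rewrite subr0 => h; rewrite gt_eqF.
  by rewrite ge_max m0 m1.
have nE : ~ in_E T (x +i* y).
  by move=> [h _]; move: fpos; rewrite /f /= h normr0 ltxx.
have [w hw] := windE _ (Goff _ nE).
have wn : w != 0.
  apply/eqP => w0'; move: hc; rewrite inE => -[_]; apply.
  by split => //=; rewrite -w0'.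
have [d d0 hd] := loc _ _ nE hw.
have [i0|i0] := leP 0 (Im T.[x +i* y]).
- have [q [qd hq]] := poly_open (x +i* y) sT ni d0.
  have [_ wq] := hd q qd; have := hmax _ _ wq wn.
  move: hq; rewrite ImE ImB /f /= (ger0_norm i0) => hq h.
  by have := ler_norm (Im T.[q]); lra.
- have ni' : normc (- 'i%C : C) = 1 by rewrite normcN.
  have [q [qd hq]] := poly_open (x +i* y) sT ni' d0.
  have [_ wq] := hd q qd; have := hmax _ _ wq wn.
  move: hq; rewrite conjcN mulrN ReN ImE ImB /f /= (ltr0_norm i0) => hq h.
  by have := ler_norm (- Im T.[q]); rewrite normrN; lra.
Qed.

End Winding.

Section NoLoop.
Variable R : realType.
Local Notation C := R[i].
Implicit Types (s t x y : R) (z p q : C).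

Lemma Re_quot_lower (w D : C) (N : R) : 0 < N ->
  normc (w - 1) <= 20^-1 -> normc (D - N%:C) <= 3 / 20 * N ->
  (2 * N)^-1 <= Re (w / D).
Proof.
move=> N0 hw hD.
have NC : N%:C != 0 :> C by rewrite -normc_gt0 normcR gtr0_norm.
have D1 : 17 / 20 * N <= normc D.
  have := normc_ge_sub N%:C (N%:C - D); rewrite (normcB N%:C D).
  have -> : N%:C - (N%:C - D) = D by ring.
  by rewrite normcR gtr0_norm //; lra.
have D0 : 0 < normc D by apply: lt_le_trans D1; rewrite mulr_gt0 //; lra.
have Dn : D != 0 by rewrite -normc_gt0.
have E : w / D - (N^-1)%:C = ((w - 1) * N%:C - (D - N%:C)) / (D * N%:C).
  by rewrite fmorphV; field; rewrite Dn NC.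
have H : normc (w / D - (N^-1)%:C) <= (2 * N)^-1.
  rewrite E normcM normcV normcM normcR gtr0_norm //.
  rewrite ler_pdivrMr ?mulr_gt0 //.
  have -> : (2 * N)^-1 * (normc D * N) = normc D / 2 by field; rewrite gt_eqF.
  apply: le_trans (normcD _ _) _; rewrite normcN normcM normcR gtr0_norm //.
  have : normc (w - 1) * N <= 20^-1 * N by rewrite ler_wpM2r // ltW.
  lra.
have := le_trans (normc_Re _) H; rewrite ReB /= ler_norml => /andP[h _].
have N2 : N^-1 = (2 * N)^-1 + (2 * N)^-1 by field; rewrite gt_eqF.
move: h; rewrite N2; lra.
Qed.

Lemma seg_sub (a b x y s : R) : a <= x -> y <= b -> x <= s <= y -> a <= s <= b.
Proof. by move=> ax yb /andP[xs sy]; rewrite (le_trans ax xs) (le_trans sy yb). Qed.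

Lemma cder_mvt2 (f f' : R -> C) (t0 t : R) (l : C) (k : R) :
  (forall s, `|s - t0| <= `|t - t0| -> cder f s (f' s) /\ normc (f' s - l) <= k) ->
  normc (f t - f t0 - l * (t - t0)%:C) <= 2 * k * `|t - t0|.
Proof.
move=> H; have [ht0|ht0] := leP t0 t.
- have hs s : t0 <= s <= t -> `|s - t0| <= `|t - t0|.
    by move=> /andP[s1 s2]; rewrite !ger0_norm ?subr_ge0 // lerD2r.
  rewrite ger0_norm ?subr_ge0 //.
  by apply: (cder_mvt (f' := f')) => // s /hs /H [].
- have hs s : t <= s <= t0 -> `|s - t0| <= `|t - t0|.
    move=> /andP[s1 s2]; rewrite !ler0_norm ?subr_le0 // ?(ltW ht0) //.
    by rewrite lerN2 lerD2r.
  have -> : f t - f t0 - l * (t - t0)%:C = - (f t0 - f t - l * (t0 - t)%:C).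
    by rewrite !rmorphB /=; ring.
  rewrite normcN ler0_norm ?opprB ?subr_le0 ?(ltW ht0) //.
  by apply: (cder_mvt (f' := f')) => //; [exact: ltW | move=> s /hs /H []..].
Qed.

Lemma jump_near (v w : C) (h e : R) : 0 < e -> normc (v - h%:C) <= 20^-1 * `|h| ->
  normc (w - 1) <= 20^-1 ->
  e / (h ^+ 2 + e ^+ 2) <= 2 * e * Re (w / (v ^+ 2 + (e ^+ 2)%:C)).
Proof.
move=> e_gt0 v2 w1; set N := h ^+ 2 + e ^+ 2.
have N0 : 0 < N by rewrite /N ltr_wpDl ?sqr_ge0 ?exprn_gt0.
have D1 : normc (v ^+ 2 + (e ^+ 2)%:C - N%:C) <= 3 / 20 * N.
  have -> : v ^+ 2 + (e ^+ 2)%:C - N%:C = (v - h%:C) * (v + h%:C).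
    by rewrite /N rmorphD /= !rmorphXn /=; ring.
  have v3 : normc (v + h%:C) <= 3 * `|h|.
    have -> : v + h%:C = (v - h%:C) + (2 * h)%:C by rewrite rmorphM /= rmorph_nat; ring.
    apply: le_trans (normcD _ _) _; rewrite normcR normrM ger0_norm //.
    by have := normr_ge0 h; lra.
  rewrite normcM.
  apply: le_trans (_ : (20^-1 * `|h|) * (3 * `|h|) <= _).
    by apply: ler_pM => //; exact: normc_ge0.
  have -> : 20^-1 * `|h| * (3 * `|h|) = 3 / 20 * `|h| ^+ 2 by ring.
  by rewrite ler_wpM2l ?divr_ge0 // real_normK ?num_real // /N lerDl sqr_ge0.
have H := Re_quot_lower N0 w1 D1.
have -> : e / N = 2 * e * (2 * N)^-1 by field; rewrite gt_eqF.
by rewrite ler_wpM2l // mulr_ge0 // ltW.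
Qed.

Lemma jump_far (v w : C) (c e : R) : 0 < e -> 0 < c -> e < c / 2 ->
  c <= normc v -> normc w = 1 ->
  - (3 * e / c ^+ 2) <= 2 * e * Re (w / (v ^+ 2 + (e ^+ 2)%:C)).
Proof.
move=> e_gt0 c0 ec nv nw.
have D1 : 3 / 4 * c ^+ 2 <= normc (v ^+ 2 + (e ^+ 2)%:C).
  have := normc_ge_sub (v ^+ 2) (- (e ^+ 2)%:C); rewrite opprK normcN normcX normcR.
  rewrite ger0_norm ?sqr_ge0 //.
  have : c ^+ 2 <= normc v ^+ 2 by rewrite ler_sqr ?nnegrE ?(ltW c0) ?normc_ge0.
  have : e ^+ 2 <= (c / 2) ^+ 2.
    by rewrite ler_sqr ?nnegrE ?(ltW e_gt0) ?(ltW ec) // divr_ge0 // ltW.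
  rewrite exprMn exprVn; lra.
have cc0 : 0 < c ^+ 2 by rewrite exprn_gt0.
have D0 : 0 < normc (v ^+ 2 + (e ^+ 2)%:C) by apply: lt_le_trans D1; lra.
have : `|Re (w / (v ^+ 2 + (e ^+ 2)%:C))| <= 4 / 3 / c ^+ 2.
  apply: le_trans (normc_Re _) _.
  rewrite normcM normcV nw mul1r.
  rewrite -[4 / 3]invf_div -invfM lef_pV2 ?posrE //; last by lra.
rewrite ler_norml => /andP[h _].
have -> : 3 * e / c ^+ 2 = 2 * e * (3 / 2 / c ^+ 2) by field; rewrite gt_eqF.
rewrite -mulrN ler_wpM2l //; first by rewrite mulr_ge0 // ltW.
apply: le_trans h; rewrite lerN2 ler_wpM2r ?invr_ge0 ?sqr_ge0 //; lra.
Qed.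

(** A function whose increments outside a small interval lose less than the
    increment 1 gained inside it cannot return to its initial value. *)
Lemma jump_sum (G dG : R -> R) (a b t0 del e K : R) :
  a <= t0 - del -> t0 + del <= b -> 0 < e -> e < del -> 0 <= K -> K * (b - a) < 1 ->
  (forall t, a <= t <= b -> is_derive t (1 : R) G (dG t)) ->
  (forall t, a <= t <= b -> del <= `|t - t0| -> - K <= dG t) ->
  (forall t, `|t - t0| <= del -> e / ((t - t0) ^+ 2 + e ^+ 2) <= dG t) ->
  0 < G b - G a.
Proof.
move=> h1 h2 e0 ed K0 K1 hG hfar hnear.
have ee : 0 < e ^+ 2 by rewrite exprn_gt0.
have hge t : `|t - t0| <= del -> 0 <= dG t.
  move=> ht; apply: le_trans (hnear t ht).
  by rewrite divr_ge0 ?addr_ge0 ?sqr_ge0 // ltW.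
have P1 : - K * (t0 - del - a) <= G (t0 - del) - G a.
  apply: (derive_lower (dF := dG)) => // t ht.
    by apply: hG; apply: seg_sub ht => //; lra.
  apply: hfar; first by apply: seg_sub ht => //; lra.
  by case/andP: ht => _ ht; rewrite ler0_norm; lra.
have P2 : 0 * (t0 - e - (t0 - del)) <= G (t0 - e) - G (t0 - del).
  apply: (derive_lower (dF := dG)) => [|t ht|t /andP[t1 t2]]; first by lra.
    by apply: hG; apply: seg_sub ht => //; lra.
  by apply: hge; rewrite ler0_norm; lra.
have P3 : (2 * e)^-1 * (t0 + e - (t0 - e)) <= G (t0 + e) - G (t0 - e).
  apply: (derive_lower (dF := dG)) => [|t ht|t /andP[t1 t2]]; first by lra.
    by apply: hG; apply: seg_sub ht => //; lra.
  have hh : `|t - t0| <= e by rewrite ler_norml; apply/andP; split; lra.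
  apply: le_trans (hnear t (le_trans hh (ltW ed))).
  have sq : (t - t0) ^+ 2 <= e ^+ 2.
    by rewrite -real_normK ?num_real // ler_sqr ?nnegrE ?(ltW e0).
  have -> : (2 * e)^-1 = e / (2 * e ^+ 2) by field; rewrite gt_eqF.
  rewrite ler_wpM2l ?(ltW e0) // lef_pV2 ?posrE ?mulr_gt0 //; first by lra.
  by rewrite ltr_wpDl ?sqr_ge0.
have P4 : 0 * (t0 + del - (t0 + e)) <= G (t0 + del) - G (t0 + e).
  apply: (derive_lower (dF := dG)) => [|t ht|t /andP[t1 t2]]; first by lra.
    by apply: hG; apply: seg_sub ht => //; lra.
  by apply: hge; rewrite ger0_norm; lra.
have P5 : - K * (b - (t0 + del)) <= G b - G (t0 + del).
  apply: (derive_lower (dF := dG)) => // t ht.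
    by apply: hG; apply: seg_sub ht => //; lra.
  apply: hfar; first by apply: seg_sub ht => //; lra.
  by case/andP: ht => ht _; rewrite ger0_norm; lra.
have E3 : (2 * e)^-1 * (t0 + e - (t0 - e)) = 1 by field; rewrite gt_eqF.
have K2 : 0 <= K * del by rewrite mulr_ge0 // ltW // (lt_trans e0).
move: P1 P2 P3 P4 P5; rewrite E3 !mul0r; clear hG hfar hnear hge; lra.
Qed.

(** The winding number jumps by a full turn when a point crosses the loop at
    a simple point; that it changes at all is enough.  The integrand of the
    difference of the two winding numbers is close to 2 e / (h^2 + e^2) near
    the crossing and of order e elsewhere. *)
Lemma wind_jump (a b : R) (g u : R -> C) (t0 : R) :
  (forall t, a <= t <= b -> cder g t (u t)) -> g a = g b ->
  (forall t, a <= t <= b -> normc (u t) = 1) -> a < t0 -> t0 < b ->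
  (forall e, 0 < e -> exists2 d, 0 < d & forall s, a <= s <= b -> `|s - t0| < d ->
     normc (u s - u t0) < e) ->
  (forall t, a <= t <= b -> t != t0 -> g t != g t0) ->
  exists2 e0, 0 < e0 & forall e, 0 < e < e0 ->
    let p := g t0 + e%:C * 'i%C * u t0 in let q := g t0 - e%:C * 'i%C * u t0 in
    off a b g p -> off a b g q -> wind a b g u p 0 -> wind a b g u q 0 -> False.
Proof.
move=> gu gab u1 at0 t0b uc ginj.
have t0I : a <= t0 <= b by rewrite !ltW.
have d1 := u1 t0 t0I; set d := u t0 in d1 *.
have dn : d != 0 by rewrite -normc_gt0 d1.
have k40 : (0 : R) < 40^-1 by rewrite invr_gt0.
have [r r0 hr] := uc _ k40.
have [del [del0 delr dela delb]] : exists del, [/\ 0 < del, del < r, del <= t0 - a & del <= b - t0].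
  have r2 : 0 < r / 2 by lra.
  have h1 : 0 < t0 - a by lra.
  have h2 : 0 < b - t0 by lra.
  have [x [x0 x1 x2 x3]] := minr_gt0_le3 r2 h1 h2.
  by exists x; split => //; move: x0 x1 r0; clear; lra.
have gcv : curve_on a b g by move=> t /gu h; exists (u t).
have [c c0 hc] := curve_far_except gcv del0 ginj.
have q1 : 0 < c ^+ 2 / (3 * (b - a) + 1) by rewrite divr_gt0 ?exprn_gt0 //; move: at0 t0b; clear; lra.
have c2 : 0 < c / 2 by rewrite divr_gt0.
have [e0 [e00 e01 e02 e03]] := minr_gt0_le3 del0 c2 q1.
exists e0 => // e /andP[e_gt0 ee0] p q op oq [Fp hFp Fp0] [Fq hFq Fq0].
have ed : e < del := lt_le_trans ee0 e01.
have ec : e < c / 2 := lt_le_trans ee0 e02.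
have eq1 : e * (3 * (b - a) + 1) < c ^+ 2.
  by rewrite -ltr_pdivlMr ?(lt_le_trans ee0) //; move: at0 t0b; clear; lra.
pose G t := Fp t - Fq t.
pose dG t := 2 * e * Re ((u t / d) / (((g t - g t0) / d) ^+ 2 + (e ^+ 2)%:C)).
have i2 : 'i%C ^+ 2 = -1 :> C by exact: sqr_i.
have prodE t : a <= t <= b -> (g t - p) * (g t - q) =
    d ^+ 2 * (((g t - g t0) / d) ^+ 2 + (e ^+ 2)%:C).
  move=> ht; rewrite /p /q rmorphXn /=.
  have -> : (g t - (g t0 + e%:C * 'i%C * d)) * (g t - (g t0 - e%:C * 'i%C * d)) =
     (g t - g t0) ^+ 2 - e%:C ^+ 2 * 'i%C ^+ 2 * d ^+ 2 by ring.
  by rewrite i2; field.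
have hG t : a <= t <= b -> is_derive t (1 : R) G (dG t).
  move=> ht; have := is_deriveB (hFp t ht) (hFq t ht).
  move=> h; apply: is_derive_eq h _; rewrite -ImB /dG.
  have p0 : g t - p != 0 by rewrite subr_eq0 op.
  have q0 : g t - q != 0 by rewrite subr_eq0 oq.
  have D0 : ((g t - g t0) / d) ^+ 2 + (e ^+ 2)%:C != 0.
    have : (g t - p) * (g t - q) != 0 by rewrite mulf_neq0.
    by rewrite prodE // mulf_eq0 negb_or => /andP[].
  have -> : u t / (g t - p) - u t / (g t - q) = u t * (p - q) / ((g t - p) * (g t - q)).
    by field; rewrite p0 q0.
  rewrite prodE // /p /q.
  set D := _ + (e ^+ 2)%:C in D0 *.
  have -> : u t * (g t0 + e%:C * 'i%C * d - (g t0 - e%:C * 'i%C * d)) / (d ^+ 2 * D) =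
     u t / d / D * (2 * e)%:C * 'i%C.
    by rewrite rmorphM /= rmorph_nat; field; rewrite dn D0.
  by rewrite ImM /= mulr1 mulr0 addr0 ReMr mulrC.
have G0 : G b - G a = 0 by rewrite /G; move: Fp0 Fq0; clear; lra.
have K0 : 0 <= 3 * e / c ^+ 2 by rewrite divr_ge0 ?sqr_ge0 // mulr_ge0 // ltW.
have K1 : 3 * e / c ^+ 2 * (b - a) < 1.
  rewrite mulrAC ltr_pdivrMr ?exprn_gt0 // mul1r.
  by apply: le_lt_trans eq1; move: e_gt0; clear; lra.
have A1 : a <= t0 - del by move: dela; clear; lra.
have A2 : t0 + del <= b by move: delb; clear; lra.
have near_I t : `|t - t0| <= del -> a <= t <= b.
  rewrite ler_norml => /andP[h1 h2]; apply: (seg_sub A1 A2).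
  by move: h1 h2; clear; rewrite -lerBlDl -lerBrDl => h1 h2; apply/andP; split; lra.
suff : 0 < G b - G a by rewrite G0 ltxx.
apply: (jump_sum A1 A2 e_gt0 ed K0 K1 hG) => [t ht hd|t hd].
- apply: jump_far => //.
    by rewrite normcM normcV d1 invr1 mulr1; exact: hc.
  by rewrite normcM normcV d1 invr1 mulr1 u1.
- have uclose s : `|s - t0| <= del -> normc (u s - d) <= 40^-1.
    by move=> hs; apply/ltW/hr; [exact: near_I | exact: le_lt_trans delr].
  apply: jump_near => //.
    have -> : (g t - g t0) / d - (t - t0)%:C = (g t - g t0 - d * (t - t0)%:C) / d.
      by field.
    rewrite normcM normcV d1 invr1 mulr1.
    have -> : 20^-1 = 2 * 40^-1 :> R by lra.
    apply: (cder_mvt2 (f' := u)) => s hs.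
    by split; [apply/gu/near_I | apply: uclose]; exact: le_trans hs hd.
  have -> : u t / d - 1 = (u t - d) / d by field.
  rewrite normcM normcV d1 invr1 mulr1.
  by apply: le_trans (uclose t hd) _; lra.
Qed.

End NoLoop.

Section NiceInjective.
Variable R : realType.
Local Notation C := R[i].
Implicit Types (s t x y : R) (z p q d : C) (g u : R -> C).

Lemma wind_exists (a b : R) g u p : a <= b ->
  (forall t, a <= t <= b -> cder g t (u t)) ->
  (forall t, a <= t <= b -> exists r (u' : R -> C) (l : C),
     [/\ 0 < r, cder u' 0 l & forall s, `|s| < r -> u (t + s) = u' s]) ->
  off a b g p -> exists w, wind a b g u p w.
Proof.
move=> ab gu uc op.
have [|F hF] := @antiderivative R a b (fun t => Im (u t / (g t - p))) ab; last first.
  by exists (F b - F a), F.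
move=> t ht e e0; have [r [u' [l [r0 hl hu]]]] := uc t ht.
have g0 : g (t + 0) - p != 0 by rewrite addr0 subr_eq0 op.
have cg : cder (fun s => g (t + s)) 0 (u t) by apply: cder_shift; rewrite addr0; exact: gu.
have cq := cder_mul hl (cder_inv g0 (cder_sub cg (cder_cst p 0))).
have [d d0 hd] := cder_cont cq e0.
exists (Num.min d r); first by rewrite lt_min d0.
move=> s hs; rewrite lt_min => /andP[sd sr].
have := hd (s - t); rewrite subr0 => /(_ sd).
rewrite /= -!hu ?normr0 // (addrC t (s - t)) subrK addr0 => h.
by apply: le_lt_trans h; rewrite -ImB normc_Im.
Qed.

Variable T : {poly C}.
Hypothesis sT : (1 < size T)%N.

Definition nice_on g a b := forall t, a <= t <= b -> exists d, nice_at T g t d.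

Lemma nice_on_sub g a b a' b' : a <= a' -> b' <= b -> nice_on g a b -> nice_on g a' b'.
Proof. by move=> h1 h2 H t ht; apply: H; exact: seg_sub ht. Qed.

Lemma nice_on_dir g a b t : nice_on g a b -> a <= t <= b ->
  nice_at T g t (curve_derive g t).
Proof. by move=> H ht; have [d hd] := H t ht; rewrite (nice_dir hd). Qed.

Lemma nice_on_curve g a b : nice_on g a b -> curve_on a b g.
Proof. by move=> H t /H[d /nice_cder h]; exists d. Qed.

Lemma nice_velocity g t d : nice_at T g t d ->
  exists r (u' : R -> C) (l : C), [/\ 0 < r, cder u' 0 l, u' 0 = d &
    forall s, `|s| < r -> curve_derive g (t + s) = u' s].
Proof.
move=> /nice_local[r [u [r0 u0 d1 H]]].
have r00 : `|0 : R| < r by rewrite normr0.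
have [_ _ [l hl] _ _] := H 0 r00.
exists r, u, l; split => // s sr; have [c1 _ _ _ _] := H s sr.
exact: cder_curve_derive.
Qed.

(** A C^1 curve with nonzero velocity is locally injective. *)
Lemma nice_loc_inj g t d : nice_at T g t d ->
  exists2 e, 0 < e & forall x y, `|x - t| < e -> `|y - t| < e -> g x = g y -> x = y.
Proof.
move=> ng; have d1 := nice_norm1 ng.
have [r [u [r0 u0 _ H]]] := nice_local ng.
have r00 : `|0 : R| < r by rewrite normr0.
have [_ _ [l hl] _ _] := H 0 r00.
have h4 : (0 : R) < 4^-1 by [].
have [e e0 he] := cder_cont hl h4.
exists (Num.min e r); first by rewrite lt_min e0.
move=> x y; wlog xy : x y / x <= y => [hw|].
  by move=> hx hy gxy; case: (leP x y) => h; [|apply/esym]; apply: hw => //; exact: ltW.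
rewrite !lt_min => /andP[xe xr] /andP[ye yr] gxy.
have inr (rr : R) s : `|x - t| < rr -> `|y - t| < rr -> x <= s <= y -> `|s - t| < rr.
  rewrite !ltr_norml => /andP[x1 x2] /andP[y1 y2] /andP[s1 s2].
  by apply/andP; split; move: x1 x2 y1 y2 s1 s2; clear; lra.
have := @cder_mvt R g (fun s => u (s - t)) x y d 4^-1 xy.
rewrite gxy subrr sub0r normcN normcM d1 mul1r normcR ger0_norm ?subr_ge0 // => M.
have {}M : y - x <= 2 * 4^-1 * (y - x).
  apply: M => s hs.
    have [c1 _ _ _ _] := H _ (inr r s xr yr hs).
    by rewrite (addrC t) subrK in c1.
  have := he (s - t); rewrite subr0 u0 => /(_ (inr e s xe ye hs)) h; exact: ltW.
by apply/eqP; rewrite eq_le xy /=; move: M; clear; lra.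
Qed.

(** A simple loop is met near a noncritical parameter by points off E on both
    of its sides; their winding numbers differ by [wind_jump], yet both vanish
    by [wind_off_E]. *)
Lemma nice_loop_absurd g a b : a < b -> nice_on g a b ->
  (forall t, a <= t <= b -> in_E T (g t)) -> g a = g b ->
  (forall x y, a <= x < b -> a <= y < b -> g x = g y -> x = y) -> False.
Proof.
move=> ab ng gE gab ginj.
have aI : a <= a <= b by rewrite lexx ltW.
pose u := curve_derive g.
have gu t : a <= t <= b -> cder g t (u t).
  by move=> ht; exact: nice_cder (nice_on_dir ng ht).
have u1 t : a <= t <= b -> normc (u t) = 1.
  by move=> ht; exact: nice_norm1 (nice_on_dir ng ht).
have uloc t : a <= t <= b -> exists r (u' : R -> C) (l : C),
     [/\ 0 < r, cder u' 0 l & forall s, `|s| < r -> u (t + s) = u' s].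
  move=> ht; have [r [u' [l [r0 hl _ H]]]] := nice_velocity (nice_on_dir ng ht).
  by exists r, u', l.
(* a noncritical parameter, just after a *)
have [r [u' [r0 _ _ Ha]]] := nice_local (nice_on_dir ng aI).
have [t0 [at0 t0b T't0]] : exists t0, [/\ a < t0, t0 < b & T^`().[g t0] != 0].
  have l0 : 0 < b - a by rewrite subr_gt0.
  have [m [m0 mr mb]] := exists_pos_lt2 r0 l0.
  exists (a + m); split; [by rewrite ltrDl|by rewrite -ltrBrDl|].
  have sr : `|m| < r by rewrite gtr0_norm.
  by have [_ _ _ _ h] := Ha _ sr; apply: h; rewrite gt_eqF.
have t0I : a <= t0 <= b by rewrite !ltW.
have simple t : a <= t <= b -> t != t0 -> g t != g t0.
  move=> /andP[h1 h2] tn; apply/eqP => E; move: tn.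
  move: h2; rewrite le_eqVlt => /orP[/eqP tb|tb].
    have : a = t0 by apply: ginj; rewrite ?lexx ?(ltW at0) // gab -tb.
    by move=> h; move: at0; rewrite h ltxx.
  by rewrite (ginj t t0) ?eqxx ?h1 ?(ltW at0).
have ucont : forall e, 0 < e -> exists2 d, 0 < d & forall s, a <= s <= b ->
    `|s - t0| < d -> normc (u s - u t0) < e.
  move=> e e0; have [r1 [u2 [l [r10 hl H]]]] := uloc t0 t0I.
  have [d d0 hd] := cder_cont hl e0.
  exists (Num.min d r1); first by rewrite lt_min d0.
  move=> s _; rewrite lt_min => /andP[sd sr].
  have := hd (s - t0); rewrite subr0 => /(_ sd).
  by rewrite -!H ?normr0 // addr0 (addrC t0) subrK.
have [e0 e00 jump] := wind_jump gu gab u1 at0 t0b ucont simple.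
(* points close to the crossing, on either side, are off E *)
pose z := g t0; pose d := u t0.
have [r2 [u3 [r20 u30 _ H0]]] := nice_local (nice_on_dir ng t0I).
have mI : Im (T^`().[z] * d) = 0.
  apply: (@Im_real_const R (fun s => T.[g (t0 + s)]) T.[z] _ r2 r20 _ 0) => //.
  - by move=> s sr; have [_ _ _ h _] := H0 s sr.
  - by rewrite normr0.
  - have cg : cder (fun s => g (t0 + s)) 0 d.
      by apply: cder_shift; rewrite addr0; exact: gu.
    by have := cder_horner T cg; rewrite addr0.
have dn : d != 0 by rewrite -normc_gt0 u1.
pose m := Re (T^`().[z] * d).
have mE : T^`().[z] * d = m%:C by exact: Im0_real.
have m0 : m != 0.
  apply/eqP => h; move: mE; rewrite h => /eqP.
  by rewrite mulf_eq0 (negPf T't0) (negPf dn).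
have [K K0 hK] := poly_taylor1 T (normc z + 1).
have q0 : 0 < `|m| / (K + 1) by rewrite divr_gt0 ?normr_gt0 // ltr_wpDl.
have [e1 [e10 e1a e1b e1c]] := minr_gt0_le3 e00 ltr01 q0.
pose e := e1 / 2.
have ep : 0 < e by rewrite divr_gt0.
have ee1 : e < e1 by rewrite /e; move: e10; clear; lra.
have Ke : K * e ^+ 2 < e * `|m|.
  have : e * (K + 1) < `|m| by rewrite -ltr_pdivlMr ?ltr_wpDl // (lt_le_trans ee1).
  move=> h; rewrite expr2 mulrCA ltr_pM2l //; apply: le_lt_trans h.
  by rewrite mulrDr mulr1 mulrC lerDl ltW.
have notE (sg : R) : `|sg| = 1 -> ~ in_E T (z + (sg * e)%:C * 'i%C * d).
  move=> sg1 [hI _]; set p := z + _ in hI.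
  have np : normc (p - z) = e.
    rewrite /p addrC addKr !normcM u1 // normcR normrM sg1 (gtr0_norm ep) mul1r mulr1.
    by rewrite /= expr0n expr1n add0r sqrtr1 mulr1.
  have pB : normc p <= normc z + 1.
    have := normcD (p - z) z; rewrite subrK np; move: ee1 e1b; clear; lra.
  have zB : normc z <= normc z + 1 by rewrite lerDl.
  have := hK p z pB zB; rewrite np.
  have -> : T^`().[z] * (p - z) = (m * (sg * e))%:C * 'i%C.
    have -> : (m * (sg * e))%:C = m%:C * (sg * e)%:C by rewrite rmorphM.
    by rewrite -mE /p; ring.
  move=> h; have := le_lt_trans (le_trans (normc_Im _) h) Ke.
  have [zI _] := gE t0 t0I.
  rewrite !ImB hI zI subrr sub0r normrN ImM /= mulr1 mulr0 addr0.
  by rewrite (normrM m) (normrM sg) sg1 (gtr0_norm ep) mul1r mulrC ltxx.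
have windE p : off a b g p -> exists w, wind a b g u p w.
  exact: wind_exists (ltW ab) gu uloc.
have W0 := wind_off_E ab gu gab sT gE windE.
have offE p : ~ in_E T p -> off a b g p.
  by move=> np t ht; apply/eqP => h; apply: np; rewrite -h; exact: gE.
have n1 : ~ in_E T (z + e%:C * 'i%C * d).
  by have := notE 1; rewrite mul1r; apply; rewrite normr1.
have n2 : ~ in_E T (z - e%:C * 'i%C * d).
  have := notE (-1); rewrite mulN1r rmorphN /= !mulNr; apply.
  by rewrite normrN1.
have eI : 0 < e < e0 by rewrite ep (lt_le_trans ee1).
exact: jump e eI (offE _ n1) (offE _ n2) (W0 _ n1) (W0 _ n2).
Qed.

(** Curves composed of germs inside E are injective: the first
    self-intersection would produce a simple loop. *)
Lemma nice_injective g a b : nice_on g a b ->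
  (forall t, a <= t <= b -> in_E T (g t)) ->
  forall x y, a <= x <= b -> a <= y <= b -> g x = g y -> x = y.
Proof.
move=> ng gE.
have [ab|ba] := ltP a b; last first.
  move=> x y /andP[x1 x2] /andP[y1 y2] _; apply: le_anti.
  by apply/andP; split; [move: x2 y1|move: x1 y2]; move: ba; clear; lra.
pose injto t := forall x y, a <= x <= t -> a <= y <= t -> g x = g y -> x = y.
pose A : set R := [set t | a <= t <= b /\ injto t].
have Aa : A a.
  split; first by rewrite lexx ltW.
  move=> x y /andP[x1 x2] /andP[y1 y2] _; apply: le_anti.
  by apply/andP; split; [move: x2 y1|move: x1 y2]; clear; lra.
have hs : has_sup A.
  by split; [exists a | exists b => t [/andP[_ h] _]].
pose t := sup A.
have ubt : ubound A t := sup_upper_bound hs.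
have at_ : a <= t by exact: ubt.
have tb : t <= b by apply: ge_sup; [exists a | move=> s [/andP[_ h] _]].
have tI : a <= t <= b by rewrite at_.
have below s : s < t -> exists2 s', s < s' & A s'.
  move=> st; have e0 : 0 < t - s by rewrite subr_gt0.
  have [s' As' h] := sup_adherent e0 hs.
  by exists s' => //; move: h; rewrite -/t; clear; lra.
have inj_lt x y : a <= x < t -> a <= y < t -> g x = g y -> x = y.
  move=> /andP[ax xt] /andP[ay yt] gxy.
  have [s' h As'] : exists2 s', Num.max x y < s' & A s' by apply: below; rewrite gt_max xt.
  move: h; rewrite gt_max => /andP[xs ys]; have [_ H] := As'.
  by apply: H => //; rewrite ?ax ?ay ltW.
(* no earlier point returns at time t *)
have noret x : a <= x < t -> g x != g t.
  move=> /andP[ax xt]; apply/eqP => gxt.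
  apply: (@nice_loop_absurd g x t xt) => //.
  - exact: nice_on_sub ng.
  - by move=> s hs'; apply: gE; exact: seg_sub hs'.
  - move=> s s' /andP[s1 s2] /andP[s3 s4]; apply: inj_lt.
      by rewrite (le_trans ax).
    by rewrite (le_trans ax).
have At : injto t.
  move=> x y /andP[ax xt] /andP[ay yt] gxy.
  move: xt yt; rewrite !le_eqVlt => /orP[/eqP xt|xt] /orP[/eqP yt|yt].
  - by rewrite xt yt.
  - by have := noret y; rewrite ay yt -gxy xt eqxx => /(_ isT).
  - by have := noret x; rewrite ax xt gxy yt eqxx => /(_ isT).
  - by apply: inj_lt => //; rewrite ?ax ?ay.
have [tb'|tb'] := eqVneq t b; first by rewrite -tb'.
exfalso.
have {tb'}tb' : t < b by rewrite lt_neqAle tb'.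
have [e e0 he] := nice_loc_inj (nice_on_dir ng tI).
have gc : curve_on a (t - e) g.
  move=> s /andP[s1 s2]; apply: (nice_on_curve ng); rewrite s1 (le_trans s2) //.
  by move: tb e0; clear; lra.
have [c c0 hc] : exists2 c, 0 < c & forall s, a <= s <= t - e -> c <= normc (g s - g t).
  apply: curve_far gc _ => s /andP[s1 s2]; apply: noret.
  by rewrite s1 (le_lt_trans s2) // gtrBl.
have [l hl] := nice_on_curve ng tI.
have [f f0 hf] := cder_cont hl c0.
have b0 : 0 < b - t by rewrite subr_gt0.
have [m [m0 me mf mb]] := minr_gt0_le3 e0 f0 b0.
have As : A (t + m / 2).
  split.
    by apply/andP; split; [move: at_ m0|move: m0 mb]; clear; lra.
  have key x y : a <= x <= t + m / 2 -> a <= y <= t + m / 2 -> x <= y -> g x = g y -> x = y.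
    move=> /andP[ax xt] /andP[ay yt] xy gxy.
    have [yt'|yt'] := leP y t; first by apply: At => //; rewrite ?ax ?ay // (le_trans xy).
    have ye : `|y - t| < m.
      by rewrite gtr0_norm ?subr_gt0 //; move: yt m0; clear; lra.
    have [xe|xe] := leP x (t - e).
      have := hc x; rewrite ax xe => /(_ isT); rewrite gxy leNgt => /negP[].
      by apply: hf; exact: lt_le_trans ye mf.
    apply: he => //; last exact: lt_le_trans ye me.
    rewrite ltr_norml; apply/andP; split; first by move: xe; clear; lra.
    by move: xt m0 me; clear; lra.
  move=> x y hx hy gxy; have [xy|xy] := leP x y; first exact: key.
  by apply/esym; apply: key => //; exact: ltW.
have := ubt _ As; rewrite -/t; move: m0; clear; lra.
Qed.

End NiceInjective.

(** * Merging arcs *)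

Section Merge.
Variable R : realType.
Local Notation C := R[i].
Implicit Types (s t x y a b : R) (z p q d : C) (g h : R -> C).
Variable T : {poly C}.
Hypothesis sT : (1 < size T)%N.

Definition arc g a b : Prop :=
  [/\ a < b, nice_on T g a b & forall t, a <= t <= b -> in_E T (g t)].

Definition img g a b : set C := [set z | exists2 t, a <= t <= b & g t = z].

Lemma arc_shift g a b c : arc g a b -> arc (fun s => g (c + s)) (a - c) (b - c).
Proof.
move=> [ab ng gE].
have I t : a - c <= t <= b - c -> a <= c + t <= b by rewrite lerBlDl lerBrDl.
split; first by rewrite ltrD2r.
  by move=> t /I /ng [d hd]; exists d; exact: nice_shift.
by move=> t /I /gE.
Qed.

Lemma img_shift g a b c : img (fun s => g (c + s)) (a - c) (b - c) = img g a b.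
Proof.
apply/seteqP; split => z [t ht <-].
  by exists (c + t) => //; move: ht; rewrite lerBlDl lerBrDl.
exists (t - c); last by rewrite addrC subrK.
by rewrite !lerD2r.
Qed.

Lemma arc_rev g a b : arc g a b -> arc (fun s => g (- s)) (- b) (- a).
Proof.
move=> [ab ng gE].
have I t : - b <= t <= - a -> a <= - t <= b by rewrite lerNl lerNr andbC.
split; first by rewrite ltrN2.
  by move=> t /I /ng [d /nice_rev]; rewrite opprK => hd; exists (- d).
by move=> t /I /gE.
Qed.

Lemma img_rev g a b : img (fun s => g (- s)) (- b) (- a) = img g a b.
Proof.
apply/seteqP; split => z [t ht <-].
  by exists (- t) => //; rewrite lerNl lerNr andbC.
by exists (- t); rewrite ?opprK // !lerN2 andbC.
Qed.

(** Arcs composed of germs have the unique continuation property: the germ at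
    a point is determined by the tangent direction. *)
Lemma nice_agree g h b d : 0 <= b -> nice_on T g 0 b -> nice_on T h 0 b ->
  g 0 = h 0 -> nice_at T g 0 d -> nice_at T h 0 d ->
  forall t, 0 <= t <= b -> g t = h t.
Proof.
move=> b0 ng nh gh0 ngd nhd.
pose eqto t := forall s, 0 <= s <= t -> g s = h s.
pose A : set R := [set t | 0 <= t <= b /\ eqto t].
have A0 : A 0.
  by split; [rewrite lexx | move=> s s0; rewrite -(le_anti s0)].
have hs : has_sup A by split; [exists 0 | exists b => t [/andP[_ k] _]].
pose t := sup A.
have ubt : ubound A t := sup_upper_bound hs.
have t0 : 0 <= t by exact: ubt.
have tb : t <= b by apply: ge_sup; [exists 0 | move=> s [/andP[_ k] _]].
have tI : 0 <= t <= b by rewrite t0.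
have lt_eq s : 0 <= s < t -> g s = h s.
  move=> /andP[s0 st]; have e0 : 0 < t - s by rewrite subr_gt0.
  have [s' [_ As'] k] := sup_adherent e0 hs.
  apply: As'; rewrite s0 /=; move: k; rewrite -/t; clear; lra.
have [dg hg] := ng t tI; have [dh hh] := nh t tI.
(* at time t both curves agree to first order *)
have [gt dE] : g t = h t /\ dg = dh.
  move: t0; rewrite le_eqVlt => /orP[/eqP t0|t0].
    move: hg hh; rewrite -t0 => hg hh; split => //.
    by rewrite -(nice_dir hg) -(nice_dir hh) (nice_dir ngd) (nice_dir nhd).
  have cf : cder (fun s => g s - h s) t (dg - dh).
    exact: cder_sub (nice_cder hg) (nice_cder hh).
  have z0 s : 0 <= s < t -> g s - h s = 0 by move=> /lt_eq ->; rewrite subrr.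
  have f0 : g t - h t = 0.
    apply/eqP; rewrite -normc_eq0 eq_le normc_ge0 andbT leNgt; apply/negP => k.
    have [e e0 he] := cder_cont cf k.
    have [m [m0 me mt]] := exists_pos_lt2 e0 t0.
    have := he (t - m); rewrite z0.
      rewrite sub0r normcN ltxx => F; suff : false by []; apply: F.
      by rewrite addrAC subrr add0r normrN gtr0_norm.
    by rewrite subr_ge0 ltW //= gtrBl.
  split; first by apply/eqP; rewrite -subr_eq0 f0.
  apply/eqP; rewrite -subr_eq0 -normc_eq0 eq_le normc_ge0 andbT leNgt; apply/negP => k.
  have k2 : 0 < normc (dg - dh) / 2 by rewrite divr_gt0.
  have [e e0 he] := cder_expand cf k2.
  have [m [m0 me mt]] := exists_pos_lt2 e0 t0.
  have := he (- m); rewrite normrN (gtr0_norm m0) z0; last first.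
    by rewrite subr_ge0 ltW //= gtrBl.
  rewrite f0 subrr sub0r rmorphN /= mulrN opprK normcM normcR gtr0_norm //.
  move=> /(_ me); rewrite ler_pM2r //; move: k; clear; lra.
rewrite -dE in hh.
have [e e0 he] := nice_same_germ hg hh gt.
have le_eq s : 0 <= s <= t -> g s = h s.
  move=> /andP[s0]; rewrite le_eqVlt => /orP[/eqP -> //|st].
  by apply: lt_eq; rewrite s0.
have [tb'|tb'] := eqVneq t b; first by rewrite -tb'.
exfalso.
have {tb'}tb' : 0 < b - t by rewrite subr_gt0 lt_neqAle tb'.
have [m [m0 me mb]] := exists_pos_lt2 e0 tb'.
have As : A (t + m).
  split; first by apply/andP; split; [move: t0 m0|move: mb]; clear; lra.
  move=> s /andP[s0 sm]; have [st|st] := leP s t; first by apply: le_eq; rewrite s0.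
  have := he (s - t); rewrite (addrC t) subrK; apply.
  by rewrite gtr0_norm ?subr_gt0 //; move: m0 me sm; clear; lra.
have := ubt _ As; rewrite -/t; move: m0; clear; lra.
Qed.

Lemma nice_agree2 g h a b d : a <= 0 -> 0 <= b -> nice_on T g a b -> nice_on T h a b ->
  g 0 = h 0 -> nice_at T g 0 d -> nice_at T h 0 d ->
  forall t, a <= t <= b -> g t = h t.
Proof.
move=> a0 b0 ng nh gh ngd nhd t /andP[ta tb].
have [t0|t0] := leP 0 t.
  have sub k : nice_on T k a b -> nice_on T k 0 b by apply: nice_on_sub.
  by apply: (nice_agree b0 (sub g ng) (sub h nh) gh ngd nhd); rewrite t0.
have rev k : nice_on T k a b -> nice_on T (fun s => k (- s)) 0 (- a).
  move=> nk s /andP[s0 sa].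
  have [|dk /nice_rev] := nk (- s); last by rewrite opprK => hk; exists (- dk).
  by rewrite lerNr sa /= (le_trans _ b0) // oppr_le0.
have na : 0 <= - a by rewrite oppr_ge0.
have rd k : nice_at T k 0 d -> nice_at T (fun s => k (- s)) 0 (- d).
  by move=> /nice_rev; rewrite oppr0.
have := @nice_agree (fun s => g (- s)) (fun s => h (- s)) (- a) (- d) na
   (rev g ng) (rev h nh) _ (rd g ngd) (rd h nhd) (- t).
rewrite !opprK oppr0; apply => //.
by rewrite oppr_ge0 (ltW t0) lerN2.
Qed.

Lemma nice_on_glue g h a b d : a <= 0 -> 0 <= b -> nice_on T g a 0 -> nice_on T h 0 b ->
  g 0 = h 0 -> nice_at T g 0 d -> nice_at T h 0 d ->
  nice_on T (fun t => if t <= 0 then g t else h t) a b.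
Proof.
move=> a0 b0 ng nh gh ngd nhd t /andP[ta tb].
have [t0|t0|t0] := ltgtP t 0.
- have [|dt ht] := ng t; first by rewrite ta ltW.
  exists dt; have e0 : 0 < - t by rewrite oppr_gt0.
  apply: (nice_eq_near e0 _ ht) => s; rewrite ltr_norml opprK => /andP[_ st].
  by rewrite ifT // -lerBrDl sub0r ltW.
- have [|dt ht] := nh t; first by rewrite tb ltW.
  exists dt; apply: (nice_eq_near t0 _ ht) => s; rewrite ltr_norml => /andP[st _].
  by rewrite ifF //; apply/negbTE; rewrite -ltNge -ltrBlDl sub0r.
- rewrite t0; exists d.
  have [e e0 he] := nice_same_germ ngd nhd gh.
  apply: (nice_eq_near e0 _ ngd) => s se; case: ifP => // _.
  exact: he.
Qed.

Lemma arc_merge0 g h a b a' b' d : arc g a b -> arc h a' b' ->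
  a <= 0 <= b -> a' <= 0 <= b' -> g 0 = h 0 ->
  nice_at T g 0 d -> nice_at T h 0 d ->
  exists k x y, arc k x y /\ img k x y = img g a b `|` img h a' b'.
Proof.
move=> [ab ng gE] [ab' nh hE] /andP[a0 b0] /andP[a0' b0'] gh ngd nhd.
pose l := if a <= a' then g else h.
pose r := if b <= b' then h else g.
pose x := Num.min a a'; pose y := Num.max b b'.
pose mx := Num.max a a'; pose mn := Num.min b b'.
have mx0 : mx <= 0 by rewrite ge_max a0.
have mn0 : 0 <= mn by rewrite le_min b0.
have agr t : mx <= t <= mn -> g t = h t.
  apply: (nice_agree2 mx0 mn0 _ _ gh ngd nhd).
    by apply: nice_on_sub ng; rewrite ?le_max ?ge_min lexx.
  by apply: nice_on_sub nh; rewrite ?le_max ?ge_min lexx orbT.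
have x0 : x <= 0 by rewrite ge_min a0.
have y0 : 0 <= y by rewrite le_max b0.
have xy : x < y.
  by rewrite /x gt_min; apply/orP; left; rewrite /y lt_max ab.
have nl : nice_on T l x 0.
  rewrite /l /x; case: (leP a a') => _; [exact: nice_on_sub ng|exact: nice_on_sub nh].
have nr : nice_on T r 0 y.
  rewrite /r /y; case: (leP b b') => _; [exact: nice_on_sub nh|exact: nice_on_sub ng].
have ld : nice_at T l 0 d by rewrite /l; case: ifP.
have rd : nice_at T r 0 d by rewrite /r; case: ifP.
have lr : l 0 = r 0 by rewrite /l /r; case: ifP; case: ifP.
exists (fun t => if t <= 0 then l t else r t), x, y.
have lE t : x <= t <= 0 -> img g a b (l t) \/ img h a' b' (l t).
  rewrite /l /x; case: (leP a a') => _ /andP[h1 h2]; [left|right]; exists t => //.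
    by rewrite h1 (le_trans h2).
  by rewrite h1 (le_trans h2).
have rE t : 0 <= t <= y -> img g a b (r t) \/ img h a' b' (r t).
  rewrite /r /y; case: (leP b b') => _ /andP[h1 h2]; [right|left]; exists t => //.
    by rewrite h2 (le_trans _ h1).
  by rewrite h2 (le_trans _ h1).
have imE z : img g a b z \/ img h a' b' z -> in_E T z.
  by move=> [[t ht <-]|[t ht <-]]; [exact: gE|exact: hE].
split; first split => //.
- exact: nice_on_glue ld rd.
- move=> t /andP[t1 t2]; case: (leP t 0) => t0; apply: imE.
    by apply: lE; rewrite t1.
  by apply: rE; rewrite t2 ltW.
apply/seteqP; split => z.
  move=> [t /andP[t1 t2] <-]; case: (leP t 0) => t0.
    by apply: lE; rewrite t1.
  by apply: rE; rewrite t2 ltW.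
move=> [[t /andP[t1 t2] <-]|[t /andP[t1 t2] <-]]; exists t.
- by rewrite /x /y ge_min t1 le_max t2.
- case: (leP t 0) => t0.
    rewrite /l; case: (leP a a') => // aa; apply/esym/agr.
    rewrite /mx /mn (max_idPl (ltW aa)) t1 /= le_min t2 (le_trans t0) //.
  rewrite /r; case: (leP b b') => // bb; apply/esym/agr.
  by rewrite /mx /mn (min_idPl bb) t2 andbT ge_max t1 (le_trans a0' (ltW t0)).
- by rewrite /x /y ge_min t1 orbT le_max t2 orbT.
- case: (leP t 0) => t0.
    rewrite /l; case: (leP a a') => // aa; apply/agr.
    by rewrite /mx /mn (max_idPr aa) t1 /= le_min t2 andbT (le_trans t0).
  rewrite /r; case: (leP b b') => // bb; apply/agr.
  by rewrite /mx /mn (min_idPr (ltW bb)) t2 andbT ge_max t1 andbT (le_trans a0 (ltW t0)).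
Qed.

(** Followed from the common point in either sense, the two arcs agree as long
    as both last, by [nice_agree]; hence their union is a curve composed of
    germs, and it is again simple by [nice_injective]. *)
Lemma arc_merge g h a b a' b' t t' d d' : arc g a b -> arc h a' b' ->
  a <= t <= b -> a' <= t' <= b' -> g t = h t' ->
  nice_at T g t d -> nice_at T h t' d' -> (d = d' \/ d = - d') ->
  exists k x y, arc k x y /\ img k x y = img g a b `|` img h a' b'.
Proof.
move=> Ag Ah tI tI' gh ngd nhd dd.
have ng0 : nice_at T (fun s => g (t + s)) 0 d by apply: nice_shift; rewrite addr0.
have nh0 : nice_at T (fun s => h (t' + s)) 0 d' by apply: nice_shift; rewrite addr0.
have I0 (x y s : R) : x <= s <= y -> x - s <= 0 <= y - s by rewrite subr_le0 subr_ge0.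
have E0 : g (t + 0) = h (t' + 0) by rewrite !addr0.
rewrite -(img_shift g a b t) -(img_shift h a' b' t').
case: dd => dd.
  rewrite -dd in nh0.
  exact: arc_merge0 (arc_shift t Ag) (arc_shift t' Ah) (I0 _ _ _ tI) (I0 _ _ _ tI') E0 ng0 nh0.
rewrite -(img_rev (fun s => h (t' + s))).
have nh1 : nice_at T (fun s => h (t' + - s)) 0 d.
  by have := nice_rev nh0; rewrite oppr0 dd.
apply: arc_merge0 (arc_shift t Ag) (arc_rev (arc_shift t' Ah)) (I0 _ _ _ tI) _ _ ng0 nh1.
  by have := I0 _ _ _ tI'; rewrite oppr_le0 oppr_ge0 andbC.
by rewrite oppr0.
Qed.

Lemma arc_injective g a b : arc g a b -> forall x y, a <= x <= b -> a <= y <= b ->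
  g x = g y -> x = y.
Proof. by move=> [ab ng gE]; exact: (nice_injective sT ng gE). Qed.

End Merge.

(** * Tangent directions at a common point *)

Section Directions.
Variable R : realType.
Local Notation C := R[i].
Implicit Types (s t a b : R) (z v w d : C) (g h u : R -> C).

Definition dirn v : C := v / (normc v)%:C.

Lemma normc_dirn v : v != 0 -> normc (dirn v) = 1.
Proof.
by move=> v0; rewrite normcM normcV normcR ger0_norm ?normc_ge0 // mulfV // normc_eq0.
Qed.

Lemma dirn_unit v : normc v = 1 -> dirn v = v.
Proof. by move=> v1; rewrite /dirn v1 divr1. Qed.

Lemma dirsep_unit g h v w : cder g 0 v -> cder h 0 w -> g 0 = h 0 ->
  normc v = 1 -> normc w = 1 ->
  (forall e : R, 0 < e -> exists s s', [/\ 0 < s < e, 0 < s' < e & g s = h s']) ->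
  v = w.
Proof.
move=> cg ch gh v1 w1 H; apply/eqP; rewrite -subr_eq0 -normc_eq0 eq_le normc_ge0 andbT.
rewrite leNgt; apply/negP => k0; set m := normc (v - w) in k0.
have k5 : 0 < m / 5 by rewrite divr_gt0.
have [e1 e10 h1] := cder_expand cg k5.
have [e2 e20 h2] := cder_expand ch k5.
have m0 : 0 < Num.min e1 e2 by rewrite lt_min e10.
have [s [s' [/andP[s0 se] /andP[s0' se'] E]]] := H _ m0.
move: se se'; rewrite !lt_min => /andP[a1 _] /andP[_ a2].
have := h1 s; rewrite add0r gtr0_norm // => /(_ a1) b1.
have := h2 s'; rewrite add0r gtr0_norm // => /(_ a2) b2.
(* s v and s' w are both close to the common displacement x *)
rewrite -gh -E in b2; set x := g s - g 0 in b1 b2.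
have nv : normc (v * s%:C) = s by rewrite normcM v1 mul1r normcR gtr0_norm.
have nw : normc (w * s'%:C) = s' by rewrite normcM w1 mul1r normcR gtr0_norm.
have D : normc (v * s%:C - w * s'%:C) <= m / 5 * s + m / 5 * s'.
  apply: le_trans (normcBD _ x _) _; rewrite normcB; exact: lerD.
have S1 := normc_ge_sub (v * s%:C) (w * s'%:C).
have S2 := normc_ge_sub (w * s'%:C) (v * s%:C).
rewrite normcB in S2; rewrite nv nw in S1 S2.
have M1 : m * s <= normc (v * s%:C - w * s'%:C) + normc (w * s'%:C - w * s%:C).
  have -> : m * s = normc (v * s%:C - w * s%:C).
    by rewrite -mulrBl normcM normcR gtr0_norm.
  exact: normcBD.
have M2 : m * s' <= normc (v * s'%:C - v * s%:C) + normc (v * s%:C - w * s'%:C).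
  have -> : m * s' = normc (v * s'%:C - w * s'%:C).
    by rewrite -mulrBl normcM normcR gtr0_norm.
  exact: normcBD.
have N1 : normc (w * s'%:C - w * s%:C) <= normc (v * s%:C - w * s'%:C).
  rewrite -mulrBr -rmorphB /= normcM w1 mul1r normcR ler_norml.
  by apply/andP; split; move: S1 S2; clear; lra.
have N2 : normc (v * s'%:C - v * s%:C) <= normc (v * s%:C - w * s'%:C).
  rewrite -mulrBr -rmorphB /= normcM v1 mul1r normcR ler_norml.
  by apply/andP; split; move: S1 S2; clear; lra.
have p1 : 0 < m * s by rewrite mulr_gt0.
have p2 : 0 < m * s' by rewrite mulr_gt0.
move: D M1 M2 N1 N2 p1 p2; clear; move: (normc _) (normc _) (normc _) => x y z'.
have -> : m / 5 * s = (m * s) / 5 by ring.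
have -> : m / 5 * s' = (m * s') / 5 by ring.
by move: (m * s) (m * s') => p q; lra.
Qed.

(** The displacements of the two curves at a common nearby point are,
    up to small errors, positive multiples of both v and w. *)
Lemma dirsep g h v w : cder g 0 v -> cder h 0 w -> g 0 = h 0 -> v != 0 -> w != 0 ->
  (forall e : R, 0 < e -> exists s s', [/\ 0 < s < e, 0 < s' < e & g s = h s']) ->
  dirn v = dirn w.
Proof.
move=> cg ch gh v0 w0 H.
have resc (f : R -> C) l : l != 0 -> cder f 0 l ->
    cder (fun s => f ((normc l)^-1 * s)) 0 (dirn l).
  move=> l0 cf.
  have cf' : cder f (0 + (normc l)^-1 * 0) l by rewrite mulr0 addr0.
  have := cder_comp_affine cf'; rewrite fmorphV /= mulrC.
  by congr (cder _ _ _); apply/funext => s; rewrite add0r.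
apply: (dirsep_unit (resc g v v0 cg) (resc h w w0 ch)); rewrite ?mulr0 ?normc_dirn //.
have nv : 0 < normc v by rewrite normc_gt0.
have nw : 0 < normc w by rewrite normc_gt0.
move=> e e0.
have p1 : 0 < e / normc v by rewrite divr_gt0.
have p2 : 0 < e / normc w by rewrite divr_gt0.
have m0 : 0 < Num.min (e / normc v) (e / normc w) by rewrite lt_min p1.
have [s [s' [/andP[s0 se] /andP[s0' se'] E]]] := H _ m0.
move: se se'; rewrite !lt_min => /andP[a1 _] /andP[_ a2].
exists (normc v * s), (normc w * s'); split.
- by rewrite mulr_gt0 //= mulrC -ltr_pdivlMr.
- by rewrite mulr_gt0 //= mulrC -ltr_pdivlMr.
- by rewrite !mulKf ?normc_eq0.
Qed.

(** If a curve leaving z in direction d runs infinitely often into a simple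
    regular arc, then the arc passes through z along the line of d; it
    continues in direction d, forwards or backwards in its parameter. *)
Lemma curve_hits_arc (f g u : R -> C) z d a b : cder f 0 d -> f 0 = z -> d != 0 ->
  (forall t, a <= t <= b -> cder g t (u t)) ->
  (forall t, a <= t <= b -> u t != 0) ->
  (forall x y, a <= x <= b -> a <= y <= b -> g x = g y -> x = y) ->
  (forall e, 0 < e -> exists2 s, 0 < s < e & exists2 t, a <= t <= b & g t = f s) ->
  exists t, [/\ a <= t <= b, g t = z &
    (t < b /\ dirn d = dirn (u t)) \/ (a < t /\ dirn d = - dirn (u t))].
Proof.
move=> cf f0 d0 gu u0 ginj H.
have gc : curve_on a b g by move=> t /gu h; exists (u t).
have [t [tI gt]] : exists t, a <= t <= b /\ g t = z.
  apply: contrapT => nt.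
  have [c c0 hc] : exists2 c, 0 < c & forall t, a <= t <= b -> c <= normc (g t - z).
    apply: curve_far gc _ => t tI; apply/eqP => gt; apply: nt; by exists t.
  have [e e0 he] := cder_cont cf c0.
  have [s /andP[s0 se] [t tI gt]] := H e e0.
  have := he s; rewrite subr0 gtr0_norm // f0 -gt => /(_ se).
  by rewrite ltNge hc.
have gne t' : a <= t' <= b -> t' != t -> g t' != z.
  by move=> tI' tn; rewrite -gt; apply/eqP => /(ginj _ _ tI' tI) h; rewrite h eqxx in tn.
(* f avoids z right after 0 *)
have [r r0 hr] : exists2 r, 0 < r & forall s, 0 < s < r -> f s != z.
  have n0 : 0 < normc d / 2 by rewrite divr_gt0 // normc_gt0.
  have [r r0 hr] := cder_expand cf n0; exists r => // s /andP[s0 sr].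
  apply/eqP => fz; have := hr s; rewrite gtr0_norm // => /(_ sr).
  rewrite add0r fz f0 subrr sub0r normcN normcM normcR gtr0_norm // ler_pM2r //.
  by have : 0 < normc d by [rewrite normc_gt0]; clear; lra.
have near e : 0 < e -> exists s t', [/\ 0 < s < e, a <= t' <= b, `|t' - t| < e, t' != t & g t' = f s].
  move=> e0; have [c c0 hc] := curve_far_except gc e0 gne.
  have [e' e0' he'] := cder_cont cf c0.
  have [m [m0 m1 m2 m3]] := minr_gt0_le3 e0 e0' r0.
  have [s /andP[s0 sm] [t' tI' gt']] := H m m0.
  exists s, t'; split => //.
  - by rewrite s0 (lt_le_trans sm).
  - rewrite ltNge; apply/negP => /(hc _ tI').
    have := he' s; rewrite subr0 gtr0_norm // (lt_le_trans sm m2) f0 gt' => /(_ isT).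
    by move=> k1 k2; have := lt_le_trans k1 k2; rewrite ltxx.
  - apply/eqP => tt; have := hr s; rewrite s0 (lt_le_trans sm m3) -gt' tt gt eqxx.
    by move=> /(_ isT).
exists t; split => //.
have [right|nright] := pselect (forall e, 0 < e -> exists s t',
    [/\ 0 < s < e, a <= t' <= b, `|t' - t| < e, t < t' & g t' = f s]).
- left; split.
    by have [s [t' [_ /andP[_ tb] _ tt _]]] := right 1 ltr01; exact: lt_le_trans tb.
  have cg : cder (fun s => g (t + s)) 0 (u t) by apply: cder_shift; rewrite addr0; exact: gu.
  apply: dirsep cf cg _ d0 (u0 t tI) _; first by rewrite addr0 f0.
  move=> e /right[s [t' [hs _ he tt E]]]; exists s, (t' - t); split => //.
    by move: he; rewrite gtr0_norm subr_gt0 tt // => ->.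
  by rewrite addrC subrK.
right.
have [e1 [e10 he1]] : exists e1, 0 < e1 /\ forall s t', 0 < s < e1 -> a <= t' <= b ->
    `|t' - t| < e1 -> g t' = f s -> ~ t < t'.
  apply: contrapT => nh; apply: nright => e e0; apply: contrapT => nh2; apply: nh.
  exists e; split => // s t' hs tI' he E tt; apply: nh2; by exists s, t'.
have left e : 0 < e -> exists s t',
    [/\ 0 < s < e, a <= t' <= b, `|t' - t| < e, t' < t & g t' = f s].
  move=> e0; have m0 : 0 < Num.min e e1 by rewrite lt_min e0.
  have [s [t' [/andP[s0 sm] tI' he tn E]]] := near _ m0.
  move: sm he; rewrite !lt_min => /andP[q1 q2] /andP[q3 q4].
  exists s, t'; split => //; first by rewrite s0.
  rewrite lt_neqAle tn leNgt; apply/negP; apply: (he1 s) => //.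
  by rewrite s0.
split.
  by have [s [t' [_ /andP[ta _] _ tt _]]] := left 1 ltr01; exact: le_lt_trans tt.
have cg : cder (fun s => g (t - s)) 0 (- u t).
  have cg' : cder (fun s => g (t + s)) (- 0) (u t).
    by apply: cder_shift; rewrite oppr0 addr0; exact: gu.
  exact: (cder_rev cg').
have -> : - dirn (u t) = dirn (- u t) by rewrite /dirn normcN mulNr.
apply: dirsep cf cg _ d0 _ _; rewrite ?oppr_eq0 ?u0 //; first by rewrite subr0 f0.
move=> e /left[s [t' [hs _ he tt E]]]; exists s, (t - t'); split => //.
  by move: he; rewrite distrC gtr0_norm subr_gt0 tt // => ->.
by rewrite opprB addrC subrK.
Qed.

End Directions.

(** * Covering E by finitely many arcs *)

Section Roots.
Variable R : realType.
Local Notation C := R[i].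

Lemma roots_of_Xn_sub (k : nat) (q : C) : (0 < k)%N -> q != 0 ->
  exists rs : seq C, [/\ uniq rs, size rs = k & forall r, r \in rs -> r ^+ k = q].
Proof.
move=> k0 q0; pose p : {poly C} := 'X^k - q%:P.
have sp : size p = k.+1 by rewrite /p size_XnsubC.
have lp : lead_coef p = 1 by rewrite lead_coefXnsubC.
have [rs prs] := closed_field_poly_normal p.
rewrite lp scale1r in prs.
exists rs; split.
- rewrite -separable_prod_XsubC -prs separable_poly.unlock.
  apply/Bezout_coprimepP; exists (- k%:R%:P, 'X) => /=.
  have -> : - k%:R%:P * p + 'X * p^`() = (k%:R * q)%:P.
    rewrite /p derivB derivXn derivC subr0 mulrnAr -exprS prednK //.
    by rewrite polyCM polyC_natr -mulr_natl; ring.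
  by rewrite polyC_eqp1 mulf_neq0 // pnatr_eq0 -lt0n.
- by move: sp; rewrite prs size_prod_XsubC => -[].
- move=> r rrs; have : root p r by rewrite prs root_prod_XsubC.
  by rewrite /root /p !hornerE subr_eq0 => /eqP.
Qed.

Lemma direction_list (c w : C) (k : nat) : (0 < k)%N -> c != 0 -> normc w = 1 ->
  exists ds : seq C, [/\ uniq ds, size ds = k &
    forall d, d \in ds -> normc d = 1 /\ c * d ^+ k = (normc c)%:C * w].
Proof.
move=> k0 c0 w1; pose q := (normc c)%:C * w / c.
have q1 : normc q = 1.
  by rewrite !normcM normcV normcR ger0_norm ?normc_ge0 // w1 mulr1 mulfV // normc_eq0.
have q0 : q != 0 by rewrite -normc_gt0 q1.
have [ds [u s h]] := roots_of_Xn_sub k0 q0; exists ds; split => // d /h E.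
split; last by rewrite E /q mulrC divfK.
by apply/eqP; rewrite -(@pexpr_eq1 _ _ k) ?normc_ge0 // -normcX E q1.
Qed.

Lemma direction_bound (c w : C) (k : nat) (ds : seq C) : (0 < k)%N -> c != 0 ->
  uniq ds -> (forall d, d \in ds -> c * d ^+ k = w) -> (size ds <= k)%N.
Proof.
move=> k0 c0 uds h; pose p : {poly C} := 'X^k - (w / c)%:P.
have sp : size p = k.+1 by rewrite /p size_XnsubC.
have p0 : p != 0 by rewrite -size_poly_eq0 sp.
rewrite -ltnS -sp; apply: max_poly_roots => //.
apply/allP => d /h E; rewrite /root /p !hornerE subr_eq0.
by rewrite -E mulrAC mulfV // mul1r.
Qed.

Lemma local_form_mup (T : {poly C}) z k V : local_form T z k V ->
  mup z (T - T.[z]%:P) = k.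
Proof.
move=> [k0 TE V0].
have E : T - T.[z]%:P = ('X - z%:P) ^+ k * V.
  by apply: (@addrI _ T.[z]%:P); rewrite addrC subrK.
by rewrite E mupMl ?mup_XsubCX ?eqxx.
Qed.

Lemma mup_prod_XsubC (rs : seq C) z :
  mup z (\prod_(x <- rs) ('X - x%:P)) = count_mem z rs.
Proof.
elim: rs => [|x rs IH].
  by rewrite big_nil mupNroot // root1.
have n0 : \prod_(j <- rs) ('X - j%:P) != 0 by rewrite monic_neq0 // monic_prod_XsubC.
by rewrite big_cons mupM ?polyXsubC_eq0 // IH -[_ - _]expr1 mup_XsubCX /= eq_sym; case: eqP.
Qed.

(** All pairs of a root z of T - x and a unit direction along which the
    leading term of T - x at z is a nonnegative multiple of w.  Counted with
    multiplicity the roots are n, and each contributes as many directions as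
    its multiplicity. *)
Lemma root_direction_list (T : {poly C}) (n : nat) (x w : C) : size T = n.+1 -> (0 < n)%N ->
  normc w = 1 ->
  exists L : seq (C * C), [/\ uniq L, size L = n,
    forall p, p \in L -> T.[p.1] = x /\ exists k V, [/\ local_form T p.1 k V,
        normc p.2 = 1 & V.[p.1] * p.2 ^+ k = (normc V.[p.1])%:C * w] &
    forall z, T.[z] = x -> exists d, (z, d) \in L].
Proof.
move=> sT n0 w1.
have sT1 : (1 < size T)%N by rewrite sT ltnS.
pose p := T - x%:P.
have sp : size p = n.+1.
  by rewrite /p size_polyDl // sT size_polyN (leq_ltn_trans (size_polyC_leq1 _)).
have p0 : p != 0 by rewrite -size_poly_eq0 sp.
have [rs prs] := closed_field_poly_normal p.
have lp : lead_coef p != 0 by rewrite lead_coef_eq0.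
have srs : size rs = n.
  by move: sp; rewrite prs size_scale // size_prod_XsubC => -[].
have rsE z : (z \in rs) = (T.[z] == x).
  rewrite -root_prod_XsubC -(rootZ _ _ lp) -prs /root /p !hornerE.
  by rewrite subr_eq0.
have ds_ex z : exists ds : seq C, z \in rs ->
    [/\ uniq ds, size ds = count_mem z rs & forall d, d \in ds ->
      exists k V, [/\ local_form T z k V, normc d = 1 &
        V.[z] * d ^+ k = (normc V.[z])%:C * w]].
  have [zrs|] := boolP (z \in rs); last by exists [::].
  have Tz : T.[z] = x by apply/eqP; rewrite -rsE.
  have [k [V lf]] := local_form_exists z sT1; have [k0 _ V0] := lf.
  have [ds [u s h]] := direction_list k0 V0 w1.
  exists ds => _; split => //.
    rewrite s -(local_form_mup lf) Tz -/p prs -mul_polyC mupMr ?mup_prod_XsubC //.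
    by rewrite rootC.
  by move=> d /h[d1 dE]; exists k, V.
have [ds dsP] := choice ds_ex.
pose L := [seq (z, d) | z <- undup rs, d <- ds z].
have memL z d : ((z, d) \in L) = (z \in rs) && (d \in ds z).
  apply/allpairsPdep/andP => [[z' [d' [h1 h2 [-> ->]]]]|[h1 h2]].
    by rewrite -mem_undup.
  by exists z, d; rewrite mem_undup.
exists L; split.
- apply: allpairs_uniq_dep; first exact: undup_uniq.
    by move=> z; rewrite mem_undup => /dsP[].
  by move=> [z d] [z' d'] _ _ /= [-> ->].
- rewrite size_allpairs_dep -srs -[RHS](perm_size (perm_count_undup rs)).
  rewrite size_flatten /shape -map_comp; congr sumn.
  apply/eq_in_map => z; rewrite mem_undup => /dsP[_ -> _] /=.
  by rewrite size_nseq.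
- move=> [z d]; rewrite memL => /andP[zrs dd] /=; split.
    by apply/eqP; rewrite -rsE.
  by have [_ _] := dsP z zrs; exact.
- move=> z Tz; have zrs : z \in rs by rewrite rsE Tz.
  have [_ s _] := dsP z zrs.
  have : (0 < size (ds z))%N by rewrite s -has_count has_pred1.
  case E : (ds z) => [|d l] // _; exists d; rewrite memL zrs E inE eqxx //.
Qed.

End Roots.

Section Coverage.
Variable R : realType.
Local Notation C := R[i].
Variables (T : {poly C}) (n : nat).
Hypothesis sT : size T = n.+1.
Hypothesis n0 : (0 < n)%N.
Implicit Types (s t x y e h a b : R) (z d : C).

Lemma size_gt1 : (1 < size T)%N. Proof. by rewrite sT ltnS. Qed.

Lemma eps_all (I : eqType) (r : seq I) (P : I -> R -> Prop) :
  (forall i, i \in r -> exists2 e, 0 < e & P i e) ->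
  (forall i e e', 0 < e' -> e' <= e -> P i e -> P i e') ->
  exists2 e, 0 < e & forall i, i \in r -> P i e.
Proof.
move=> H mono; elim: r H => [|i r IH] H; first by exists 1.
have [e e0 he] := H i (mem_head _ _).
have [|e' e0' he'] := IH.
  by move=> j jr; apply: H; rewrite inE jr orbT.
have m0 : 0 < Num.min e e' by rewrite lt_min e0.
exists (Num.min e e') => // j; rewrite inE => /orP[/eqP ->|jr].
  by apply: mono he => //; rewrite ge_min lexx.
by apply: mono (he' j jr) => //; rewrite ge_min lexx orbT.
Qed.

Lemma germ_side z d g (sg : R) k (V : {poly C}) (e0 h0 : R) : germ T z d g ->
  local_form T z k V -> V.[z] * d ^+ k = (normc V.[z])%:C * sg%:C -> 0 < e0 -> 0 < h0 ->
  exists e (phi : R -> R), [/\ 0 < e, e < e0, phi 0 = 0, cont_on 0 e phi &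
    forall s, 0 <= s <= e ->
      [/\ T.[g s] = T.[z] + (sg * phi s)%:C, 0 <= phi s, phi s < h0 & 0 < s -> 0 < phi s]].
Proof.
move=> [r [u [zeta [eta [a [k' [V' [rho [[r0 lf' rhoE rho0] [g0 u0 ze0 d1] h1 h2 h3]]]]]]]]] lf VE e00 h00.
have [kk VV] := local_form_unique lf' lf; rewrite kk VV in lf' rhoE h2.
have [k0 TE V0] := lf.
pose m := normc V.[z].
have m0 : 0 < m by rewrite normc_gt0.
have rE : rho = sg * m.
  have : rho%:C = (sg * m)%:C by rewrite -rhoE VE rmorphM mulrC.
  by case.
pose phi s := m * zeta s ^+ k.
have dphi s : `|s| < r -> is_derive s (1 : R) phi (m * (k%:R * zeta s ^+ k.-1 * eta s)).
  move=> /h2[hz _ _].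
  have := is_deriveM (is_derive_cst m s (1 : R)) (is_derive_exp k hz).
  by move=> hd; apply: is_derive_eq hd _; rewrite /GRing.scale /= mulr0 addr0.
have phi0 : phi 0 = 0 by rewrite /phi ze0 expr0n -[k == 0%N]negbK -lt0n k0 mulr0.
have cphi s : `|s| < r -> forall e, 0 < e -> exists2 d, 0 < d &
    forall x, `|x - s| < d -> `|phi x - phi s| < e.
  move=> sr e e_gt0.
  have cp : cder (fun s => (phi s)%:C) s (m * (k%:R * zeta s ^+ k.-1 * eta s))%:C.
    by split; [exact: dphi | exact: (is_derive_cst (0 : R) s (1 : R))].
  have [dd dd0 hd] := cder_cont cp e_gt0; exists dd => // x /hd.
  by rewrite -rmorphB normcR.
have r00 : `|0 : R| < r by rewrite normr0.
have [del del0 hdel] := cphi 0 r00 h0 h00.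
have [e1 [e10 e1a e1b e1c]] := minr_gt0_le3 e00 r0 del0.
pose e := e1 / 2.
have ep : 0 < e by rewrite divr_gt0.
have ee : e < e1 by rewrite /e; move: e10; clear -sT n0; lra.
have inr s : 0 <= s <= e -> `|s| < e1.
  by move=> /andP[s0 se]; rewrite ger0_norm // (le_lt_trans se).
exists e, phi; split => //; first exact: lt_le_trans ee e1a.
  move=> s /inr se eps eps0.
  by have [dd dd0 hd] := cphi s (lt_le_trans se e1b) eps eps0; exists dd => // x _; exact: hd.
move=> s sI; have se := inr s sI; have sr := lt_le_trans se e1b.
have [s0 _] := andP sI.
have [zp _] := germ_zeta (fun s sr => let: And3 a _ _ := h2 s sr in a)
       (fun s sr => let: And3 _ b _ := h2 s sr in b) ze0 sr.
have zge : 0 <= zeta s.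
  by move: s0; rewrite le_eqVlt => /orP[/eqP <-|/zp /ltW //]; rewrite ze0.
have [_ _ TgE] := h2 s sr; split.
- by rewrite TgE rE /phi mulrA.
- by rewrite mulr_ge0 ?exprn_ge0 // ltW.
- have := hdel s; rewrite subr0 phi0 subr0 => /(_ (lt_le_trans se e1c)).
  by rewrite ltr_norml => /andP[].
- by move=> /zp zp'; rewrite mulr_gt0 // exprn_gt0.
Qed.

Lemma arc_side z d (sg x0 : R) k (V : {poly C}) (e0 h0 : R) :
  local_form T z k V -> normc d = 1 -> V.[z] * d ^+ k = (normc V.[z])%:C * sg%:C ->
  T.[z] = x0%:C -> 0 < e0 -> 0 < h0 ->
  (forall h, 0 <= h < h0 -> -1 <= x0 + sg * h <= 1) ->
  exists e h1, [/\ 0 < e, e < e0, 0 < h1, arc T (std_germ T z d) 0 e &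
    forall h, 0 < h < h1 -> exists2 s, 0 < s < e & T.[std_germ T z d s] = (x0 + sg * h)%:C].
Proof.
move=> lf d1 VE Tz e00 h00 hin.
have [g hg] : exists g, germ T z d g.
  by apply: germ_exists lf d1 _; rewrite VE -rmorphM.
have sg' := std_germP hg.
have [e2 e20 hn] := std_germ_nice hg.
have m0 : 0 < Num.min e0 e2 by rewrite lt_min e00.
have [e [phi [ep ee phi0 cphi hphi]]] := germ_side sg' lf VE m0 h00.
move: ee; rewrite lt_min => /andP[ee1 ee2].
have eI : 0 <= e <= e by rewrite lexx ltW.
have [_ _ _ pe] := hphi e eI.
exists e, (phi e); split => //; first exact: pe.
- split => //.
    move=> t /andP[t0 te]; apply: hn; rewrite ger0_norm //.
    exact: le_lt_trans te ee2.
  move=> t /hphi[TE p0 ph _]; rewrite /in_E TE Tz -rmorphD /=; split => //.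
  by apply: hin; rewrite p0.
move=> h /andP[h_gt0 hpe].
have cc : {within `[0, e]%classic, continuous (fun x => phi (clamp 0 e x))}.
  exact: continuous_subspaceT (clamp_continuous (ltW ep) cphi).
have [] := @IVT R (fun x => phi (clamp 0 e x)) 0 e h (ltW ep) cc.
  rewrite !clamp_id ?lexx ?(ltW ep) // phi0.
  by rewrite ge_min le_max (ltW h_gt0) (ltW hpe) orbT.
move=> s /itvP sI; rewrite clamp_id ?sI // => ps.
have s0 : 0 < s.
  by rewrite lt_neqAle sI andbT; apply/eqP => z0; move: h_gt0; rewrite -ps -z0 phi0 ltxx.
have se : s < e.
  by rewrite lt_neqAle sI andbT; apply/eqP => z0; move: hpe; rewrite -ps z0 ltxx.
exists s; first by rewrite s0.
by have [|-> _ _ _] := hphi s _; rewrite ?sI // Tz ps -rmorphD.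
Qed.

(** The family is indexed by natural numbers, of which only those below m
    matter, so that families of different sizes have one type. *)
Definition covers (m : nat) (F : nat -> (R -> C) * R * R) (S : C -> Prop) : Prop :=
  (forall i, (i < m)%N -> arc T (F i).1.1 (F i).1.2 (F i).2) /\
  forall z, S z -> exists2 i, (i < m)%N & img (F i).1.1 (F i).1.2 (F i).2 z.

Lemma covers_sub m F (S S' : C -> Prop) : (forall z, S' z -> S z) ->
  covers m F S -> covers m F S'.
Proof. by move=> h [h1 h2]; split => // z /h /h2. Qed.

Lemma covers_union m F m' F' (S S' : C -> Prop) : covers m F S -> covers m' F' S' ->
  exists m2 F2, covers m2 F2 (fun z => S z \/ S' z).
Proof.
move=> [h1 h2] [h1' h2'].
exists (m + m')%N, (fun i => if (i < m)%N then F i else F' (i - m)%N); split.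
  move=> i im; case: (ltnP i m) => [|mi]; first exact: h1.
  by apply: h1'; rewrite ltn_subLR.
move=> z [/h2[i im hi]|/h2'[i im hi]].
  by exists i; [exact: ltn_addr | rewrite im].
exists (m + i)%N; first by rewrite ltn_add2l.
by rewrite ltnNge leq_addr /= addKn.
Qed.

(** For x close to x0 on one side, every one of the n germs that leave the
    points over x0 towards this side contains a point over x.  As T - x has at
    most n zeros, there are no other points over x. *)
Lemma cover_side (x0 sg h0 : R) : `|sg| = 1 -> 0 < h0 ->
  (forall h, 0 <= h < h0 -> -1 <= x0 + sg * h <= 1) ->
  exists (eta : R) m F, 0 < eta /\
    covers m F (fun z => exists2 h, 0 <= h < eta & T.[z] = (x0 + sg * h)%:C).
Proof.
move=> sg1 h00 hin.
have sgC : normc (sg%:C : C) = 1 by rewrite normcR.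
have [L [uL sL LP Lall]] := root_direction_list x0%:C sT n0 sgC.
pose G (p : C * C) := std_germ T p.1 p.2.
have Ggerm p : p \in L -> germ T p.1 p.2 (G p).
  move=> /LP[_ [k [V [lf d1 VE]]]].
  have [g hg] : exists g, germ T p.1 p.2 g.
    by apply: germ_exists lf d1 _; rewrite VE -rmorphM.
  exact: std_germP hg.
(* distinct germs are disjoint near their starting points *)
have sep2 p p' : p \in L -> p' \in L -> p != p' -> exists2 e, 0 < e &
    forall s s', 0 < s < e -> 0 < s' < e -> G p s != G p' s'.
  move=> pL pL' pp.
  have [r [u [r0 g0 u0 d1 H]]] := germ_facts (Ggerm p pL).
  have [r' [u' [r0' g0' u0' d1' H']]] := germ_facts (Ggerm p' pL').
  have rr0 : `|0 : R| < r by rewrite normr0.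
  have rr0' : `|0 : R| < r' by rewrite normr0.
  have [c1 _ _ _ _] := H 0 rr0; have [c1' _ _ _ _] := H' 0 rr0'.
  have [zz|zz] := eqVneq p.1 p'.1; last first.
    have k0 : 0 < normc (p.1 - p'.1) / 2 by rewrite divr_gt0 // normc_gt0 subr_eq0.
    have [e e0 he] := cder_cont c1 k0; have [e' e0' he'] := cder_cont c1' k0.
    exists (Num.min e e'); first by rewrite lt_min e0.
    move=> s s' /andP[s0]; rewrite lt_min => /andP[se _] /andP[s0'].
    rewrite lt_min => /andP[_ se']; apply/eqP => E.
    have := he s; rewrite subr0 gtr0_norm // g0 => /(_ se) b1.
    have := he' s'; rewrite subr0 gtr0_norm // g0' => /(_ se') b2.
    have := normcBD p.1 (G p s) p'.1; rewrite (normcB p.1 (G p s)) {2}E.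
    by move: b1 b2; clear -sT n0; lra.
  apply: contrapT => nh; move/negP: pp; apply; apply/eqP.
  have dd : p.2 = p'.2.
    rewrite -u0 -u0'; apply: (dirsep_unit c1 c1'); rewrite ?g0 ?g0' ?u0 ?u0' //.
    move=> e e0; apply: contrapT => nh2; apply: nh; exists e => // s s' hs hs'.
    by apply/eqP => E; apply: nh2; exists s, s'.
  by rewrite (surjective_pairing p) (surjective_pairing p') zz dd.
have [eps eps0 sep] : exists2 e, 0 < e & forall p, p \in L -> forall p', p' \in L ->
    p != p' -> forall s s', 0 < s < e -> 0 < s' < e -> G p s != G p' s'.
  have mono (p p' : C * C) (e e' : R) : e' <= e ->
     (p' \in L -> p != p' -> forall s s', 0 < s < e -> 0 < s' < e -> G p s != G p' s') ->
     (p' \in L -> p != p' -> forall s s', 0 < s < e' -> 0 < s' < e' -> G p s != G p' s').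
    move=> ee H pL' pp s s' /andP[s0 se] /andP[s0' se'].
    by apply: H => //; [rewrite s0 (lt_le_trans se) | rewrite s0' (lt_le_trans se')].
  apply: (@eps_all _ L (fun p e => forall p', p' \in L -> p != p' ->
      forall s s', 0 < s < e -> 0 < s' < e -> G p s != G p' s')).
    move=> p pL.
    have [||e e0 he] := @eps_all _ L (fun p' e => p' \in L -> p != p' ->
      forall s s', 0 < s < e -> 0 < s' < e -> G p s != G p' s').
    - move=> p' pL'; have [->|pp] := eqVneq p p'; first by exists 1.
      by have [e e0 he] := sep2 p p' pL pL' pp; exists e => // _ _; exact: he.
    - by move=> p' e e' _ ee; exact: mono.
    by exists e => // p' pL'; exact: he.
  by move=> p e e' _ ee H p' pL' pp; apply: mono ee _ pL' pp => h1 h2; exact: H.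
have side p : exists eh : R * R, p \in L -> [/\ 0 < eh.1, eh.1 < eps, 0 < eh.2,
   arc T (G p) 0 eh.1 & forall h, 0 < h < eh.2 ->
     exists2 s, 0 < s < eh.1 & T.[G p s] = (x0 + sg * h)%:C].
  have [pL|] := boolP (p \in L); last by exists (0, 0).
  have [Tp [k [V [lf d1 VE]]]] := LP p pL.
  have [e [h1 [q1 q2 q3 q4 q5]]] := arc_side lf d1 VE Tp eps0 h00 hin.
  by exists (e, h1).
have [eh ehP] := choice side.
have [eta eta0 etaP] : exists2 e, 0 < e & forall p, p \in L -> e <= (eh p).2.
  apply: (@eps_all _ L (fun p e => e <= (eh p).2)).
    by move=> p pL; have [_ _ h _ _] := ehP p pL; exists (eh p).2.
  by move=> p e e' _ ee; apply: le_trans.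
pose F i : (R -> C) * R * R := let p := nth (0, 0) L i in (G p, 0, (eh p).1).
have imF p s : p \in L -> 0 <= s <= (eh p).1 ->
    exists2 i, (i < n)%N & img (F i).1.1 (F i).1.2 (F i).2 (G p s).
  move=> pL hs; exists (index p L); first by rewrite -sL index_mem.
  by rewrite /F nth_index //=; exists s.
exists eta, n, F; split => //; split.
  move=> i; rewrite -sL => iL; have pL := mem_nth (0, 0) iL.
  by have [_ _ _ h _] := ehP _ pL.
move=> z [h /andP[h_ge0 heta] Tz].
move: h_ge0; rewrite le_eqVlt => /orP[/eqP hz|h_gt0].
  have [|d zd] := Lall z; first by rewrite Tz -hz mulr0 addr0.
  have [e0 _ _ _ _] := ehP _ zd.
  have eI : 0 <= (0 : R) <= (eh (z, d)).1 by rewrite lexx ltW.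
  have := imF _ 0 zd eI.
  by have [r [u [_ -> _ _ _]]] := germ_facts (Ggerm _ zd).
have pts p : exists s, p \in L -> 0 < s < (eh p).1 /\ T.[G p s] = (x0 + sg * h)%:C.
  have [pL|] := boolP (p \in L); last by exists 0.
  have [_ _ _ _ q] := ehP p pL.
  have hI : 0 < h < (eh p).2 by rewrite h_gt0 (lt_le_trans heta) // etaP.
  by have [s s1 s2] := q h hI; exists s.
have [sp spP] := choice pts.
pose ws := [seq G p (sp p) | p <- L].
have [zws|zws] := boolP (z \in ws).
  have /mapP[p pL ->] := zws; have [/andP[s0 se] _] := spP p pL.
  by apply: imF => //; rewrite !ltW.
exfalso.
pose P := T - (x0 + sg * h)%:C%:P.
have sP : size P = n.+1.
  by rewrite /P size_polyDl // sT size_polyN (leq_ltn_trans (size_polyC_leq1 _)).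
have P0 : P != 0 by rewrite -size_poly_eq0 sP.
have uws : uniq (z :: ws).
  rewrite /= zws map_inj_in_uniq // => p p' pL pL' E.
  apply/eqP; apply: contraT => pp.
  have [/andP[s0 se] _] := spP p pL; have [/andP[s0' se'] _] := spP p' pL'.
  have [_ ee _ _ _] := ehP p pL; have [_ ee' _ _ _] := ehP p' pL'.
  have := sep p pL p' pL' pp (sp p) (sp p').
  by rewrite s0 s0' (lt_trans se ee) (lt_trans se' ee') E eqxx => /(_ isT isT).
have rws : all (root P) (z :: ws).
  have rP w : T.[w] = (x0 + sg * h)%:C -> root P w.
    by move=> hw; rewrite /root /P !hornerE hw subrr.
  rewrite /= rP //=; apply/allP => w /mapP[p pL ->]; apply: rP.
  by have [] := spP p pL.
by have := max_poly_roots P0 rws uws; rewrite /= size_map sL sP ltnn.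
Qed.

Lemma cover_local (x0 : R) : -1 <= x0 <= 1 ->
  exists (eta : R) m F, 0 < eta /\
    covers m F (fun z => in_E T z /\ `|Re T.[z] - x0| < eta).
Proof.
move=> /andP[x1 x2].
have up : exists (eta : R) m F, 0 < eta /\
    covers m F (fun z => in_E T z /\ x0 <= Re T.[z] < x0 + eta /\ x0 < 1).
  have [x3|x3] := ltP x0 1; last first.
    exists 1, 0%N, (fun=> (fun=> 0, 0, 0)); split => //; split => // z [_ [_ h]].
    by [].
  have h0 : 0 < 1 - x0 by rewrite subr_gt0.
  have [||eta [m [F [e0 hF]]]] := @cover_side x0 1 (1 - x0) _ h0.
  - by rewrite normr1.
  - by move=> h /andP[q1 q2]; apply/andP; split; move: q1 q2 x1 x2; clear -sT n0; lra.
  exists eta, m, F; split => //; apply: covers_sub hF => z [[zI _] [/andP[q1 q2] _]].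
  exists (Re T.[z] - x0).
    by rewrite subr_ge0 q1 ltrBlDl.
  by rewrite mul1r addrC subrK; exact: Im0_real.
have down : exists (eta : R) m F, 0 < eta /\
    covers m F (fun z => in_E T z /\ x0 - eta < Re T.[z] <= x0 /\ -1 < x0).
  have [x3|x3] := ltP (-1) x0; last first.
    exists 1, 0%N, (fun=> (fun=> 0, 0, 0)); split => //; split => // z [_ [_ h]].
    by [].
  have h0 : 0 < x0 + 1 by rewrite -[1]opprK subr_gt0.
  have [||eta [m [F [e0 hF]]]] := @cover_side x0 (-1) (x0 + 1) _ h0.
  - by rewrite normrN1.
  - by move=> h /andP[q1 q2]; apply/andP; split; move: q1 q2 x1 x2; clear -sT n0; lra.
  exists eta, m, F; split => //; apply: covers_sub hF => z [[zI _] [/andP[q1 q2] _]].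
  exists (x0 - Re T.[z]).
    by rewrite subr_ge0 q2 ltrBlDl -ltrBlDr.
  by rewrite mulN1r opprB addrC subrK; exact: Im0_real.
have [e1 [m1 [F1 [e10 c1]]]] := up; have [e2 [m2 [F2 [e20 c2]]]] := down.
have [m [F hF]] := covers_union c1 c2.
exists (Num.min e1 e2), m, F; split; first by rewrite lt_min e10.
apply: covers_sub hF => z [zE]; rewrite lt_min !ltr_norml => /andP[/andP[a1 a2] /andP[b1 b2]].
have [_ /andP[z1 z2]] := zE.
have [h|h|h] := ltgtP (Re T.[z]) x0.
- right; split => //; split; last exact: le_lt_trans z1 h.
  by rewrite ?(ltW h) ?andbT; move: b1; clear -sT n0; lra.
- left; split => //; split; last exact: lt_le_trans h z2.
  by rewrite ?(ltW h) /=; move: a2; clear -sT n0; lra.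
- have [h1|h1] := ltP x0 1.
    left; split => //; split => //; rewrite ?h ?lexx /=; move: e10; clear -sT n0; lra.
  right; split => //; split; first by rewrite ?h ?lexx ?andbT; move: e20; clear -sT n0; lra.
  by apply: lt_le_trans h1; clear -sT n0; lra.
Qed.

(** The supremum of the x for which the part of E over [-1, x] has a finite
    covering is 1 by [cover_local]. *)
Lemma E_covered : exists m F, covers m F (in_E T).
Proof.
pose S x z := in_E T z /\ Re T.[z] <= x.
pose A : set R := [set x | -1 <= x <= 1 /\ exists m F, covers m F (S x)].
have Am : A (-1).
  have I1 : -1 <= (-1 : R) <= 1 by apply/andP; split; lra.
  split => //; have [eta [m [F [e0 hF]]]] := cover_local I1.
  exists m, F; apply: covers_sub hF => z [zE z1]; split => //.
  have [_ /andP[z2 _]] := zE.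
  have -> : Re T.[z] = -1 by apply: le_anti; rewrite z1 z2.
  by rewrite subrr normr0.
have hs : has_sup A by split; [exists (-1) | exists 1 => t [/andP[_ k] _]].
pose t := sup A.
have ubt : ubound A t := sup_upper_bound hs.
have t1 : -1 <= t by exact: ubt.
have t2 : t <= 1 by apply: ge_sup; [exists (-1) | move=> s [/andP[_ k] _]].
have tI : -1 <= t <= 1 by rewrite t1.
have [eta [m [F [e0 hF]]]] := cover_local tI.
have [s [_ [m' [F' hF']]] st] := sup_adherent e0 hs.
have [m2 [F2 hF2]] := covers_union hF hF'.
have Ax : A (Num.min 1 (t + eta / 2)).
  split.
    rewrite ge_min lexx andbT le_min; apply/andP; split; first by lra.
    by move: t1 e0; clear -sT n0; lra.
  exists m2, F2; apply: covers_sub hF2 => z [zE]; rewrite le_min => /andP[z1 z2].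
  have [zs|zs] := leP (Re T.[z]) s; first by right.
  left; split => //; rewrite ltr_norml; apply/andP; split.
    by move: zs st; rewrite -/t; clear -sT n0; lra.
  by move: z2 e0; clear -sT n0; lra.
have [_ [m3 [F3 hF3]]] := Ax.
have := ubt _ Ax; rewrite ge_min => /orP[h|h]; last first.
  by exfalso; move: h e0; clear -sT n0; lra.
exists m3, F3; apply: covers_sub hF3 => z zE; split => //.
have [_ /andP[_ z2]] := zE.
rewrite le_min z2 /=; apply: le_trans z2 _; move: h e0; clear -sT n0; lra.
Qed.

End Coverage.

(** * Directions in which E leaves a point *)

Section Inward.
Variable R : realType.
Local Notation C := R[i].
Variables (T : {poly C}) (n : nat).
Hypothesis sT : size T = n.+1.
Hypothesis n0 : (0 < n)%N.
Implicit Types (s t x y e h a b : R) (z d : C).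

Let sT1 : (1 < size T)%N. Proof. exact: size_gt1 sT n0. Qed.

Definition odd_zero z : bool := odd (mup z (T ^+ 2 - 1)).

Definition inward z d : Prop := (exists g, germ T z d g) /\
  exists2 e, 0 < e & forall s, 0 <= s <= e -> in_E T (std_germ T z d s).

Lemma frequently_fin (m : nat) (Q : nat -> R -> Prop) :
  (forall e, 0 < e -> exists2 s, 0 < s < e & exists2 i, (i < m)%N & Q i s) ->
  exists2 i, (i < m)%N & forall e, 0 < e -> exists2 s, 0 < s < e & Q i s.
Proof.
move=> H; apply: contrapT => nh.
have [||e e0 he] := @eps_all R _ (iota 0 m) (fun i e => forall s, 0 < s < e -> ~ Q i s).
- move=> i; rewrite mem_iota add0n /= => im.
  apply: contrapT => nh2; apply: nh; exists i => // e e0.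
  apply: contrapT => nh3; apply: nh2; exists e => // s hs Qs; apply: nh3; by exists s.
- move=> i e e' e0' ee H' s /andP[s0 se]; apply: H'.
  by rewrite s0 (lt_le_trans se).
have [s hs [i im Qs]] := H e e0.
by apply: (he i _ s hs Qs); rewrite mem_iota.
Qed.

Lemma E_real z : in_E T z -> T.[z] = (Re T.[z])%:C.
Proof. by move=> [h _]; exact: Im0_real. Qed.

Lemma germ_sign z d g : germ T z d g ->
  exists k V (sg : R), [/\ local_form T z k V, `|sg| = 1 &
    V.[z] * d ^+ k = (normc V.[z])%:C * sg%:C].
Proof.
move=> [r [u [zeta [eta [a [k [V [rho [[r0 lf rhoE rho0] [g0 u0 ze0 d1] h1 h2 h3]]]]]]]]].
exists k, V, (Num.sg rho); split => //; first by rewrite normr_sg rho0.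
have -> : normc V.[z] = `|rho|.
  by rewrite -normcR -rhoE normcM normcX d1 expr1n mulr1.
by rewrite rhoE -rmorphM mulrC -numEsg.
Qed.

Lemma germ_inward z d g k (V : {poly C}) (x0 sg h0 : R) : germ T z d g ->
  local_form T z k V -> V.[z] * d ^+ k = (normc V.[z])%:C * sg%:C ->
  T.[z] = x0%:C -> 0 < h0 -> (forall h, 0 <= h < h0 -> -1 <= x0 + sg * h <= 1) ->
  inward z d.
Proof.
move=> hg lf VE Tz h00 hin; split; first by exists g.
have [e [phi [e0 _ _ _ he]]] := germ_side (std_germP hg) lf VE ltr01 h00.
exists e => // s /he[TE p0 ph _]; rewrite /in_E TE Tz -rmorphD /=; split => //.
by apply: hin; rewrite p0.
Qed.

Lemma inward_sign z d (x0 : R) k (V : {poly C}) : inward z d -> T.[z] = x0%:C ->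
  `|x0| = 1 -> local_form T z k V -> V.[z] * d ^+ k = (normc V.[z])%:C * (- x0)%:C.
Proof.
move=> [[g hg] [e e0 he]] Tz x01 lf.
have [k' [V' [sg [lf' sg1 VE]]]] := germ_sign hg.
have [kk VV] := local_form_unique lf' lf; rewrite kk VV in VE.
have [e1 [phi [e10 ee1 _ _ he1]]] := germ_side (std_germP hg) lf VE e0 ltr01.
have e1I : 0 <= e1 <= e1 by rewrite lexx ltW.
have [TE _ _ /(_ e10) pp] := he1 e1 e1I.
have [|_] := he e1; first by rewrite !ltW.
rewrite TE Tz -rmorphD /= => hE; rewrite VE; congr (_ * _%:C).
move: hE; case: (normr1P x01) => ->; case: (normr1P sg1) => -> /andP[h1 h2]; rewrite ?opprK //; exfalso;
  move: h1 h2 pp; clear -sT n0; lra.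
Qed.

Lemma mup_boundary z (x0 : R) k (V : {poly C}) : T.[z] = x0%:C -> `|x0| = 1 ->
  local_form T z k V -> mup z (T ^+ 2 - 1) = k.
Proof.
move=> Tz x01 lf; rewrite -(local_form_mup lf) Tz.
have E : T ^+ 2 - 1 = (T - x0%:C%:P) * (T + x0%:C%:P).
  have x02 : x0 ^+ 2 = 1 by rewrite -real_normK ?num_real // x01 expr1n.
  have xC : (x0%:C : C) ^+ 2 = 1.
    by rewrite -(rmorphXn (real_complex R)) x02.
  have pC : (x0%:C%:P : {poly C}) ^+ 2 = 1 by rewrite -polyC_exp xC.
  by rewrite -subr_sqr pC.
rewrite E mupMl // /root hornerD hornerC Tz -rmorphD /=.
have : x0 + x0 != 0.
  by rewrite -mulr2n mulrn_eq0 /= -normr_gt0 x01.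
by rewrite eq_complex /= eqxx andbT.
Qed.

Lemma mup_interior z : T.[z] != 1 -> T.[z] != -1 -> mup z (T ^+ 2 - 1) = 0%N.
Proof.
move=> h1 h2; apply: mupNroot.
by rewrite /root !hornerE -(expr1n _ 2) subr_sqr mulf_neq0 // ?subr_eq0 // addr_eq0.
Qed.

(** If T(z) is 1 or -1, then T - T(z) has a zero of even order k at z, and its
    leading term takes the same value in opposite directions; otherwise T may
    move to either side of T(z). *)
Lemma inward_opp z d : in_E T z -> ~~ odd_zero z -> inward z d -> inward z (- d).
Proof.
move=> zE no iz; have [[g hg] _] := iz.
have [k [V [sg [lf sg1 VE]]]] := germ_sign hg.
have Tz := E_real zE; set x0 := Re T.[z] in Tz.
have hg' := germ_rev hg.
have VE' : V.[z] * (- d) ^+ k = (normc V.[z])%:C * ((-1) ^+ k * sg)%:C.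
  rewrite (exprNn d) mulrCA VE rmorphM rmorphXn rmorphN1 /=; ring.
have sg1' : `|(-1) ^+ k * sg| = 1 by rewrite normrM normrX normrN1 expr1n mul1r.
have [_ /andP[z1 z2]] := zE.
have [x1|x1] := eqVneq `|x0| 1.
  have kev : ~~ odd k by move: no; rewrite /odd_zero (mup_boundary Tz x1 lf).
  have VE2 := inward_sign iz Tz x1 lf.
  apply: (germ_inward (sg := - x0) (h0 := 1) hg' lf _ Tz ltr01).
    rewrite (exprNn d) mulrCA VE2 -signr_odd (negPf kev) expr0 mul1r //.
  move=> h /andP[h1 h2]; case: (normr1P x1) => ->; apply/andP; split;
    move: h1 h2; clear -sT n0; lra.
have x2 : 0 < 1 - `|x0|.
  by rewrite subr_gt0 lt_neqAle x1 /= ler_norml z1 z2.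
apply: (germ_inward (sg := (-1) ^+ k * sg) hg' lf VE' Tz x2).
move=> h /andP[h1 h2]; rewrite -ler_norml.
apply: le_trans (ler_normD _ _) _; rewrite normrM sg1' mul1r ger0_norm //.
by move: h2; clear -sT n0; lra.
Qed.

(** In opposite directions the leading term of odd degree has opposite signs,
    and in one of them T leaves [-1,1]. *)
Lemma inward_not_opp z d : in_E T z -> odd_zero z -> inward z d -> ~ inward z (- d).
Proof.
move=> zE oz iz iz'; have Tz := E_real zE; set x0 := Re T.[z] in Tz.
have x1 : `|x0| = 1.
  have [h|h1] := eqVneq T.[z] 1.
    by rewrite /x0 h /= normr1.
  have [h|h2] := eqVneq T.[z] (-1).
    by rewrite /x0 h /= normrN1.
  by move: oz; rewrite /odd_zero mup_interior.
have [k [V lf]] := local_form_exists z sT1.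
have ko : odd k by move: oz; rewrite /odd_zero (mup_boundary Tz x1 lf).
have h1 := inward_sign iz Tz x1 lf; have h2 := inward_sign iz' Tz x1 lf.
have [_ _ V0] := lf.
move: h2; rewrite (exprNn d) mulrCA h1 -signr_odd ko expr1 mulN1r => /eqP.
rewrite eq_sym -subr_eq0 opprK -mulr2n mulrn_eq0 /= mulf_eq0.
rewrite -!normc_eq0 !normcR normrN x1 oner_eq0 orbF normr_eq0 normc_eq0.
by rewrite (negPf V0).
Qed.

(** The curve runs infinitely often into one arc of a finite covering of E;
    apply [curve_hits_arc]. *)
Lemma E_direction (f : R -> C) d z : cder f 0 d -> f 0 = z -> d != 0 ->
  (forall e, 0 < e -> exists2 s, 0 < s < e & in_E T (f s)) -> inward z (dirn d).
Proof.
move=> cf f0 d0 H.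
have [m [F [Farc Fcov]]] := E_covered sT n0.
have [i im Hi] : exists2 i, (i < m)%N & forall e, 0 < e -> exists2 s, 0 < s < e &
    img (F i).1.1 (F i).1.2 (F i).2 (f s).
  apply: frequently_fin => e /H[s hs sE]; exists s => //; exact: Fcov.
have Ai := Farc i im.
move: (F i).1.1 (F i).1.2 (F i).2 Ai Hi => g a b Ai Hi.
have [ab ng gE] := Ai.
have [t [tI gt dd]] := @curve_hits_arc R f g (curve_derive g) z d a b cf f0 d0
  (fun t ht => nice_cder (nice_on_dir ng ht))
  (fun t ht => nice_neq0 (nice_on_dir ng ht))
  (arc_injective sT1 Ai) Hi.
have nt := nice_on_dir ng tI; set u := curve_derive g t in nt dd.
have du : dirn u = u by apply: dirn_unit; exact: nice_norm1 nt.
rewrite du in dd.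
have [[h hg] [e e0 he]] := nt; rewrite gt in hg he.
have [/andP[ta tb]] := tI.
case: dd => [[tb' ->]|[ta' ->]].
  split; first by exists h.
  have bt : 0 < b - t by rewrite subr_gt0.
  have [r [r0 re rb]] := exists_pos_lt2 e0 bt; exists r => // s /andP[s0 sr].
  rewrite -he ?ger0_norm ?(le_lt_trans sr) //; apply: gE.
  by rewrite (le_trans ta) ?lerDl //= -lerBrDl (le_trans sr) // ltW.
split; first by eexists; exact: germ_rev hg.
have at0 : 0 < t - a by rewrite subr_gt0.
have [r [r0 re ra]] := exists_pos_lt2 e0 at0; exists r => // s /andP[s0 sr].
rewrite std_germN ?(nice_neq0 nt) // -he ?normrN ?ger0_norm ?(le_lt_trans sr) //.
by apply: gE; apply/andP; split; [move: ra sr|move: s0 tb]; clear -sT n0; lra.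
Qed.

End Inward.

(** * A covering by the least number of arcs *)

Section Minimal.
Variable R : realType.
Local Notation C := R[i].
Variables (T : {poly C}) (n : nat).
Hypothesis sT : size T = n.+1.
Hypothesis n0 : (0 < n)%N.
Implicit Types (s t x y e a b : R) (z d : C).

Let sT1 : (1 < size T)%N. Proof. exact: size_gt1 sT n0. Qed.

Definition arc_data : Type := ((R -> C) * R * R)%type.
Definition fimg (A : arc_data) : set C := img A.1.1 A.1.2 A.2.
Definition is_arc (A : arc_data) : Prop := arc T A.1.1 A.1.2 A.2.

(** An end is a boolean, false for the start and true for the finish; the
    direction at an end points from it into the arc. *)
Definition end_par (A : arc_data) (e : bool) : R := if e then A.2 else A.1.2.
Definition end_pt (A : arc_data) (e : bool) : C := A.1.1 (end_par A e).
Definition end_dir (A : arc_data) (e : bool) : C :=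
  (if e then -1 else 1) * curve_derive A.1.1 (end_par A e).

Lemma end_par_in A (e : bool) : is_arc A -> A.1.2 <= end_par A e <= A.2.
Proof. by move=> [ab _ _]; rewrite /end_par; case: e; rewrite lexx ltW. Qed.

Lemma end_nice A (e : bool) : is_arc A ->
  nice_at T A.1.1 (end_par A e) (curve_derive A.1.1 (end_par A e)).
Proof. by move=> hA; have [_ ng _] := hA; apply: nice_on_dir ng (end_par_in e hA). Qed.

Lemma arc_off_end (A : arc_data) (e : bool) (s : R) :
  end_par A e + (if e then -1 else 1) * s = if e then A.2 - s else A.1.2 + s.
Proof. by rewrite /end_par; case: e; rewrite ?mulN1r ?mul1r. Qed.

Lemma end_germ A (e : bool) : is_arc A -> exists2 r, 0 < r & forall s, `|s| < r ->
  std_germ T (end_pt A e) (end_dir A e) s = A.1.1 (end_par A e + (if e then -1 else 1) * s).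
Proof.
move=> hA; have ng := end_nice e hA; have [_ [r r0 hr]] := ng.
exists r => // s sr; rewrite /end_dir /end_pt.
case: e ng hr => ng hr; rewrite ?mulN1r ?mul1r.
  by rewrite std_germN ?(nice_neq0 ng) // -hr ?normrN.
by rewrite -hr.
Qed.

Lemma end_inward A (e : bool) : is_arc A -> inward T (end_pt A e) (end_dir A e).
Proof.
move=> hA; have [ab ng gE] := hA; have := end_nice e hA.
rewrite /inward => hn; split.
  have [[h hg] _] := hn; rewrite /end_dir; case: e hn hg => hn hg.
    by rewrite mulN1r; eexists; exact: germ_rev hg.
  by rewrite mul1r; exists h.
have [r r0 hr] := end_germ e hA.
have l0 : 0 < A.2 - A.1.2 by rewrite subr_gt0.
have [q [q0 qr ql]] := exists_pos_lt2 r0 l0; exists q => // s /andP[s0 sq].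
rewrite hr ?ger0_norm ?(le_lt_trans sq) // arc_off_end; apply: gE.
by case: (e); apply/andP; split; move: s0 sq ql; clear -sT n0; lra.
Qed.

Definition family (m : nat) (F : nat -> arc_data) : Prop :=
  (forall i, (i < m)%N -> is_arc (F i)) /\
  forall z, in_E T z -> exists2 i, (i < m)%N & fimg (F i) z.

Lemma family_merge m F i j K : family m F -> (i < j)%N -> (j < m)%N -> is_arc K ->
  fimg K = fimg (F i) `|` fimg (F j) -> exists F', family m.-1 F'.
Proof.
move=> [hF cF] ij jm hK KE.
exists (fun k => if k == i then K else if k == j then F m.-1 else F k).
have m0 : (0 < m)%N by apply: leq_trans jm.
split.
  move=> k km; case: eqP => // _; case: eqP => _; apply: hF.
    by rewrite prednK.
  by apply: leq_trans km _; rewrite leq_pred.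
move=> z /cF[k km zk].
have im : (i < m.-1)%N by rewrite (leq_trans ij) // -ltnS prednK.
have [ki|ki] := eqVneq k i.
  by exists i => //; rewrite eqxx KE; left; rewrite -ki.
have [kj|kj] := eqVneq k j.
  by exists i => //; rewrite eqxx KE; right; rewrite -kj.
have [kl|kl] := eqVneq k m.-1.
  exists j; first by rewrite ltn_neqAle -kl eq_sym kj kl -ltnS prednK.
  by rewrite (gtn_eqF ij) eqxx -kl.
exists k; last by rewrite (negPf ki) (negPf kj).
by rewrite ltn_neqAle kl -ltnS prednK.
Qed.

Lemma minimal_family : exists m F, family m F /\
  forall m' F', family m' F' -> (m <= m')%N.
Proof.
have [m [F hF]] := E_covered sT n0.
have ex : exists m, `[< exists F, family m F >] by exists m; apply/asboolP; exists F.
have [F' hF'] : exists F, family (ex_minn ex) F.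
  by case: ex_minnP => k /asboolP.
exists (ex_minn ex), F'; split => // m' G hG.
by case: ex_minnP => k _; apply; apply/asboolP; exists G.
Qed.

Variables (m : nat) (F : nat -> arc_data).
Hypothesis hF : family m F.
Hypothesis minF : forall m' F', family m' F' -> (m <= m')%N.

Let F_arc i : (i < m)%N -> is_arc (F i).
Proof. by have [h _] := hF; exact: h. Qed.

(** Otherwise the two arcs could be merged. *)
Lemma min_no_merge i j t t' d d' : (i < m)%N -> (j < m)%N -> i != j ->
  (F i).1.2 <= t <= (F i).2 -> (F j).1.2 <= t' <= (F j).2 ->
  (F i).1.1 t = (F j).1.1 t' -> nice_at T (F i).1.1 t d -> nice_at T (F j).1.1 t' d' ->
  (d = d' \/ d = - d') -> False.
Proof.
move=> im jm ij tI tI' E ni nj dd.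
have [k [x [y [hk kE]]]] := arc_merge (F_arc im) (F_arc jm) tI tI' E ni nj dd.
have [F' hF'] : exists F', family m.-1 F'.
  have [lt_ij|lt_ji|eq_ij] := ltngtP i j.
  - exact: (@family_merge m F i j (k, x, y)).
  - apply: (@family_merge m F j i (k, x, y)) => //.
    by rewrite /fimg /= kE setUC.
  - by rewrite eq_ij eqxx in ij.
by have := minF hF'; rewrite leqNgt ltn_predL (leq_trans _ im).
Qed.

Let u i := curve_derive (F i).1.1.

Lemma min_hit_no (f : R -> C) d z i j t : cder f 0 d -> f 0 = z -> normc d = 1 ->
  (i < m)%N -> (j < m)%N -> i != j -> (F i).1.2 <= t <= (F i).2 -> (F i).1.1 t = z ->
  (d = u i t \/ d = - u i t) ->
  ~ (forall e, 0 < e -> exists2 s, 0 < s < e & fimg (F j) (f s)).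
Proof.
move=> cf f0 d1 im jm ij tI gt du H.
have d0 : d != 0 by rewrite -normc_gt0 d1.
have [_ ni _] := F_arc im; have Aj := F_arc jm; have [_ nj _] := Aj.
have [t' [tI' gt' dd]] := @curve_hits_arc R f _ (u j) z d _ _ cf f0 d0
  (fun t ht => nice_cder (nice_on_dir nj ht))
  (fun t ht => nice_neq0 (nice_on_dir nj ht))
  (arc_injective sT1 Aj) H.
have nj' := nice_on_dir nj tI'.
have E : dirn (u j t') = u j t' by apply: dirn_unit; exact: nice_norm1 nj'.
rewrite E (dirn_unit d1) in dd.
apply: (min_no_merge im jm ij tI tI' _ (nice_on_dir ni tI) nj').
  by rewrite gt gt'.
case: du => du; case: dd => [[_ dd]|[_ dd]].
- by left; rewrite -/(u i t) -du.
- by right; rewrite -/(u i t) -du.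
- by right; rewrite -/(u j t') -dd du opprK.
- by left; apply: oppr_inj; rewrite -/(u i t) -/(u j t') -du.
Qed.

(** At an accumulation point of the intersection both arcs would have the same
    tangent line, by [curve_hits_arc]. *)
Lemma min_finite i j : (i < m)%N -> (j < m)%N -> i != j ->
  finite_set (fimg (F i) `&` fimg (F j)).
Proof.
move=> im jm ij; have Ai := F_arc im; have [ab ni gE] := Ai.
pose a := (F i).1.2; pose b := (F i).2; pose g := (F i).1.1.
pose P : set R := [set t | a <= t <= b /\ fimg (F j) (g t)].
have PE : fimg (F i) `&` fimg (F j) `<=` g @` P.
  by move=> z [[t tI <-] zj]; exists t.
apply: sub_finite_set PE _; apply: finite_image.
apply: contrapT => infP.
have bP : bounded_set P.
  exists (`|a| + `|b|); split; first exact: num_real.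
  move=> x hx t [/andP[ta tb] _] /=; apply: le_trans (ltW hx).
  have := ler_norm b; have := ler_norm (- a); rewrite normrN ler_norml => h1 h2.
  have := normr_ge0 a; have := normr_ge0 b => h3 h4.
  by apply/andP; split; move: h1 h2 h3 h4 ta tb; clear -sT n0 hF minF; lra.
have [t lt] := infinite_bounded_limit_point_nonempty infP bP.
have near e : 0 < e -> exists2 s, P s & s != t /\ `|s - t| < e.
  move=> e0; have [s [st Ps hs]] := lt _ (nbhsx_ballx t e e0).
  by exists s => //; split => //; move: hs; rewrite /ball /= distrC.
have tI : a <= t <= b.
  apply/andP; split; rewrite leNgt; apply/negP => h.
    have e0 : 0 < a - t by rewrite subr_gt0.
    have [s [/andP[s1 s2] _] [_]] := near _ e0.
    rewrite ltr_norml => /andP[_]; move: s1; clear -sT n0 hF minF; lra.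
  have e0 : 0 < t - b by rewrite subr_gt0.
  have [s [/andP[s1 s2] _] [_]] := near _ e0.
  by rewrite ltr_norml => /andP[h1 _]; move: s2 h1; clear -sT n0 hF minF; lra.
have cg : cder g t (u i t) := nice_cder (nice_on_dir ni tI).
have u1 : normc (u i t) = 1 := nice_norm1 (nice_on_dir ni tI).
have cr : cder (fun s => g (t + s)) 0 (u i t) by apply: cder_shift; rewrite addr0.
have cl : cder (fun s => g (t - s)) 0 (- u i t).
  have cg' : cder (fun s => g (t + s)) (- 0) (u i t) by apply: cder_shift; rewrite oppr0 addr0.
  exact: (cder_rev cg').
have [right|nright] := pselect (forall e, 0 < e ->
    exists2 s, 0 < s < e & fimg (F j) (g (t + s))).
  apply: (@min_hit_no (fun s => g (t + s)) (u i t) (g t) i j t cr) => //; last by left.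
  by rewrite addr0.
apply: (@min_hit_no (fun s => g (t - s)) (- u i t) (g t) i j t cl) => //.
- by rewrite subr0.
- by rewrite normcN.
- by right.
have [e1 [e10 he1]] : exists e1, 0 < e1 /\ forall s, 0 < s < e1 -> ~ fimg (F j) (g (t + s)).
  apply: contrapT => nh; apply: nright => e e0; apply: contrapT => nh2; apply: nh.
  by exists e; split => // s hs Fs; apply: nh2; exists s.
move=> e e0; have m0 : 0 < Num.min e e1 by rewrite lt_min e0.
have [s [sI Fs] [st]] := near _ m0; rewrite lt_min => /andP[se se1].
have [ts|ts|ts] := ltgtP t s.
- exfalso; apply: (he1 (s - t)); last by rewrite addrC subrK.
  by move: se1; rewrite gtr0_norm ?subr_gt0 // ts.
- exists (t - s); last by rewrite opprB addrC subrK.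
  by move: se; rewrite distrC gtr0_norm ?subr_gt0 // ts => ->.
- by rewrite ts eqxx in st.
Qed.

(** At any other point E continues beyond the end of the arc.  The arc that
    covers the continuation either could be merged with the one that ends, or
    is that same arc, which would then meet itself. *)
Lemma min_end_odd i (e : bool) : (i < m)%N -> odd_zero T (end_pt (F i) e).
Proof.
move=> im; apply: contrapT => /negP no.
have Ai := F_arc im; have [ab ni gE] := Ai.
have tI := end_par_in e Ai; set t := end_par (F i) e in tI.
pose z := end_pt (F i) e; pose d := end_dir (F i) e.
have zE : in_E T z by exact: gE.
(* E continues beyond the end point, and another arc must cover this part *)
have [[h hg] [r r0 hr]] := inward_opp zE no (end_inward e Ai).
have [_ cF] := hF.
have [r' [u' [r0' g0 u0' d1 H]]] := germ_facts (std_germP hg).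
have r00 : `|0 : R| < r' by rewrite normr0.
have [cg _ _ _ _] := H 0 r00.
have d0 : - d != 0 by rewrite -normc_gt0 d1.
have [j jm Hj] : exists2 j, (j < m)%N & forall e, 0 < e -> exists2 s, 0 < s < e &
    fimg (F j) (std_germ T z (- d) s).
  apply: frequently_fin => e1 e10.
  have [s [s0 se sr]] := exists_pos_lt2 e10 r0.
  exists s; first by rewrite s0.
  by apply/cF/hr; rewrite (ltW s0) ltW.
have dE : d = u i t \/ d = - u i t.
  by rewrite /d /end_dir -/t; case: (e); rewrite ?mulN1r ?mul1r; [right|left].
rewrite u0' in cg.
have [ij|ij] := eqVneq i j; last first.
  apply: (min_hit_no cg g0 d1 im jm ij tI erefl _ Hj).
  by case: dE => dE; [right | left]; rewrite -/d dE ?opprK.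
rewrite -ij in Hj.
have [t' [tI' gt' dd]] := @curve_hits_arc R _ _ (u i) z (- d) _ _ cg g0 d0
  (fun t ht => nice_cder (nice_on_dir ni ht))
  (fun t ht => nice_neq0 (nice_on_dir ni ht))
  (arc_injective sT1 Ai) Hj.
have tt : t' = t by apply: (arc_injective sT1 Ai) => //; rewrite gt'.
have nt := nice_on_dir ni tI; have un : u i t != 0 := nice_neq0 nt.
have E : dirn (u i t) = u i t by apply: dirn_unit; exact: nice_norm1 nt.
have self (w : C) : w != 0 -> - w = w -> False.
  move=> w0 /eqP; rewrite eq_sym -subr_eq0 opprK -mulr2n mulrn_eq0 /=.
  by rewrite (negPf w0).
rewrite tt E (dirn_unit d1) in dd.
move: dd; rewrite /d /end_dir -/t -/(u i t); clear nt E.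
move: (u i t) un => w un; rewrite /t /end_par.
case: (e) => -[[lt dd]|[lt dd]].
- by move: lt; rewrite ltxx.
- by move: dd; rewrite mulN1r opprK => dd; exact: self _ un (esym dd).
- by move: dd; rewrite mul1r => dd; exact: self _ un dd.
- by move: lt; rewrite ltxx.
Qed.

Lemma min_end_inj i j (e e' : bool) : (i < m)%N -> (j < m)%N ->
  end_pt (F i) e = end_pt (F j) e' -> end_dir (F i) e = end_dir (F j) e' ->
  (i, e) = (j, e').
Proof.
move=> im jm pE dE; have Ai := F_arc im; have Aj := F_arc jm.
have [ij|ij] := eqVneq i j.
  rewrite -ij in pE *; congr (_, _).
  have := arc_injective sT1 Ai (end_par_in e Ai) (end_par_in e' Ai) pE.
  have [ab _ _] := Ai; rewrite /end_par; case: e e' {pE dE} => -[] // E.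
    by move: ab; rewrite E ltxx.
  by move: ab; rewrite E ltxx.
exfalso; apply: (min_no_merge im jm ij (end_par_in e Ai) (end_par_in e' Aj) pE
  (end_nice e Ai) (end_nice e' Aj)).
move: dE; rewrite /end_dir; case: (e); case: (e'); rewrite ?mulN1r ?mul1r.
- by move/oppr_inj => ->; left.
- by move=> <-; right; rewrite opprK.
- by move=> ->; right.
- by move=> ->; left.
Qed.

End Minimal.

(** * Arbitrary analytic arcs *)

Section AnalyticArcs.
Variable R : realType.
Local Notation C := R[i].
Implicit Types (s t x y : R) (z d : C).

Lemma sqr_le_exp2 n : (n.+1 ^ 2 <= 4 * 2 ^ n)%N.
Proof.
elim: n => [//|n IH]; rewrite expnS.
case: n IH => [//|[//|n]] IH; move: IH; rewrite !expnS !expn0; nia.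
Qed.

(** A convergent power series is differentiable at its centre. *)
Lemma real_analytic_derive (f : R -> R) t : real_analytic_at f t ->
  exists l, is_derive t (1 : R) f l.
Proof.
move=> [a /nbhs_ballP[del /= del0 Ha]].
have ha x : `|x| < del -> pseries a x @ \oo --> f (t + x).
  move=> xd; have := Ha (t + x); rewrite /ball /= opprD addNKr normrN => /(_ xd).
  by rewrite addrAC subrr add0r.
pose x1 := del / 2.
have x10 : 0 < x1 by rewrite divr_gt0.
have x1d : `|x1| < del by rewrite gtr0_norm // /x1; lra.
have cv : cvgn (pseries a x1) by apply/cvg_ex; exists (f (t + x1)); exact: ha.
have [M [_ HM]] := cvg_series_bounded cv.
have {}HM n : `|a n * x1 ^+ n| <= `|M| + 1.
  have hM : M < `|M| + 1 by rewrite (le_lt_trans (ler_norm M)) // ltrDl.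
  exact: (HM _ hM n).
have M0 : 0 <= `|M| + 1 by rewrite addr_ge0.
pose r := 2 / x1.
have r0 : 0 < r by rewrite divr_gt0.
have hb n : normc ((a n)%:C : C) <= (4 * (`|M| + 1)) * r ^+ n * wt R n.
  rewrite normcR.
  have xn : 0 < x1 ^+ n by rewrite exprn_gt0.
  have : `|a n| <= (`|M| + 1) / x1 ^+ n.
    by rewrite ler_pdivlMr // -(gtr0_norm xn) -normrM.
  move=> h; apply: le_trans h _.
  rewrite /r (expr_div_n 2 x1) /wt.
  have -> : 4 * (`|M| + 1) * (2 ^+ n / x1 ^+ n) / n.+1%:R ^+ 2 =
     (`|M| + 1) / x1 ^+ n * (4 * 2 ^+ n / n.+1%:R ^+ 2) by ring.
  rewrite ler_peMr ?divr_ge0 ?(ltW xn) // ler_pdivlMr ?exprn_gt0 // mul1r.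
  by rewrite -!natrX -natrM ler_nat sqr_le_exp2.
have z2 : `|0 : R| * r < 2^-1 by rewrite normr0 mul0r invr_gt0.
have cp := psum_cder r0 hb z2.
set l := psum _ 0 in cp.
have cf : cder (fun x => (f (t + x))%:C) 0 l.
  apply: cder_near_eps del0 _ cp => x; rewrite subr0 => xd.
  rewrite /psum /=; congr (_ +i* _); first exact: (cvg_lim _ (ha x xd)).
  have -> : pseries (fun=> (0 : R)) x = (fun=> 0).
    by apply/funext => k; rewrite /pseries /series /= big1 // => i _; rewrite mul0r.
  exact: lim_cst.
have cs : cder (fun s => (f (t + (- t + s)))%:C) t l.
  by apply: (cder_shift (g := fun x => (f (t + x))%:C)); rewrite addNr.
have [h _] := cs; exists (Re l); move: h => /=.
by congr (is_derive _ _ _ _); apply/funext => s; rewrite addNKr.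
Qed.

Lemma analytic_param_cder (g : R -> C) t : analytic_jordan_param g -> 0 <= t <= 1 ->
  cder g t (curve_derive g t) /\ curve_derive g t != 0.
Proof.
move=> [_ H] tI; have [|h1 h2 h3] := H t; first by rewrite in_itv.
split => //; have [l1 d1] := real_analytic_derive h1.
have [l2 d2] := real_analytic_derive h2.
have c : cder g t (l1 +i* l2) by split.
by rewrite (cder_curve_derive c).
Qed.

Lemma analytic_param_inj (g : R -> C) : analytic_jordan_param g ->
  forall x y, 0 <= x <= 1 -> 0 <= y <= 1 -> g x = g y -> x = y.
Proof. by move=> [[inj _ _] _] x y hx hy; apply: inj; rewrite in_itv. Qed.

Lemma arc_imageE (g : R -> C) z : arc_image g z <-> exists2 t, 0 <= t <= 1 & g t = z.
Proof.
split=> [[t /itvP ht <-]|[t ht <-]]; first by exists t => //; rewrite !ht.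
by exists t => //=; rewrite in_itv.
Qed.

Lemma inverse_imageE (T : {poly C}) z : inverse_image_segment T z <-> in_E T z.
Proof.
split=> [[x /itvP hx hE]|[h1 h2]].
  by rewrite /in_E -hE /= !hx.
exists (Re T.[z]); first by rewrite /= in_itv.
by rewrite (Im0_real h1).
Qed.

Definition ends nu (g : 'I_nu -> R -> C) : seq C :=
  flatten [seq [:: g k 0; g k 1] | k <- enum 'I_nu].

Definition end_index nu : seq ('I_nu * bool) :=
  [seq (k, e) | k <- enum 'I_nu, e <- [:: false; true]].

Lemma end_index_uniq nu : uniq (end_index nu).
Proof. by apply: allpairs_uniq => //; [exact: enum_uniq | move=> [? ?] [? ?]]. Qed.

Lemma mem_end_index nu p : p \in end_index nu.
Proof.
case: p => k e; apply/allpairsP; exists (k, e); split => //=; first by rewrite mem_enum.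
by case: e; rewrite !inE.
Qed.

Lemma ends_map nu (g : 'I_nu -> R -> C) :
  ends g = [seq g p.1 (if p.2 then 1 else 0) | p <- end_index nu].
Proof.
rewrite /ends /end_index; elim: (enum 'I_nu) => //= k s ->.
by [].
Qed.

Lemma size_ends nu (g : 'I_nu -> R -> C) : size (ends g) = (2 * nu)%N.
Proof.
by rewrite ends_map size_map /end_index size_allpairs size_enum_ord mulnC.
Qed.

Lemma count_ends nu (g : 'I_nu -> R -> C) z :
  count_mem z (ends g) =
  size [seq p <- end_index nu | g p.1 (if p.2 then 1 else 0) == z].
Proof. by rewrite ends_map count_map size_filter. Qed.

End AnalyticArcs.

Section LowerBound.
Variable R : realType.
Local Notation C := R[i].
Variables (T : {poly C}) (n : nat).
Hypothesis sT : size T = n.+1.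
Hypothesis n0 : (0 < n)%N.
Implicit Types (s t x y : R) (z d : C).

Lemma odd_zero_value z : odd_zero T z -> exists x0 : R, T.[z] = x0%:C /\ `|x0| = 1.
Proof.
move=> oz.
have [h|h1] := eqVneq T.[z] 1; first by exists 1; rewrite h normr1.
have [h|h2] := eqVneq T.[z] (-1).
  by exists (-1); rewrite h normrN1; split => //; rewrite rmorphN1.
by move: oz; rewrite /odd_zero mup_interior.
Qed.

(** Both senses of the tangent line would be inward by [E_direction]. *)
Lemma no_pass (g : R -> C) t d z e : cder g t d -> d != 0 -> g t = z -> odd_zero T z ->
  0 < e -> (forall s, `|s - t| < e -> in_E T (g s)) -> False.
Proof.
move=> cg d0 gt oz e0 gE.
have zE : in_E T z by rewrite -gt; apply: gE; rewrite subrr normr0.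
have small e1 : 0 < e1 -> exists2 s, 0 < s < e1 & s < e.
  by move=> e10; have [s [s0 s1 s2]] := exists_pos_lt2 e10 e0; exists s; rewrite ?s0.
have cr : cder (fun s => g (t + s)) 0 d by apply: cder_shift; rewrite addr0.
have cl : cder (fun s => g (t - s)) 0 (- d).
  have cg' : cder (fun s => g (t + s)) (- 0) d by apply: cder_shift; rewrite oppr0 addr0.
  exact: (cder_rev cg').
have ir : inward T z (dirn d).
  apply: (E_direction sT n0 cr); rewrite ?addr0 // => e1 /small[s /andP[s0 se1] se].
  exists s; first by rewrite s0.
  by apply: gE; rewrite addrAC subrr add0r gtr0_norm.
have il : inward T z (- dirn d).
  have -> : - dirn d = dirn (- d) by rewrite /dirn normcN mulNr.
  apply: (E_direction sT n0 cl); rewrite ?subr0 ?oppr_eq0 // => e1 /small[s /andP[s0 se1] se].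
  exists s; first by rewrite s0.
  by apply: gE; rewrite addrAC subrr sub0r normrN gtr0_norm.
exact (inward_not_opp sT n0 zE oz ir il).
Qed.

(** E leaves z in as many directions as the multiplicity of z.  Each of them is
    the direction of an arc at z, and by [no_pass] this arc ends there; an end
    determines its direction. *)
Lemma odd_lower nu (g : 'I_nu -> R -> C) :
  (forall k, analytic_jordan_param (g k)) ->
  (forall z, in_E T z <-> exists k, arc_image (g k) z) ->
  forall z, odd_zero T z -> (mup z (T ^+ 2 - 1) <= count_mem z (ends g))%N.
Proof.
move=> ga gE z oz.
have [x0 [Tz x01]] := odd_zero_value oz.
have [k [V lf]] := local_form_exists z (size_gt1 sT n0); have [k0 _ V0] := lf.
rewrite (mup_boundary Tz x01 lf) count_ends.
have nx1 : normc ((- x0)%:C : C) = 1 by rewrite normcR normrN.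
have [ds [uds sds dsP]] := direction_list k0 V0 nx1.
have hin h : 0 <= h < 1 -> -1 <= x0 + - x0 * h <= 1.
  by move=> /andP[h1 h2]; case: (normr1P x01) => ->; apply/andP; split;
    move: h1 h2; clear -sT n0; lra.
pose edir (p : 'I_nu * bool) : C :=
  (if p.2 then -1 else 1) * dirn (curve_derive (g p.1) (if p.2 then 1 else 0)).
have key d : exists p : option ('I_nu * bool), d \in ds ->
    exists2 q, p = Some q & g q.1 (if q.2 then 1 else 0) = z /\ d = edir q.
  have [dd|] := boolP (d \in ds); last by exists None.
  have [d1 VE] := dsP d dd.
  have [g0 hg] : exists g0, germ T z d g0.
    by apply: germ_exists lf d1 _; rewrite VE -rmorphM.
  have [_ [r r0 hr]] := germ_inward (sg := - x0) hg lf VE Tz ltr01 hin.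
  have [r' [u' [r0' f0 u0' _ H]]] := germ_facts (std_germP hg).
  have r00 : `|0 : R| < r' by rewrite normr0.
  have [cf _ _ _ _] := H 0 r00; rewrite u0' in cf.
  pose gi (i : nat) := if insub i is Some k then g k else fun=> 0.
  have giE (i : 'I_nu) : gi i = g i by rewrite /gi valK.
  have [i im Hi] : exists2 i, (i < nu)%N & forall e, 0 < e -> exists2 s, 0 < s < e &
      arc_image (gi i) (std_germ T z d s).
    apply: frequently_fin => e e0.
    have [s [s0 se sr]] := exists_pos_lt2 e0 r0; exists s; first by rewrite s0.
    have /gE[i hi] : in_E T (std_germ T z d s) by apply: hr; rewrite !ltW.
    by exists i => //; rewrite giE.
  pose i' := Ordinal im; have gE' : gi i = g i' by rewrite -giE.
  rewrite gE' in Hi.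
  have cgi t : 0 <= t <= 1 -> cder (g i') t (curve_derive (g i') t).
    by move=> ht; have [] := analytic_param_cder (ga i') ht.
  have ngi t : 0 <= t <= 1 -> curve_derive (g i') t != 0.
    by move=> ht; have [] := analytic_param_cder (ga i') ht.
  have d0 : d != 0 by rewrite -normc_gt0 d1.
  have Hi' e : 0 < e -> exists2 s, 0 < s < e & exists2 t, 0 <= t <= 1 & g i' t = std_germ T z d s.
    by move=> /Hi[s hs /arc_imageE ht]; exists s.
  have [t [tI gt dE]] := curve_hits_arc cf f0 d0 cgi ngi (analytic_param_inj (ga i')) Hi'.
  rewrite (dirn_unit d1) in dE.
  have ntI : t == 0 \/ t == 1.
    apply: contrapT => nt; have {}nt : t != 0 /\ t != 1.
      by split; apply/negP => h; apply: nt; [left|right].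
    have [t0' t1'] := nt; have [/andP[ta tb]] := tI.
    have ta' : 0 < t by rewrite lt_neqAle eq_sym t0'.
    have tb' : 0 < 1 - t by rewrite subr_gt0 lt_neqAle t1'.
    have m0 : 0 < Num.min t (1 - t) by rewrite lt_min ta'.
    apply: (no_pass (cgi t tI) (ngi t tI) gt oz m0) => s.
    rewrite lt_min !ltr_norml => /andP[/andP[h1 h2] /andP[h3 h4]].
    apply/gE; exists i'; apply/arc_imageE; exists s => //.
    by apply/andP; split; [move: h1|move: h4]; clear -sT n0; lra.
  case: ntI => /eqP tE; rewrite tE in gt dE.
    exists (Some (i', false)) => _; exists (i', false) => //; split => //.
    rewrite /edir /= mul1r; case: dE => [[_ ->] //|[]].
    by rewrite ltxx.
  exists (Some (i', true)) => _; exists (i', true) => //; split => //.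
  rewrite /edir /= mulN1r; case: dE => [[]|[_ ->] //].
  by rewrite ltxx.
have [f fP] := choice key.
rewrite -sds -(size_map f) -(size_map Some [seq p <- _ | _]).
apply: uniq_leq_size.
  rewrite map_inj_in_uniq // => d d' dd dd' E.
  have [q fq [_ ->]] := fP d dd; have [q' fq' [_ ->]] := fP d' dd'.
  by move: E; rewrite fq fq' => -[->].
move=> p /mapP[d dd ->]; have [q -> [gq _]] := fP d dd.
by apply: map_f; rewrite mem_filter gq eqxx mem_end_index.
Qed.

End LowerBound.

(** * The decomposition of E and the main theorem *)

Section Decomposition.
Variable R : realType.
Local Notation C := R[i].
Variables (T : {poly C}) (n : nat).
Hypothesis sT : size T = n.+1.
Hypothesis n0 : (0 < n)%N.
Implicit Types (s t x y : R) (z d : C).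

Definition unit_param (A : arc_data R) (s : R) : C := A.1.1 (A.1.2 + (A.2 - A.1.2) * s).

Lemma unit_param0 A : unit_param A 0 = end_pt A false.
Proof. by rewrite /unit_param mulr0 addr0. Qed.

Lemma unit_param1 A : unit_param A 1 = end_pt A true.
Proof. by rewrite /unit_param mulr1 addrC subrK. Qed.

Lemma unit_param_in A s : is_arc T A -> 0 <= s <= 1 ->
  A.1.2 <= A.1.2 + (A.2 - A.1.2) * s <= A.2.
Proof.
move=> [ab _ _] /andP[s0 s1]; have l0 : 0 < A.2 - A.1.2 by rewrite subr_gt0.
rewrite lerDl mulr_ge0 ?(ltW l0) //= -lerBrDl.
by rewrite ger_pMr.
Qed.

Lemma unit_param_image A z : is_arc T A -> arc_image (unit_param A) z <-> fimg A z.
Proof.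
move=> hA; have [ab _ _] := hA; have l0 : 0 < A.2 - A.1.2 by rewrite subr_gt0.
split=> [/arc_imageE[s sI <-]|[t /andP[t1 t2] <-]].
  by exists (A.1.2 + (A.2 - A.1.2) * s) => //; exact: unit_param_in.
apply/arc_imageE; exists ((t - A.1.2) / (A.2 - A.1.2)).
  apply/andP; split; last by rewrite ler_pdivrMr // mul1r lerD2r.
  by rewrite divr_ge0 ?(ltW l0) // subr_ge0.
by rewrite /unit_param mulrCA mulfV ?gt_eqF // mulr1 addrC subrK.
Qed.

Lemma unit_param_analytic A : is_arc T A -> analytic_jordan_param (unit_param A).
Proof.
move=> hA; have [ab ng gE] := hA.
have sT1 := size_gt1 sT n0.
set a := A.1.2; set L := A.2 - a.
have L0 : 0 < L by rewrite subr_gt0.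
have nt s : 0 <= s <= 1 -> nice_at T A.1.1 (a + L * s) (curve_derive A.1.1 (a + L * s)).
  by move=> sI; exact: nice_on_dir ng (unit_param_in hA sI).
have cd s : 0 <= s <= 1 ->
    cder (unit_param A) s (L%:C * curve_derive A.1.1 (a + L * s)).
  by move=> sI; apply: cder_comp_affine; exact: nice_cder (nt s sI).
split.
  split.
  - move=> x y; rewrite !in_itv /= => xI yI E.
    have := arc_injective sT1 hA (unit_param_in hA xI) (unit_param_in hA yI) E.
    by move=> /addrI /mulfI; apply; rewrite gt_eqF.
  - apply: derivable_within_continuous => s /itvP hs.
    have sI : 0 <= s <= 1 by rewrite !hs.
    by have [[h _] _] := cd s sI.
  - apply: derivable_within_continuous => s /itvP hs.
    have sI : 0 <= s <= 1 by rewrite !hs.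
    by have [_ [h _]] := cd s sI.
move=> t /itvP ht; have tI : 0 <= t <= 1 by rewrite !ht.
have ntt := nt t tI.
have [_ [e e0 he]] := ntt.
have [r [u [zeta [eta [c [k [V [rho [[r0 _ _ _] _ _ _ hc]]]]]]]]] := nice_germ ntt.
have m0 : 0 < Num.min e r / L by rewrite divr_gt0 // lt_min e0.
have ser s : `|s - t| < Num.min e r / L ->
    [/\ `|L * (s - t)| < r & unit_param A s =
      std_germ T (A.1.1 (a + L * t)) (curve_derive A.1.1 (a + L * t)) (L * (s - t))].
  rewrite ltr_pdivlMr // mulrC -{1}(gtr0_norm L0) -normrM lt_min => /andP[h1 h2].
  split => //; rewrite -he // /unit_param -/a -/L; congr (A.1.1 _); ring.
have scale (b : nat -> R) x : pseries (fun m => b m * L ^+ m) x = pseries b (L * x).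
  rewrite /pseries; congr (series _); apply/funext => m /=.
  by rewrite exprMn mulrA.
split.
- exists (fun m => Re (c m) * L ^+ m); apply/nbhs_ballP.
  exists (Num.min e r / L) => // s; rewrite /ball /= distrC => /ser[h1 ->].
  by rewrite scale; have [] := hc _ h1.
- exists (fun m => Im (c m) * L ^+ m); apply/nbhs_ballP.
  exists (Num.min e r / L) => // s; rewrite /ball /= distrC => /ser[h1 ->].
  by rewrite scale; have [] := hc _ h1.
- rewrite (cder_curve_derive (cd t tI)) mulf_neq0 ?(nice_neq0 ntt) //.
  by rewrite -normc_gt0 normcR normr_gt0 gt_eqF.
Qed.

Definition odd_mult z : nat := if odd_zero T z then mup z (T ^+ 2 - 1) else 0%N.

Lemma lists_oddE b : lists_odd_zeros (T ^+ 2 - 1) b <-> forall z, count_mem z b = odd_mult z.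
Proof. by []. Qed.

Lemma mem_segment (E : set C) nu (g : 'I_nu -> R -> C) :
  E = \bigcup_(k in [set: 'I_nu]) arc_image (g k) ->
  forall z, E z <-> exists k, arc_image (g k) z.
Proof.
by move=> -> z; split=> [[k _ h]|[k h]]; exists k.
Qed.

(** The covering by the least number of arcs is such a decomposition.  By
    [min_end_odd] its ends are zeros of odd multiplicity.  Those at a given
    zero have different inward directions, and the inward directions at a zero
    of multiplicity m satisfy an equation d^m = const; [odd_lower] gives the
    converse bound. *)
Lemma odd_decomposition : exists nu b,
  consists_of_analytic_arcs (inverse_image_segment T) nu b /\
  lists_odd_zeros (T ^+ 2 - 1) b.
Proof.
have [m [F [hF minF]]] := minimal_family sT n0.
have [Farc Fcov] := hF.
pose g (k : 'I_m) := unit_param (F k).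
have ga k : analytic_jordan_param (g k) by apply: unit_param_analytic; exact: Farc.
have gim (k : 'I_m) z : arc_image (g k) z <-> fimg (F k) z.
  by apply: unit_param_image; exact: Farc.
have gE z : in_E T z <-> exists k, arc_image (g k) z.
  split=> [/Fcov[i im h]|[k /gim[t tI <-]]].
    by exists (Ordinal im); apply/gim.
  by have [_ _ h] := Farc k (ltn_ord k); exact: h.
have gend (p : 'I_m * bool) : g p.1 (if p.2 then 1 else 0) = end_pt (F p.1) p.2.
  by case: p => k [] /=; rewrite /g ?unit_param1 ?unit_param0.
exists m, (ends g); split.
  exists g; split => //.
  - apply/seteqP; split => z.
      by move=> /inverse_imageE /gE[k h]; exists k.
    by move=> [k _ h]; apply/inverse_imageE/gE; exists k.
  - move=> k l kl; have -> : arc_image (g k) `&` arc_image (g l) =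
        fimg (F k) `&` fimg (F l).
      by apply/seteqP; split => z [/gim h1 /gim h2].
    exact (min_finite sT n0 hF minF (ltn_ord k) (ltn_ord l) kl).
apply/lists_oddE => z; rewrite /odd_mult.
have [oz|noz] := boolP (odd_zero T z); last first.
  rewrite count_ends; apply/eqP; rewrite size_eq0 -[_ == _]negbK -has_filter.
  apply/hasPn => p _; rewrite gend; apply: contra noz => /eqP <-.
  exact (min_end_odd sT n0 hF minF _ (ltn_ord p.1)).
apply/eqP; rewrite eqn_leq (odd_lower sT n0 ga gE oz) andbT.
have [x0 [Tz x01]] := odd_zero_value oz.
have [k [V lf]] := local_form_exists z (size_gt1 sT n0); have [k0 _ V0] := lf.
rewrite (mup_boundary Tz x01 lf) count_ends.
pose ed (p : 'I_m * bool) := end_dir (F p.1) p.2.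
rewrite -(size_map ed); apply: (direction_bound k0 V0 (w := (normc V.[z])%:C * (- x0)%:C)).
  rewrite map_inj_in_uniq; first exact: filter_uniq (end_index_uniq m).
  move=> [i e] [j e']; rewrite !mem_filter !gend /= => /andP[/eqP pz _] /andP[/eqP pz' _] E.
  have := min_end_inj sT n0 hF minF (ltn_ord i) (ltn_ord j) (etrans pz (esym pz')) E.
  by move=> [/val_inj -> ->].
move=> d /mapP[p]; rewrite mem_filter gend => /andP[/eqP pz _] ->.
apply: (inward_sign _ Tz x01 lf); rewrite -pz.
exact: end_inward (Farc _ (ltn_ord p.1)).
Qed.

Lemma analytic_arcs_count nu b z :
  consists_of_analytic_arcs (inverse_image_segment T) nu b ->
  (odd_mult z <= count_mem z b)%N /\ size b = (2 * nu)%N.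
Proof.
move=> [g [ga gU _ bE]].
have gE w : in_E T w <-> exists k, arc_image (g k) w.
  by rewrite -inverse_imageE (mem_segment gU).
split; last by rewrite (perm_size bE) -(size_ends g).
rewrite /odd_mult; case: ifP => // oz.
by rewrite (permP bE); exact (odd_lower sT n0 ga gE oz).
Qed.

End Decomposition.

Theorem theorem1 (R : realType) (n : nat) (hn : (1 <= n)%N) (T : {poly R[i]})
    (hT : size T = n.+1) (nu : nat) (hnu : (1 <= nu)%N)
    (b : (2 * nu).-tuple R[i]) :
  consists_of_no_less_analytic_arcs (inverse_image_segment T) nu b <->
  lists_odd_zeros (T ^+ 2 - 1) b.
Proof.
have [nu0 [b0 [arcs0 odd0]]] := odd_decomposition hT hn.
have c0 z : count_mem z b0 = odd_mult T z by exact: odd0.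
have [_ s0] := analytic_arcs_count hT hn 0 arcs0.
(* the zeros of odd multiplicity occur among the ends of any decomposition *)
have sub m c : consists_of_analytic_arcs (inverse_image_segment T) m c ->
    exists2 s, subseq s c & perm_eq b0 s.
  move=> arcs; apply/count_subseqP => z; rewrite c0.
  by have [] := analytic_arcs_count hT hn z arcs.
have sub_size m c : consists_of_analytic_arcs (inverse_image_segment T) m c ->
    (nu0 <= m)%N.
  move=> arcs; have [s sc bs] := sub m c arcs.
  have [_ sc'] := analytic_arcs_count hT hn 0 arcs.
  by rewrite -(leq_pmul2l (ltn0Sn 1)) -s0 -sc' (perm_size bs) size_subseq.
split=> [[arcs least]|oddb].
- have nn : nu = nu0.
    apply/eqP; rewrite eqn_leq (sub_size _ _ arcs) andbT leqNgt; apply/negP => lt.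
    exact: least lt arcs0.
  have [s sb bs] := sub nu b arcs.
  have sE : s = b.
    apply/eqP; rewrite -(size_subseq_leqif sb) -(perm_size bs) s0 size_tuple nn.
    by [].
  by move=> z; rewrite -(permP (perm_trans bs _) (pred1 z)) // ?sE // c0.
- have pb : perm_eq b b0.
    by apply/allP => z _ /=; rewrite oddb c0.
  have nn : nu = nu0.
    apply/eqP; rewrite -(eqn_pmul2l (ltn0Sn 1)) -s0 -(perm_size pb) size_tuple.
    by [].
  split.
    rewrite -nn in arcs0; have [g [h1 h2 h3 h4]] := arcs0.
    by exists g; split => //; exact: perm_trans pb h4.
  by move=> m c lt /sub_size; rewrite leqNgt -nn lt.
Qed.
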